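(* Let $u,v\in\mathbb{R}^2$ satisfy $|\sigma(u,v)|=1$, and write $\nu=\alpha u+\beta v$ with $\alpha,\beta\in\mathbb{R}$. Assume that the four points $0,u,v,\nu$ are distinct and that $$\dim_{\mathbb{Q}}\operatorname{span}_{\mathbb{Q}}\{1,\alpha,\beta\}=2.$$ Then, for every nonzero $f\in L^2(\mathbb{R})$ (complex-valued), the four vectors $$f,\qquad \pi(u)f,\qquad \pi(v)f,\qquad \pi(\nu)f$$ are linearly independent over $\mathbb{C}$ in $L^2(\mathbb{R})$.
   Context: For $(x,\omega),(y,\eta)\in\mathbb{R}^2$, $\sigma((x,\omega),(y,\eta))=x\eta-y\omega$ is the standard symplectic form. For $(x,\omega)\in\mathbb{R}^2$ the time-frequency shift $\pi(x,\omega)$ is the unitary operator on $L^2(\mathbb{R})$ given by $\pi(x,\omega)f(t)=e^{-2\pi i\omega t}f(t-x)$. The span in the hypothesis is the $\mathbb{Q}$-linear span inside $\mathbb{R}$. *)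

(* Defs.v *)
From HB Require Import structures.
From mathcomp Require Import all_boot all_order all_algebra.
From mathcomp Require Import all_classical all_reals all_analysis.
From mathcomp Require Import complex.

Set Implicit Arguments.
Unset Strict Implicit.
Unset Printing Implicit Defensive.

Import Order.TTheory GRing.Theory Num.Theory.
Import numFieldNormedType.Exports.

Local Open Scope classical_set_scope.
Local Open Scope ring_scope.
Local Open Scope complex_scope.

Section Phase_plane.
Context {R : realType}.
Implicit Types (u v z : R * R).

Definition symplectic u v : R := u.1 * v.2 - v.1 * u.2.

Definition expi (theta : R) : R[i] := cos theta +i* sin theta.

Definition tfshift z (f : R -> R[i]) : R -> R[i] :=
  fun t => expi (- (2 * pi * z.2 * t)) * f (t - z.1).

End Phase_plane.

Section Complex_L2.
Context {R : realType}.
Local Notation mu := (@lebesgue_measure R).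

(* The vectors of L^2(R) are represented by square-integrable functions, and
   equality of vectors is equality almost everywhere. *)
Definition L2fun (f : R -> R[i]) : Prop :=
  [/\ measurable_fun setT (fun t => complex.Re (f t)),
      measurable_fun setT (fun t => complex.Im (f t)) &
      (\int[mu]_t (ComplexField.Normc.normc (f t) ^+ 2)%:E < +oo)%E].

Definition L2eq (f g : R -> R[i]) : Prop := f = g %[ae mu].

Definition L2free n (F : n.-tuple (R -> R[i])) : Prop :=
  forall c : 'I_n -> R[i],
    L2eq (fun t => \sum_(i < n) c i * tnth F i t) (fun=> 0) ->
    forall i, c i = 0.

End Complex_L2.

Section Rational_span.
Context {R : realType}.

Definition Qcomb n (b : n.-tuple R) (q : 'I_n -> rat) : R :=
  \sum_(i < n) ratr (q i) * tnth b i.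

Definition Qspan n (b : n.-tuple R) : set R := range (Qcomb b).

Definition Qfree n (b : n.-tuple R) : Prop :=
  forall q : 'I_n -> rat, Qcomb b q = 0 -> forall i, q i = 0.

Definition Qdim_eq (V : set R) (d : nat) : Prop :=
  exists b : d.-tuple R, Qfree b /\ Qspan b = V.

End Rational_span.

(* Main.v *)
Require Import Defs.
From HB Require Import structures.
From mathcomp Require Import all_boot all_order all_algebra.
From mathcomp Require Import all_classical all_reals all_analysis.
From mathcomp Require Import measurable_realfun.
From mathcomp Require Import complex ring lra zify.

(** Suppose that
    [c0 f + c1 pi(u) f + c2 pi(v) f + c3 pi(nu) f = 0] with [f] not null.

    If some coefficient vanishes, at most three points occur
    ([three_points_free]). Translating one point to the origin and making a second
    one vertical, the relation becomes [|f (t - s)| = |a + b e(kappa t)| |f t|],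
    where [e(x)] stands for [exp (2 pi i x)], unless [f] is a.e. annihilated by a
    nonzero trigonometric polynomial. Square integrability forces [f] to tend to
    zero along almost every orbit [t + Z s], in both directions; so the products
    of the multiplier become small to the past and large to the future, which
    contradicts the recurrence of rotations ([null_two_sided_decay]).

    If no coefficient vanishes, the hypothesis on the dimension gives an integer
    relation [k alpha + l beta = m], and the lattice generated by [u] and [v] has a
    basis [(Q, P)] with [nu = (p / d) Q + theta P] and [theta] irrational
    ([adapted_basis]). Chirps and the Fourier transform act on time-frequency
    shifts by shears and a quarter turn, up to unimodular factors, so [P] may be
    taken vertical and [Q] horizontal ([make_frame]). Put [Q = (s, 0)] and
    [P = (0, omega)]; then [omega s = 1] up to sign, so that [e(omega t)] is
    constant along the orbits of the translation by [s]. Solving the relation for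
    [pi(nu) f] and iterating it [d] times yields, for almost every [t], a relation
    for the sequence [x_n = f (t + n s)]: a polynomial [g_t] in the shift, applied
    to [x], is [z0 e(theta1 n) x] up to a translation, with [theta1] irrational
    and [z0 = e(theta2 omega t)].

    Iterate this [q] times, [q] being the denominator of a good rational
    approximation of [theta1]. The left-hand side becomes the action of a product
    of [q] rotated copies of [g_t]. In a product of [q] rotated copies of a factor
    [1 - r X] with [|r| < 1] the power sums that govern the coefficients nearly
    cancel, so by Newton's identities the product is close to [1]. Hence the roots
    of [g_t] inside the unit circle contribute only shifts, the others only
    scalars, and with [A t] the product of the leading coefficient and of the
    opposites of the outer roots one gets [(A t / z0) ^ q --> 1] along these [q]
    ([outer_value_limit]). Here the two-sided decay of [x] gives the maximum at
    which the two sides are compared.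

    The function [A] is algebraic over the polynomials in [e(omega t)]
    ([outer_algebraic]), and [theta2] is irrational, so [B = A / z0] is
    bi-Lipschitz on a set that is not null ([null_algebraic]). For [t] and [t'] at
    distance comparable to [1 / q] the powers [B t ^ q] and [B t' ^ q] then differ
    by a fixed amount; so the set where they are close to [1] for all large [q]
    misses an interval at each of these scales around each of its points, and is
    null by Lebesgue's density theorem ([null_bilipschitz], [vertical_four]).

    The Fourier transform of square-integrable functions is obtained from cosine
    and sine transforms of truncations. Weighting by [exp (- a xi)] turns the
    product of two transforms into a double integral against the Poisson kernel
    ([poisson_identity]); this identity gives both Plancherel's inequality
    ([plancherel_le]) and injectivity ([transform_injective]). *)

Set Implicit Arguments.
Unset Strict Implicit.
Unset Printing Implicit Defensive.

Import Order.TTheory GRing.Theory Num.Theory.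
Import numFieldNormedType.Exports.

Local Open Scope classical_set_scope.
Local Open Scope ring_scope.

Local Notation nrm := ComplexField.Normc.normc.

(** * Moduli of complex numbers *)

Section Modulus.
Context {R : realType}.
Implicit Types x y z : R[i].

Lemma nrmE x : nrm x = Num.sqrt (complex.Re x ^+ 2 + complex.Im x ^+ 2).
Proof. by case: x. Qed.

Lemma nrm_ge0 x : 0 <= nrm x.
Proof. by rewrite nrmE sqrtr_ge0. Qed.

Lemma sqr_nrm x : nrm x ^+ 2 = complex.Re x ^+ 2 + complex.Im x ^+ 2.
Proof. by rewrite nrmE sqr_sqrtr// addr_ge0// sqr_ge0. Qed.

Lemma nrm0 : nrm (0 : R[i]) = 0.
Proof. exact: ComplexField.Normc.normc0. Qed.

Lemma nrm1 : nrm (1 : R[i]) = 1.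
Proof. exact: ComplexField.Normc.normc1. Qed.

Lemma nrm_eq0 x : (nrm x == 0) = (x == 0).
Proof.
apply/eqP/eqP => [|->]; last exact: nrm0.
exact: ComplexField.Normc.eq0_normc.
Qed.

Lemma nrm_gt0 x : (0 < nrm x) = (x != 0).
Proof. by rewrite lt_def nrm_eq0 nrm_ge0 andbT. Qed.

Lemma nrmM x y : nrm (x * y) = nrm x * nrm y.
Proof. exact: ComplexField.Normc.normcM. Qed.

Lemma nrmV x : nrm x^-1 = (nrm x)^-1.
Proof. exact: ComplexField.Normc.normcV. Qed.

Lemma nrmN x : nrm (- x) = nrm x.
Proof. exact: normcN. Qed.

Lemma nrmD x y : nrm (x + y) <= nrm x + nrm y.
Proof. exact: le_normcD. Qed.

Lemma nrmB x y : nrm (x - y) = nrm (y - x).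
Proof. by rewrite -nrmN opprB. Qed.

Lemma nrmBD x y : nrm (x - y) <= nrm x + nrm y.
Proof. by rewrite -(nrmN y) nrmD. Qed.

Lemma nrm_rev x y : nrm x - nrm y <= nrm (x - y).
Proof. by rewrite lerBlDr; apply: le_trans (nrmD _ _); rewrite subrK. Qed.

Lemma nrm_tri x y z : nrm (x - z) <= nrm (x - y) + nrm (y - z).
Proof. by apply: le_trans (nrmD _ _); rewrite addrA subrK. Qed.

Lemma nrmX x n : nrm (x ^+ n) = nrm x ^+ n.
Proof. by elim: n => [|n IH]; rewrite ?expr0 ?nrm1// !exprS nrmM IH. Qed.

Lemma nrm_sum (I : Type) (r : seq I) (P : pred I) (F : I -> R[i]) :
  nrm (\sum_(i <- r | P i) F i) <= \sum_(i <- r | P i) nrm (F i).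
Proof.
elim/big_ind2 : _ => [|x a y b ha hb|//]; first by rewrite nrm0.
by apply: le_trans (nrmD _ _) _; apply: lerD.
Qed.

Lemma nrm_real (a : R) : nrm (a%:C)%C = `|a|.
Proof. by rewrite nrmE /= expr0n addr0 sqrtr_sqr. Qed.

Lemma nrm_nat n : nrm (n%:R : R[i]) = n%:R.
Proof. by rewrite -(rmorph_nat (real_complex R)) nrm_real normr_nat. Qed.

Lemma le_Re_nrm x : `|complex.Re x| <= nrm x.
Proof. by rewrite -sqrtr_sqr nrmE ler_wsqrtr// lerDl sqr_ge0. Qed.

Lemma le_Im_nrm x : `|complex.Im x| <= nrm x.
Proof. by rewrite -sqrtr_sqr nrmE ler_wsqrtr// lerDr sqr_ge0. Qed.

Lemma nrm_le_ReIm x : nrm x <= `|complex.Re x| + `|complex.Im x|.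
Proof.
rewrite -ler_sqr ?nnegrE ?nrm_ge0 ?addr_ge0// sqr_nrm sqrrD !real_normK ?num_real//.
by rewrite -addrA lerD2l lerDr mulrn_wge0// mulr_ge0.
Qed.

End Modulus.

(** * The character of the circle *)

Section Circle.
Context {R : realType}.
Implicit Types x y : R.

Definition cexp x : R[i] := expi (2 * pi * x).

Lemma expiD x y : expi (x + y) = expi x * expi y.
Proof. by rewrite /expi cosD sinD; apply/eqP; rewrite eq_complex /= !eqxx/= addrC. Qed.

Lemma cexpD x y : cexp (x + y) = cexp x * cexp y.
Proof. by rewrite /cexp mulrDr expiD. Qed.

Lemma cexp0 : cexp 0 = 1.
Proof. by rewrite /cexp mulr0 /expi cos0 sin0. Qed.

Lemma nrm_cexp x : nrm (cexp x) = 1.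
Proof. by rewrite nrmE /= cos2Dsin2 sqrtr1. Qed.

Lemma cexp_neq0 x : cexp x != 0.
Proof. by rewrite -nrm_gt0 nrm_cexp ltr01. Qed.

Lemma cexpN x : cexp (- x) = (cexp x)^-1.
Proof. by apply: (mulfI (cexp_neq0 x)); rewrite divff ?cexp_neq0// -cexpD subrr cexp0. Qed.

Lemma cexpB x y : cexp (x - y) = cexp x / cexp y.
Proof. by rewrite cexpD cexpN. Qed.

Lemma cexpMn x n : cexp (n%:R * x) = cexp x ^+ n.
Proof.
elim: n => [|n IH]; first by rewrite mul0r cexp0 expr0.
by rewrite -natr1 mulrDl mul1r cexpD IH exprSr.
Qed.

Lemma cexp1 : cexp 1 = 1.
Proof. by rewrite /cexp mulr1 /expi mulr_natl cos2pi sin2pi. Qed.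

Lemma cexp_nat n : cexp n%:R = 1.
Proof. by rewrite -(mulr1 n%:R) cexpMn cexp1 expr1n. Qed.

Lemma cexp_int (n : int) : cexp n%:~R = 1.
Proof. by case: n => n; rewrite ?NegzE ?mulrNz ?cexpN -?pmulrn cexp_nat ?invr1. Qed.

Lemma cexpMz x (n : int) : cexp (n%:~R * x) = cexp x ^ n.
Proof.
case: n => n; first by rewrite -pmulrn cexpMn.
by rewrite NegzE mulrNz mulNr cexpN -pmulrn cexpMn exprnN.
Qed.

Lemma cexp_eq1 x : cexp x = 1 -> exists n : int, x = n%:~R.
Proof.
move=> e1; exists (Num.floor x).
set y := x - (Num.floor x)%:~R.
have y1 : cexp y = 1 by rewrite cexpB e1 cexp_int divr1.
have y0 : 0 <= y by rewrite subr_ge0 floor_le.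
have yl : y < 1 by rewrite ltrBlDl; have := floorD1_gt x; rewrite intrD.
suff : y = 0 by move/eqP; rewrite subr_eq0 => /eqP.
move/eqP: y1; rewrite eq_complex /= => /andP[/eqP c1 _].
have p0 := pi_gt0 R.
have [yh|yh] := leP y (1/2).
  have : 2 * pi * y = 0.
    apply: cos_inj; rewrite ?cos0 // in_itv /= ?lexx ?pi_ge0//.
    by apply/andP; split; nra.
  by move/eqP; rewrite !mulf_eq0 (gt_eqF p0) pnatr_eq0/= => /eqP.
have : 2 * pi * (1 - y) = 0.
  apply: cos_inj; rewrite ?cos0 // ?in_itv /= ?lexx ?pi_ge0//.
    by apply/andP; split; nra.
  by rewrite mulrBr mulr1 cosB [2 * pi]mulr_natl cos2pi sin2pi mul0r addr0 mul1r -mulr_natl.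
by move/eqP; rewrite !mulf_eq0 (gt_eqF p0) pnatr_eq0/= => /eqP; lra.
Qed.

Lemma sin_le_id x : `|sin x| <= `|x|.
Proof.
wlog x0 : x / 0 <= x.
  move=> H; have [/H//|/ltW x0] := leP 0 x.
  by rewrite -normrN -sinN -[leRHS]normrN; apply: H; rewrite oppr_ge0.
have [->|xn0] := eqVneq x 0; first by rewrite sin0 normr0.
have xp : 0 < x by rewrite lt_def xn0.
have [|c _] := @MVT _ (@sin R) (@cos R) 0 x xp.
  by apply: continuous_subspaceT => z; exact: continuous_sin.
by rewrite sin0 !subr0 => ->; rewrite normrM ler_piMl// cos_max.
Qed.

Lemma nrm_expiB x y : nrm (expi x - expi y) <= `|x - y|.
Proof.
set m := (x + y) / 2; set h := (x - y) / 2.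
have -> : x = m + h by rewrite /m /h; field.
have -> : y = m - h by rewrite /m /h; field.
have -> : m + h - (m - h) = 2 * h by ring.
have -> : expi (m + h) - expi (m - h)
        = ((2 * sin h)%:C * ((- sin m) +i* cos m))%C.
  apply/eqP; rewrite eq_complex /= cosD cosB sinD sinB.
  by apply/andP; split; apply/eqP; ring.
rewrite nrmM nrm_real nrmE /= sqrrN addrC cos2Dsin2 sqrtr1 mulr1 2!normrM.
by rewrite ler_wpM2l// sin_le_id.
Qed.

Lemma nrm_cexpB x y : nrm (cexp x - cexp y) <= 8 * `|x - y|.
Proof.
apply: le_trans (nrm_expiB _ _) _; rewrite -mulrBr normrM ler_wpM2r//.
rewrite ger0_norm; last by have := pi_ge0 R; lra.
by have := pihalf_lt2 R; lra.
Qed.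

Lemma nrm_cexpB1 x : nrm (cexp x - 1) <= 8 * `|x|.
Proof. by rewrite -cexp0 -{2}[x]subr0 nrm_cexpB. Qed.

Lemma tfshiftE z (f : R -> R[i]) t : tfshift z f t = cexp (- (z.2 * t)) * f (t - z.1).
Proof. by rewrite /tfshift /cexp mulrN mulrA. Qed.

End Circle.

(** * Rational approximations and power sums of rotations *)

Section Approximation.
Context {R : realType}.
Implicit Types (theta : R) (p : int) (q k : nat).

(** Irrationality of [theta], in the form in which it is used. *)
Definition irrational_angle theta := forall k, (0 < k)%N -> cexp (k%:R * theta) != 1.

(** The fraction [p / q] is in lowest terms and within [1 / q ^ 2] of [theta]. *)
Definition approximant theta q := exists p : int,
  [/\ (0 < q)%N, coprime `|p| q & q%:R * `|q%:R * theta - p%:~R| <= 1].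

Lemma irrational_angleN theta : irrational_angle theta -> irrational_angle (- theta).
Proof. by move=> irr k /irr; rewrite mulrN cexpN invr_eq1. Qed.

Lemma approximantN theta q : approximant theta q -> approximant (- theta) q.
Proof.
move=> [p [q0 cp le1]]; exists (- p); split=> //; first by rewrite abszN.
by rewrite mulrNz mulrN -opprD normrN.
Qed.

(** Pigeonhole for the fractional parts of the first multiples of [theta]. *)
Lemma dirichlet theta m : (0 < m)%N -> exists q p,
  [/\ (0 < q)%N, (q <= m)%N & m%:R * `|q%:R * theta - p%:~R| <= 1].
Proof.
move=> m0; have m0R : 0 < m%:R :> R by rewrite ltr0n.
pose fr i := i%:R * theta - (Num.floor (i%:R * theta))%:~R : R.
have fr01 i : 0 <= fr i < 1.
  by rewrite /fr; have := floor_itv (i%:R * theta); rewrite intrD; lra.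
pose f i := Num.truncn (m%:R * fr i).
have [inj|/existsNP[i /existsNP[j H]]] :=
    pselect (forall i j, (i <= m)%N -> (j <= m)%N -> f i = f j -> i = j).
  have : (m.+1 <= m)%N.
    apply: (@pigeonhole _ _ f).
      by move=> i j; rewrite !inE/= !ltnS; exact: inj.
    move=> _ [i _ <-] /=; have /andP[f0 f1] := fr01 i.
    have /andP[fl _] := truncn_itv (mulr_ge0 (ltW m0R) f0).
    by rewrite -(ltr_nat R); apply: le_lt_trans fl _; rewrite gtr_pMr.
  by rewrite ltnn.
have [im [jm [fij /eqP ij]]] : (i <= m)%N /\ (j <= m)%N /\ f i = f j /\ i <> j.
  by move: H => /not_implyP[im /not_implyP[jm /not_implyP[fij ij]]].
wlog lij : i j im jm fij ij H / (i < j)%N.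
  move=> W; move: (ij); rewrite neq_ltn => /orP[lij|lji]; first exact: (W i j).
  by apply: (W j i) => //; [rewrite eq_sym | move=> /(_ jm im (esym fij))/eqP; rewrite eq_sym (negbTE ij)].
exists (j - i)%N, (Num.floor (j%:R * theta) - Num.floor (i%:R * theta)).
split; [by rewrite subn_gt0 | exact: leq_trans (leq_subr _ _) jm |].
have -> : (j - i)%:R * theta - (Num.floor (j%:R * theta) - Num.floor (i%:R * theta))%:~R
    = fr j - fr i by rewrite natrB ?(ltnW lij)// /fr intrB; ring.
have hi := truncn_itv (_ : 0 <= m%:R * fr i); have hj := truncn_itv (_ : 0 <= m%:R * fr j).
have /andP[i0 _] := fr01 i; have /andP[j0 _] := fr01 j.
have {}hi := hi (mulr_ge0 (ltW m0R) i0); have {}hj := hj (mulr_ge0 (ltW m0R) j0).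
move: hi hj; rewrite -/(f i) -/(f j) -fij -natr1 => hi hj.
rewrite -[X in X * _]ger0_norm ?ler0n// -normrM ler_norml; lra.
Qed.

(** A bounded denominator keeps [q theta] away from the integers, so the
    denominators in Dirichlet's theorem are unbounded; dividing by a common factor
    only improves the estimate. *)
Lemma approximant_infinite theta n : irrational_angle theta ->
  exists2 q, (n < q)%N & approximant theta q.
Proof.
move=> irr.
have [d d0 hd] : exists2 d : R, 0 < d & forall k, (0 < k <= n)%N -> d <= nrm (cexp (k%:R * theta) - 1).
  elim: n => [|n [d d0 hd]]; first by exists 1 => // k; case: k.
  exists (Num.min d (nrm (cexp (n.+1%:R * theta) - 1))).
    by rewrite lt_min d0 nrm_gt0 subr_eq0 irr.
  move=> k /andP[k0]; rewrite leq_eqVlt => /orP[/eqP->|kn].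
    by rewrite ge_min lexx orbT.
  by rewrite ge_min hd// k0 -ltnS.
pose m := (Num.truncn (8 / d)).+1.
have mR : 8 / d < m%:R by exact: truncnS_gt.
have m0R : 0 < m%:R :> R by rewrite ltr0n.
have [q [p [q0 qm hq]]] := dirichlet theta (ltn0Sn (Num.truncn (8 / d))).
rewrite -/m in qm hq.
pose g := gcdn `|p| q; have g0 : (0 < g)%N by rewrite gcdn_gt0 q0 orbT.
pose q' := (q %/ g)%N; pose p' := (p %/ g)%Z.
have qE : q = (q' * g)%N by rewrite divnK// dvdn_gcdr.
have pE : p = p' * g%:Z by rewrite divzK// dvdzE dvdn_gcdl.
have q'0 : (0 < q')%N by rewrite divn_gt0// dvdn_leq// dvdn_gcdr.
have hq' : m%:R * `|q'%:R * theta - p'%:~R| <= 1.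
  apply: le_trans hq; rewrite qE [in leRHS]pE natrM intrM -pmulrn.
  have -> : q'%:R * g%:R * theta - p'%:~R * g%:R = g%:R * (q'%:R * theta - p'%:~R) by ring.
  rewrite normrM normr_nat ler_wpM2l ?ler0n// ler_peMl// ler1n//.
exists q'.
  rewrite ltnNge; apply/negP => q'n.
  have := hd q'; rewrite q'0 q'n => /(_ isT).
  apply/negP; rewrite -ltNge.
  have -> : q'%:R * theta = (q'%:R * theta - p'%:~R) + p'%:~R by ring.
  rewrite cexpD cexp_int mulr1; apply: le_lt_trans (nrm_cexpB1 _) _.
  rewrite -(ltr_pM2l m0R) mulrCA; apply: (@le_lt_trans _ _ 8).
    by rewrite ler_piMr.
  by rewrite -ltr_pdivrMr.
exists p'; split=> //.
  rewrite /coprime; have := muln_gcdl `|p'|%N q' g.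
  have -> : (`|p'| * g = `|p|)%N by rewrite pE abszM.
  rewrite -qE -/g -{2}[g]mul1n => /eqP; rewrite eqn_pmul2r//.
apply: le_trans hq'; rewrite ler_wpM2r// ler_nat (leq_trans _ qm)//.
by rewrite qE leq_pmulr.
Qed.

Definition power_sum theta q k : R[i] := \sum_(j < q) cexp (j%:R * (k%:R * theta)).

Lemma geometric_cexp x q :
  (cexp x - 1) * (\sum_(j < q) cexp (j%:R * x)) = cexp (q%:R * x) - 1 :> R[i].
Proof. by rewrite cexpMn subrX1; congr (_ * _); apply: eq_bigr => j _; rewrite cexpMn. Qed.

(** The geometric sum has numerator [cexp (q k theta) - 1], and [q theta] is within
    [1 / q] of an integer. For fixed [k] the power sums thus tend to [0]. *)
Lemma power_sum_small theta q k : approximant theta q ->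
  q%:R * (nrm (cexp (k%:R * theta) - 1) * nrm (power_sum theta q k)) <= 8 * k%:R.
Proof.
move=> [p [q0 cp le1]]; rewrite -nrmM geometric_cexp.
have -> : q%:R * (k%:R * theta) = k%:R * (q%:R * theta - p%:~R) + (k%:Z * p)%:~R.
  by rewrite intrM -pmulrn; ring.
rewrite cexpD cexp_int mulr1.
apply: le_trans (ler_wpM2l (ler0n _ _) (nrm_cexpB1 _)) _.
rewrite normrM normr_nat.
have := ler_wpM2l (ler0n R (8 * k)) le1; rewrite natrM mulr1.
by apply: le_trans; rewrite le_eqVlt; apply/orP; left; apply/eqP; ring.
Qed.

Lemma power_sum_rat p q k : (0 < q)%N -> coprime `|p| q -> ~~ (q %| k)%N ->
  \sum_(j < q) cexp (j%:R * (k%:R * (p%:~R / q%:R))) = 0 :> R[i].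
Proof.
move=> q0 cp ndvd; have q0R : q%:R != 0 :> R by rewrite pnatr_eq0 -lt0n.
have /eqP := geometric_cexp (k%:R * (p%:~R / q%:R)) q.
have -> : q%:R * (k%:R * (p%:~R / q%:R)) = (k%:Z * p)%:~R :> R.
  by rewrite intrM -pmulrn; field.
rewrite cexp_int subrr mulf_eq0 => /orP[|/eqP//].
rewrite subr_eq0 => /eqP /cexp_eq1[m /eqP].
rewrite mulrA -(inj_eq (mulIf q0R)) divfK// (pmulrn 1 k) (pmulrn 1 q) -!intrM eqr_int => /eqP.
move=> /(congr1 absz); rewrite !abszM /= => e.
suff : (q %| k * `|p|)%N by rewrite Gauss_dvdl 1?coprime_sym// (negbTE ndvd).
by rewrite e dvdn_mull.
Qed.

(** Replacing [theta] by [p / q] costs at most [k] times an absolute constant,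
    and for [p / q] the sum vanishes unless [q] divides [k]. *)
Lemma power_sum_linear theta q k : (0 < k)%N -> approximant theta q ->
  nrm (power_sum theta q k) <= 8 * k%:R.
Proof.
move=> k0 [p [q0 cp le1]].
have q0R : q%:R != 0 :> R by rewrite pnatr_eq0 -lt0n.
have [/(dvdn_leq k0) qk|ndvd] := boolP (q %| k)%N.
  apply: le_trans (nrm_sum _ _ _) _.
  under eq_bigr do rewrite nrm_cexp.
  rewrite sumr_const card_ord; apply: le_trans (_ : k%:R <= _); first by rewrite ler_nat.
  by rewrite ler_peMl// ler1n.
rewrite -[power_sum _ _ _]subr0 -(power_sum_rat q0 cp ndvd) -sumrB.
apply: le_trans (nrm_sum _ _ _) _.
apply: (@le_trans _ _ (\sum_(j < q) 8 * k%:R / q%:R)); last first.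
  by rewrite sumr_const card_ord -[X in X <= _]mulr_natr divfK.
apply: ler_sum => j _; apply: le_trans (nrm_cexpB _ _) _.
rewrite -!mulrBr !normrM !normr_nat -mulrA ler_wpM2l// mulrCA ler_wpM2l//.
have -> : theta - p%:~R / q%:R = (q%:R * theta - p%:~R) / q%:R by field.
rewrite normrM normfV normr_nat mulrA ler_pdivrMr ?ltr0n// mulVf//.
by apply: le_trans le1; rewrite ler_wpM2r// ler_nat ltnW.
Qed.

Lemma expr_small (z e : R) : 0 <= z < 1 -> 0 < e -> exists n, z ^+ n <= e.
Proof.
move=> /andP[z0 z1] e0.
have : (fun n => z ^+ n) @ \oo --> (0 : R) by apply: cvg_expr; rewrite ger0_norm.
move/cvgrPdist_le => /(_ e e0) [n _ /(_ n)] /=; rewrite leqnn sub0r normrN => /(_ isT) H.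
by exists n; apply: le_trans H; exact: ler_norm.
Qed.

Lemma sum_expr_le (y : R) n : 0 <= y < 1 -> \sum_(i < n) y ^+ i <= (1 - y)^-1.
Proof.
move=> /andP[y0 y1]; have y1' : 0 < 1 - y by rewrite subr_gt0.
rewrite -[leRHS]mul1r ler_pdivlMr// mulrC -opprB mulNr -subrX1 opprB.
by rewrite lerBlDr lerDl exprn_ge0.
Qed.

Lemma natr_expr_le (y : R) i : 0 <= y < 1 -> i%:R * y ^+ i <= (1 - y)^-1.
Proof.
move=> y01; apply: le_trans (sum_expr_le i y01).
rewrite mulr_natl -[X in _ *+ X]card_ord -sumr_const; apply: ler_sum => j _.
by case/andP: y01 => y0 y1; apply: ler_wiXn2l; rewrite ?y0 ?(ltW y1)// ltnW.
Qed.

(** The first terms are small for large [q] by [power_sum_small], and the tail is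
    uniformly small by [power_sum_linear]. *)
Lemma power_sum_weighted theta (x e : R) : irrational_angle theta -> 0 <= x < 1 -> 0 < e ->
  exists K, forall q, (K < q)%N -> approximant theta q ->
    forall n, \sum_(i < n) nrm (power_sum theta q i.+1) * x ^+ i.+1 <= e.
Proof.
move=> irr /andP[x0 x1] e0.
pose y := (1 + x) / 2; have y01 : 0 <= y < 1 by rewrite /y; lra.
have [y0 y1] := andP y01; have yp : 0 < y by rewrite /y; lra.
pose z := x / y; have z01 : 0 <= z < 1.
  by rewrite divr_ge0//= ltr_pdivrMr// mul1r /y; lra.
have [z0 z1] := andP z01.
pose c := 8 / (1 - y) / (1 - z).
have c0 : 0 < c by rewrite /c !divr_gt0// subr_gt0.
have e2c : 0 < e / 2 / c by apply: divr_gt0 => //; apply: divr_gt0.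
have [I zI] := expr_small z01 e2c.
pose b k := 8 * k.+1%:R / nrm (cexp (k.+1%:R * theta) - 1).
have b0 k : 0 <= b k by rewrite divr_ge0// ?mulr_ge0// nrm_ge0.
pose B := \sum_(k < I) b k.
have B0 : 0 <= B by apply: sumr_ge0.
exists (Num.truncn (B / (e / 2))) => q Kq qa n.
have q0 : 0 < q%:R :> R by case: qa => p [q0 _ _]; rewrite ltr0n.
have hq : B / q%:R <= e / 2.
  rewrite ler_pdivrMr// mulrC -ler_pdivrMr ?divr_gt0//.
  apply: ltW; apply: lt_le_trans (truncnS_gt _) _; by rewrite ler_nat.
pose F i := nrm (power_sum theta q i.+1) * x ^+ i.+1.
have F0 i : 0 <= F i by rewrite mulr_ge0// ?nrm_ge0// exprn_ge0.
have FI i : F i <= b i / q%:R.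
  apply: (@le_trans _ _ (nrm (power_sum theta q i.+1))).
    by apply: ler_piMr; [exact: nrm_ge0|apply: exprn_ile1 => //; exact: ltW].
  rewrite ler_pdivlMr// ler_pdivlMr ?nrm_gt0 ?subr_eq0 ?irr//.
  by have := power_sum_small i.+1 qa; lra.
have Ft i : F i <= 8 / (1 - y) * z ^+ i.+1.
  rewrite /F; have -> : x = y * z by rewrite /z mulrCA divff ?gt_eqF// mulr1.
  rewrite exprMn mulrA ler_wpM2r ?exprn_ge0//.
  apply: le_trans (ler_wpM2r (exprn_ge0 _ y0) (power_sum_linear (ltn0Sn i) qa)) _.
  by rewrite -mulrA ler_wpM2l// natr_expr_le.
apply: (@le_trans _ _ (\sum_(i < I + n) F i)).
  by rewrite addnC big_split_ord/= lerDl sumr_ge0.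
rewrite big_split_ord/= [e]splitr lerD//.
  by apply: le_trans hq; rewrite mulr_suml ler_sum.
apply: (@le_trans _ _ (\sum_(i < n) 8 / (1 - y) * z ^+ I * z ^+ i)).
  apply: ler_sum => i _; apply: le_trans (Ft _) _; rewrite -[leRHS]mulrA; apply: ler_wpM2l.
    by rewrite divr_ge0// subr_ge0 ltW.
  by rewrite -exprD ler_wiXn2l// ltW.
rewrite -mulr_sumr; apply: le_trans (ler_wpM2l _ (sum_expr_le n z01)) _.
  by rewrite mulr_ge0 ?exprn_ge0// divr_ge0// subr_ge0 ltW.
have -> : 8 / (1 - y) * z ^+ I / (1 - z) = z ^+ I * c by rewrite /c; ring.
by rewrite -ler_pdivlMr.
Qed.

End Approximation.

(** * Products of rotated linear factors *)

Section Newton.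
Context {R : realType}.
Local Notation C := R[i].

(** The factors are normalised by their constant term, so that the power sums of
    Newton's identities are those of the [a j], the inverses of the roots. *)
Definition unit_prod (a : nat -> C) q : {poly C} := \prod_(j < q) (1 - (a j)%:P * 'X).

Lemma newton_identity (a : nat -> C) q k :
  k.+1%:R * (unit_prod a q)`_k.+1 =
  - \sum_(i < k.+1) (\sum_(j < q) a j ^+ i.+1) * (unit_prod a q)`_(k - i).
Proof.
elim: q k => [|q IH] k.
  rewrite /unit_prod big_ord0 coef1 mulr0 big1 ?oppr0// => i _.
  by rewrite big_ord0 mul0r.
pose p := unit_prod a q.
have pS i : (unit_prod a q.+1)`_i.+1 = p`_i.+1 - a q * p`_i.
  rewrite /unit_prod big_ord_recr/= -/(unit_prod a q) -/p mulrBr mulr1 coefB.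
  by rewrite mulrCA coefCM coefMX.
have p0 : (unit_prod a q.+1)`_0 = p`_0.
  rewrite /unit_prod big_ord_recr/= -/(unit_prod a q) -/p mulrBr mulr1 coefB.
  by rewrite mulrCA coefCM coefMX mulr0 subr0.
under eq_bigr do rewrite big_ord_recr mulrDl/=.
rewrite big_split/= pS mulrBr IH.
have -> : \sum_(i < k.+1) a q ^+ i.+1 * (unit_prod a q.+1)`_(k - i) = a q * p`_k.
  have H m : \sum_(i < m.+1) a q ^+ i.+1 * (unit_prod a q.+1)`_(m - i) = a q * p`_m.
    elim: m => [|m IHm]; first by rewrite big_ord1 expr1 subn0 p0.
    rewrite big_ord_recl subn0 pS /=.
    under eq_bigr do rewrite exprS -mulrA /bump leq0n add1n subSS.
    by rewrite -mulr_sumr IHm; ring.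
  exact: H.
have -> : \sum_(i < k.+1) (\sum_(j < q) a j ^+ i.+1) * (unit_prod a q.+1)`_(k - i) =
   \sum_(i < k.+1) (\sum_(j < q) a j ^+ i.+1) * p`_(k - i) + a q * (k%:R * p`_k).
  case: k => [|k]; first by rewrite !big_ord1 subn0 p0 mul0r mulr0 addr0.
  rewrite IH mulrN mulr_sumr big_ord_recr [in RHS]big_ord_recr/= subnn p0.
  rewrite addrAC; congr (_ + _); rewrite -sumrB; apply: eq_bigr => i _.
  by rewrite subSn -1?ltnS// pS; ring.
by rewrite -natr1; ring.
Qed.

Lemma unit_prod0 (a : nat -> C) q : (unit_prod a q)`_0 = 1.
Proof.
rewrite -horner_coef0 horner_prod big1// => i _.
by rewrite !hornerE ?mulr0 ?subr0.
Qed.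

(** In the weighted norm [sum |p_k| tau^-k] the logarithm of the product is
    small, so by Newton's recursion the product is close to [1]. *)
Lemma unit_prod_coef (a : nat -> C) q (tau w : R) : 0 < tau -> w <= 1 ->
  (forall n, \sum_(i < n) nrm (\sum_(j < q) a j ^+ i.+1) * tau ^- i.+1 <= w) ->
  forall k, nrm (unit_prod a q)`_k.+1 <= w * tau ^+ k.+1.
Proof.
move=> tau0 w1 hw.
have w0 : 0 <= w by have := hw 0%N; rewrite big_ord0.
suff H k j : (j <= k)%N -> nrm (unit_prod a q)`_j <= tau ^+ j /\
    ((0 < j)%N -> nrm (unit_prod a q)`_j <= w * tau ^+ j).
  by move=> k; have [_] := H k.+1 k.+1 (leqnn _); apply.
elim: k j => [|k IH] j.
  by rewrite leqn0 => /eqP->; rewrite unit_prod0 nrm1 expr0.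
rewrite leq_eqVlt => /orP[/eqP->|]; last exact: IH.
suff b : nrm (unit_prod a q)`_k.+1 <= w * tau ^+ k.+1.
  by split=> //; apply: le_trans b _; rewrite ler_piMl// exprn_ge0 ?ltW.
have := congr1 (fun z => nrm z) (newton_identity a q k); rewrite nrmM nrm_nat nrmN => e.
have {e} : k.+1%:R * nrm (unit_prod a q)`_k.+1 <= w * tau ^+ k.+1.
  rewrite e; apply: le_trans (nrm_sum _ _ _) _.
  apply: le_trans (ler_wpM2r (exprn_ge0 k.+1 (ltW tau0)) (hw k.+1)).
  rewrite mulr_suml; apply: ler_sum => i _; rewrite nrmM -mulrA.
  rewrite ler_wpM2l ?nrm_ge0//.
  have [+ _] := IH (k - i)%N (leq_subr _ _); move=> /le_trans; apply.
  have ik : (i <= k)%N by rewrite -ltnS.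
  have -> : tau ^+ k.+1 = tau ^+ i.+1 * tau ^+ (k - i) by rewrite -exprD addSn subnKC.
  by rewrite mulKf// expf_neq0// gt_eqF.
by apply: le_trans; rewrite ler_peMl ?nrm_ge0// ler1n.
Qed.

Lemma unit_prod_l1 (a : nat -> C) q (tau w : R) : 0 < tau < 1 -> w <= 1 ->
  (forall n, \sum_(i < n) nrm (\sum_(j < q) a j ^+ i.+1) * tau ^- i.+1 <= w) ->
  forall n, \sum_(k < n) nrm (unit_prod a q)`_k.+1 <= w / (1 - tau).
Proof.
move=> /andP[tau0 tau1] w1 hw n.
have w0 : 0 <= w by have := hw 0%N; rewrite big_ord0.
have tau01 : 0 <= tau < 1 by rewrite ltW.
apply: le_trans (ler_wpM2l w0 (sum_expr_le n tau01)); rewrite mulr_sumr.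
apply: ler_sum => i _; apply: le_trans (unit_prod_coef tau0 w1 hw i) _.
by rewrite ler_wpM2l// exprS ler_piMl ?exprn_ge0// ltW.
Qed.

(** The [k]-th power sum of the numbers [cexp (j theta) * r] is [r ^ k] times a
    power sum of the rotation, to which [power_sum_weighted] applies. *)
Lemma rotated_prod_l1 (theta e : R) (r : C) : irrational_angle theta -> nrm r < 1 -> 0 < e ->
  exists K, forall q, (K < q)%N -> approximant theta q ->
    forall n, \sum_(k < n) nrm (unit_prod (fun j => cexp (j%:R * theta) * r) q)`_k.+1 <= e.
Proof.
move=> irr r1 e0; have r0 := nrm_ge0 r.
pose tau := (1 + nrm r) / 2.
have tau01 : 0 < tau < 1 by rewrite /tau; lra.
have [tau0 tau1] := andP tau01.
pose w := Num.min 1 (e * (1 - tau)).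
have w0 : 0 < w by rewrite lt_min ltr01 mulr_gt0// subr_gt0.
have x01 : 0 <= nrm r / tau < 1.
  by apply/andP; split; [rewrite divr_ge0 ?(ltW tau0)|rewrite ltr_pdivrMr// mul1r /tau; lra].
have [K HK] := power_sum_weighted irr x01 w0.
exists K => q Kq qa n.
have w1 : w <= 1 by rewrite ge_min lexx.
apply: (@le_trans _ _ (w / (1 - tau))); last first.
  by rewrite ler_pdivrMr ?subr_gt0// ge_min lexx orbT.
apply: unit_prod_l1 => // m; apply: le_trans (HK q Kq qa m).
apply: ler_sum => i _.
have -> : \sum_(j < q) (cexp (j%:R * theta) * r) ^+ i.+1 = r ^+ i.+1 * power_sum theta q i.+1.
  rewrite mulr_sumr; apply: eq_bigr => j _.
  by rewrite exprMn -cexpMn mulrC [X in cexp X]mulrCA.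
by rewrite nrmM nrmX [(nrm r / tau) ^+ _]exprMn exprVn mulrA [X in _ <= X / _]mulrC.
Qed.

End Newton.

(** * Polynomials acting on two-sided sequences *)

Section Convolution.
Context {R : realType}.
Local Notation C := R[i].
Implicit Types (p q : {poly C}) (s : int -> C) (d n : int).

(** A polynomial acts on two-sided sequences, its indeterminate being the
    shift by [d]. *)
Definition act d p s n : C := \sum_(k < size p) p`_k * s (n - d *+ k).

Lemma act_wide d p s n m : (size p <= m)%N ->
  act d p s n = \sum_(k < m) p`_k * s (n - d *+ k).
Proof.
move=> pm; rewrite /act (big_ord_widen m (fun k => p`_k * s (n - d *+ k)))//.
rewrite big_mkcond/=; apply: eq_bigr => k _; case: ltnP => // /(nth_default 0) ->.
by rewrite mul0r.
Qed.

Lemma actD d p q s n : act d (p + q) s n = act d p s n + act d q s n.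
Proof.
pose m := maxn (size p) (size q).
rewrite (@act_wide d (p + q) s n m) ?size_polyD// (@act_wide d p s n m) ?leq_maxl//.
rewrite (@act_wide d q s n m) ?leq_maxr// -big_split/=; apply: eq_bigr => k _.
by rewrite coefD mulrDl.
Qed.

Lemma actZ d (c : C) p s n : act d (c *: p) s n = c * act d p s n.
Proof.
rewrite (@act_wide d (c *: p) s n (size p)) ?size_scale_leq// mulr_sumr.
by apply: eq_bigr => k _; rewrite coefZ mulrA.
Qed.

Lemma actC d (c : C) s n : act d c%:P s n = c * s n.
Proof.
rewrite (@act_wide d c%:P s n 1) ?size_polyC_leq1// big_ord1 coefC/=.
by rewrite mulr0n subr0.
Qed.

Lemma act1 d s n : act d 1 s n = s n.
Proof. by rewrite -polyC1 actC mul1r. Qed.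

Lemma actMX d p s n : act d (p * 'X) s n = act d p s (n - d).
Proof.
rewrite (@act_wide d (p * 'X) s n (size p).+1) ?size_polyMleq; last first.
  by apply: leq_trans (size_polyMleq _ _) _; rewrite size_polyX addn2.
rewrite big_ord_recl coefMX mul0r add0r; apply: eq_bigr => k _.
by rewrite coefMX/= /bump leq0n add1n mulrS opprD addrA.
Qed.

Lemma actX d s n : act d 'X s n = s (n - d).
Proof. by rewrite -['X]mul1r actMX actC mul1r. Qed.

Lemma actM d p q s n : act d (p * q) s n = act d p (act d q s) n.
Proof.
elim/poly_ind: p n => [|p c IH] n.
  by rewrite mul0r !/(act _ 0 _ _) /act size_poly0 !big_ord0.
rewrite mulrDl !actD actC mul_polyC actZ mulrAC !actMX; congr (_ + _).
exact: IH.
Qed.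

Lemma eq_act d p s s' n : s =1 s' -> act d p s n = act d p s' n.
Proof. by move=> e; apply: eq_bigr => k _; rewrite e. Qed.

Lemma act_shift d p s (c : C) m n :
  act d p (fun i => c * s (i - m)) n = c * act d p s (n - m).
Proof. by rewrite mulr_sumr; apply: eq_bigr => k _; rewrite mulrCA addrAC. Qed.

(** Products of rotated factors are compared with the identity in the sup norm;
    invariance under shifts and scalars lets the shifts and the scalars that come
    from different roots be collected. *)
Definition near_id (e : R) (G : (int -> C) -> int -> C) :=
  [/\ forall s s', s =1 s' -> G s =1 G s',
      forall s (c : C) m n, G (fun i => c * s (i - m)) n = c * G s (n - m) &
      forall s M, (forall n, nrm (s n) <= M) -> forall n, nrm (G s n - s n) <= e * M].

Lemma near_id_id : near_id 0 (fun s => s).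
Proof. by split=> // s M sM n; rewrite subrr nrm0 mul0r. Qed.

Lemma near_id_comp e e' G H : 0 <= e -> 0 <= e' -> near_id e G -> near_id e' H ->
  near_id (e + e' + e * e') (G \o H).
Proof.
move=> e0 e'0 [Ge Gs Gn] [He Hs Hn]; split.
- by move=> s s' /He/Ge.
- by move=> s c m n /=; rewrite -Gs; apply: Ge => i; rewrite Hs.
- move=> s M sM n /=.
  have bH i : nrm (H s i) <= M + e' * M.
    apply: le_trans (_ : nrm (s i + (H s i - s i)) <= _); first by rewrite addrC subrK.
    by apply: le_trans (nrmD _ _) _; apply: lerD => //; exact: Hn.
  apply: le_trans (nrm_tri _ (H s n) _) _.
  by apply: le_trans (lerD (Gn _ _ bH n) (Hn _ _ sM n)) _; lra.
Qed.

Lemma near_id_act d p e : p`_0 = 1 -> (forall m, \sum_(k < m) nrm p`_k.+1 <= e) ->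
  near_id e (act d p).
Proof.
move=> p0 pe; split; [by move=> s s' ss n; exact: eq_act | exact: act_shift |].
move=> s M sM n; rewrite (@act_wide d p s n (size p).+1)// big_ord_recl p0 mul1r.
rewrite mulr0n subr0 addrAC subrr add0r; apply: le_trans (nrm_sum _ _ _) _.
have M0 : 0 <= M := le_trans (nrm_ge0 _) (sM 0).
apply: le_trans (ler_wpM2r M0 (pe (size p))); rewrite mulr_suml.
by apply: ler_sum => k _; rewrite nrmM ler_wpM2l// nrm_ge0.
Qed.

Lemma act_prod_linear (a : nat -> C) (q : nat) s n :
  act 1 (\prod_(j < q) ('X - (a j)%:P)) s n = act (-1) (unit_prod a q) s (n - q%:Z).
Proof.
elim: q n => [|q IH] n.
  by rewrite /unit_prod !big_ord0 !act1 subr0.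
rewrite /unit_prod !big_ord_recr/= -/(unit_prod a q).
rewrite mulrC actM [X in act (-1) X]mulrC actM actD -polyCN actC actX.
rewrite actD act1 -mulNr -polyCN mul_polyC actZ actX !IH.
by congr (act _ _ _ _ + _ * act _ _ _ _); lia.
Qed.

End Convolution.

(** * Iteration of a quasi-periodic recurrence *)

Section Dynamics.
Context {R : realType}.
Local Notation C := R[i].
Variables (theta : R) (irr : irrational_angle theta).

(** Moving the action of [p] past multiplication by [cexp (j theta n)] turns [p]
    into [rot p j]. *)
Definition rot (p : {poly C}) j := p \Po (cexp (j%:R * theta) *: 'X).

Lemma coef_rot p j i : (rot p j)`_i = p`_i * cexp (j%:R * theta) ^+ i.
Proof.
rewrite /rot coef_comp_poly.
under eq_bigr do rewrite exprZn coefZ coefXn.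
have [ip|pi] := ltnP i (size p); last first.
  rewrite nth_default// mul0r big1// => k _.
  by rewrite eqn_leq leqNgt (leq_trans (ltn_ord k) pi)/= mulr0n !mulr0.
rewrite (bigD1 (Ordinal ip))//= eqxx mulr1 big1 ?addr0// => k /negbTE ki.
by rewrite eq_sym (_ : (nat_of_ord k == i) = false) ?mulr0n ?mulr0.
Qed.

Lemma scale_prod_const (c : C) (F : nat -> {poly C}) q :
  c ^+ q *: \prod_(j < q) F j = \prod_(j < q) (c *: F j).
Proof. by rewrite scaler_prod prodr_const card_ord. Qed.

Lemma half_succ q : (q.+1 * q)./2 = ((q * q.-1)./2 + q)%N.
Proof. by rewrite -!bin2 binS bin1 addnC. Qed.

(** The contribution of one root to the product of [q] rotated copies: a scalar,
    a shift for a root inside the unit circle, and an operator close to the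
    identity. *)
Lemma rotated_root (rho : C) (e : R) : nrm rho != 1 -> 0 < e ->
  exists K, forall q, (K < q)%N -> approximant theta q -> exists2 G, near_id e G &
    forall s n, act 1 (\prod_(j < q) rot ('X - rho%:P) j) s n =
      if nrm rho < 1 then cexp (theta * (q * q.-1)./2%:R) * G s (n - q%:Z)
      else (- rho) ^+ q * G s n.
Proof.
move=> rho1 e0.
have rotE j : rot ('X - rho%:P) j = cexp (j%:R * theta) *: 'X - rho%:P.
  by rewrite /rot comp_polyB comp_polyX comp_polyC.
have irrN := irrational_angleN irr.
have [r1|r1] := ltP (nrm rho) 1.
  have [K HK] := rotated_prod_l1 irrN r1 e0.
  exists K => q Kq qa.
  exists (act (-1) (unit_prod (fun j => cexp (j%:R * - theta) * rho) q)).
    by apply: near_id_act (HK q Kq (approximantN qa)); rewrite unit_prod0.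
  move=> s n.
  have -> : \prod_(j < q) rot ('X - rho%:P) j =
      cexp (theta * (q * q.-1)./2%:R) *: \prod_(j < q) ('X - (cexp (j%:R * - theta) * rho)%:P).
    elim: q {Kq qa} => [|q IH]; first by rewrite !big_ord0 mulr0 cexp0 scale1r.
    rewrite !big_ord_recr/= IH rotE.
    rewrite half_succ natrD [theta * (_ + _)]mulrDr cexpD [theta * q%:R]mulrC.
    rewrite -scalerAl -scalerA [cexp (q%:R * theta) *: (_ * _)]scalerAr.
    congr (_ *: (_ * _)).
    rewrite scalerBr mulrC -!mul_polyC -polyCM mulrA; congr (_ - _%:P).
    by rewrite -cexpD mulrN [theta * _]mulrC subrr cexp0 mul1r.
  by rewrite actZ (act_prod_linear (fun j => cexp (j%:R * - theta) * rho)).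
have rg : 1 < nrm rho by rewrite lt_def rho1.
have r1' : nrm rho^-1 < 1 by rewrite nrmV invf_lt1// (lt_trans _ rg).
have rho0 : rho != 0 by rewrite -nrm_gt0 (lt_le_trans _ r1).
have [K HK] := rotated_prod_l1 irr r1' e0.
exists K => q Kq qa.
exists (act 1 (unit_prod (fun j => cexp (j%:R * theta) * rho^-1) q)).
  by apply: near_id_act (HK q Kq qa); rewrite unit_prod0.
move=> s n; rewrite -actZ; congr act.
rewrite /unit_prod (scale_prod_const _ (fun j => 1 - (cexp (j%:R * theta) / rho)%:P * 'X)); apply: eq_bigr => j _.
rewrite rotE scalerBr alg_polyC -!mul_polyC mulrA -polyCM mulrCA mulNr divff// mulrN1.
by rewrite !polyCN mulNr opprK addrC.
Qed.

Lemma rotM p q j : rot (p * q) j = rot p j * rot q j.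
Proof. by rewrite /rot comp_polyM. Qed.

Definition inner_count (rs : seq C) := count (fun z => nrm z < 1) rs.
(** Up to the leading coefficient, a number whose modulus is the Mahler measure of
    the polynomial with roots [rs]. *)
Definition outer_prod (rs : seq C) : C := \prod_(z <- rs | ~~ (nrm z < 1)) (- z).

Lemma rotated_roots (rs : seq C) (e : R) : all (fun z => nrm z != 1) rs -> 0 < e ->
  exists K, forall q, (K < q)%N -> approximant theta q -> exists2 G, near_id e G &
    forall s n, act 1 (\prod_(j < q) rot (\prod_(z <- rs) ('X - z%:P)) j) s n =
      cexp (theta * (q * q.-1)./2%:R) ^+ inner_count rs * outer_prod rs ^+ q *
      G s (n - (q * inner_count rs)%:Z).
Proof.
elim: rs e => [|r rs IH] e /=.
  move=> _ e0; exists 0%N => q _ _; exists (fun s => s).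
    have [a b c] := @near_id_id R; split=> // s M sM n.
    by apply: le_trans (c _ _ sM n) _; have M0 := le_trans (nrm_ge0 _) (sM 0); rewrite ler_wpM2r ?(ltW e0).
  move=> s n; rewrite /outer_prod !big_nil expr1n expr0 muln0 subr0 mul1r mul1r.
  rewrite big1 -?[1 in LHS]polyC1 ?actC ?mul1r// => j _.
  by rewrite /rot comp_polyC.
move=> /andP[r1 rs1] e0.
pose d := Num.min 1 (e / 3).
have d0 : 0 < d by rewrite lt_min ltr01 divr_gt0.
have [K1 H1] := rotated_root r1 d0; have [K2 H2] := IH d rs1 d0.
exists (maxn K1 K2) => q; rewrite gtn_max => /andP[q1 q2] qa.
have [G1 nG1 E1] := H1 q q1 qa; have [G2 nG2 E2] := H2 q q2 qa.
have [G1e G1s _] := nG1; have [G2e G2s _] := nG2.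
exists (G1 \o G2).
  have [a b c] := near_id_comp (ltW d0) (ltW d0) nG1 nG2.
  split=> // s M sM n; apply: le_trans (c _ _ sM n) _.
  have M0 := le_trans (nrm_ge0 _) (sM 0); apply: ler_wpM2r => //.
  have : d <= 1 by rewrite ge_min lexx.
  have : d <= e / 3 by rewrite ge_min lexx orbT.
  by nra.
move=> s n.
have -> : \prod_(j < q) rot (\prod_(z <- r :: rs) ('X - z%:P)) j =
   (\prod_(j < q) rot ('X - r%:P) j) * (\prod_(j < q) rot (\prod_(z <- rs) ('X - z%:P)) j).
  by rewrite -big_split/=; apply: eq_bigr => j _; rewrite big_cons rotM.
rewrite actM E1; have := G1e _ _ (E2 s); rewrite /outer_prod big_cons.
case: ifP => rl G1E.
  rewrite G1E G1s /= add1n exprS -!mulrA; congr (_ * (_ * (_ * G1 _ _))).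
  by rewrite mulnS PoszD opprD addrA.
by rewrite G1E G1s /= add0n exprMn -!mulrA [RHS]mulrCA.
Qed.

(** The place where [s] is largest is where an operator close to the identity in
    the sup norm can be tested without losing a constant. *)
Lemma max_attained (s : int -> C) : s 0 != 0 ->
  (forall e : R, 0 < e -> exists k : nat, forall n : int, (k <= `|n|)%N -> nrm (s n) <= e) ->
  exists m, forall n, nrm (s n) <= nrm (s m).
Proof.
move=> s0 sv; have p0 : 0 < nrm (s 0) by rewrite nrm_gt0.
have [k hk] := sv _ p0.
have H j : exists m : int, forall n : int, (`|n| < j)%N -> nrm (s n) <= nrm (s m).
  elim: j => [|j [m hm]]; first by exists 0.
  have [m1 [l1 l2]] : exists m1 : int, nrm (s m) <= nrm (s m1) /\ nrm (s j) <= nrm (s m1).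
    by have [a|/ltW a] := leP (nrm (s m)) (nrm (s j)); [exists j|exists m].
  have [m2 [l3 l4]] : exists m2 : int, nrm (s m1) <= nrm (s m2) /\ nrm (s (- j%:Z)) <= nrm (s m2).
    by have [a|/ltW a] := leP (nrm (s m1)) (nrm (s (- j%:Z))); [exists (- j%:Z)|exists m1].
  exists m2 => n; rewrite ltnS leq_eqVlt => /orP[/eqP nj|nj].
    have [->|->] : n = j%:Z \/ n = - j%:Z by lia.
      exact: le_trans l3.
    exact: l4.
  exact: le_trans (hm _ nj) (le_trans l1 l3).
have [m hm] := H k.+1; exists m => n; have [nk|nk] := ltnP `|n|%N k.+1; first exact: hm.
by apply: le_trans (hk _ _) (hm 0 _) => //; apply: ltnW.
Qed.

Lemma far_index (m N : int) (i q k : nat) : N <> i%:Z -> (k + `|m| < q)%N ->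
  (k <= `|(m + q%:Z * N - (q * i)%N%:Z)%R|)%N.
Proof.
move=> Ni kq.
have -> : m + q%:Z * N - (q * i)%N%:Z = m + q%:Z * (N - i%:Z) by rewrite PoszM; ring.
have n1 : (1 <= `|N - i%:Z|)%N by lia.
have : (q <= `|(q%:Z * (N - i%:Z))%R|)%N by rewrite abszM leq_pmulr.
by clear Ni n1; lia.
Qed.

Lemma half_double q : ((q * q.-1)./2 + (q * q.-1)./2 + q = q * q)%N.
Proof.
rewrite addnn halfK; case: q => [|q] //=.
have -> : odd (q.+1 * q) = false by rewrite oddM /= andNb.
by rewrite subn0 -mulnSr.
Qed.

Lemma phase_exponent (q i : nat) :
  q%:Z * (q%:Z * i%:Z) - i%:Z * ((q * q.-1)./2 + q)%N%:Z = (i * (q * q.-1)./2)%N%:Z.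
Proof.
have := half_double q; set w := (q * q.-1)./2 => ww.
by rewrite mulrA -PoszM -ww !PoszD PoszM; ring.
Qed.

(** Each new application of the relation must be moved past the phases already
    collected, whence the rotated copies of [g] and the triangular number in the
    exponent. *)
Lemma iterated_relation (g : {poly C}) (s : int -> C) z0 (N : int) :
  (forall n, act 1 g s n = z0 * cexp (theta * (n - N)%:~R) * s (n - N)) ->
  forall (q : nat) n, act 1 (\prod_(j < q) rot g j) s n =
    z0 ^+ q * cexp (theta * (q%:Z * n - N * ((q * q.-1)./2 + q)%N%:Z)%:~R) *
    s (n - q%:Z * N).
Proof.
move=> rel; elim=> [|q IH] n.
  by rewrite big_ord0 act1 mul0r mulr0 subr0 mulr0 cexp0 expr0 !mul1r mul0r subr0.
rewrite big_ord_recr/= mulrC actM (eq_act _ _ _ IH).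
set w := (q * q.-1)./2.
have -> : act 1 (rot g q) (fun n => z0 ^+ q * cexp (theta * (q%:Z * n - N * (w + q)%N%:Z)%:~R) *
    s (n - q%:Z * N)) n = z0 ^+ q * cexp (theta * (q%:Z * n - N * (w + q)%N%:Z)%:~R) *
    act 1 g s (n - q%:Z * N).
  rewrite /act (_ : size (rot g q) = size g); last first.
    by rewrite /rot size_comp_poly2// size_scale ?cexp_neq0// size_polyX.
  rewrite mulr_sumr; apply: eq_bigr => i _; rewrite coef_rot.
  have -> : n - 1 *+ i - q%:Z * N = n - q%:Z * N - 1 *+ i by rewrite addrAC.
  rewrite -cexpMn.
  have -> : cexp (theta * (q%:Z * n - N * (w + q)%N%:Z)%:~R) = cexp (i%:R * (q%:R * theta)) *
     cexp (theta * (q%:Z * (n - 1 *+ i) - N * (w + q)%N%:Z)%:~R).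
    rewrite -cexpD; congr cexp; rewrite !(intrD, mulrNz, intrM) -!pmulrn !mulrz_nat.
    by ring.
  by ring.
rewrite rel exprSr half_succ.
have -> : cexp (theta * (q.+1%:Z * n - N * (w + q + q.+1)%N%:Z)%:~R) =
   cexp (theta * (q%:Z * n - N * (w + q)%N%:Z)%:~R) * cexp (theta * (n - q%:Z * N - N)%:~R).
  by rewrite -cexpD -mulrDr -intrD; congr (cexp (theta * _%:~R)); lia.
have -> : n - q.+1%:Z * N = n - q%:Z * N - N by lia.
by ring.
Qed.

(** Iterating the relation [q] times turns multiplication by [cexp (theta n)]
    into an operator close to the identity, and convolution by [g] into the
    scalar [A ^+ q] times a shift. Comparing moduli at the maximum of [s]
    excludes the shift, and comparing values at [0] identifies the scalar. *)
Lemma outer_value_limit (c : C) (rs : seq C) (s : int -> C) z0 (N : int) :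
  all (fun z => nrm z != 1) rs -> nrm z0 = 1 -> s 0 != 0 ->
  (forall e : R, 0 < e -> exists k : nat, forall n : int, (k <= `|n|)%N -> nrm (s n) <= e) ->
  (forall n, act 1 (c *: \prod_(z <- rs) ('X - z%:P)) s n =
     z0 * cexp (theta * (n - N)%:~R) * s (n - N)) ->
  forall e : R, 0 < e -> exists K, forall q, (K < q)%N -> approximant theta q ->
    nrm ((c * outer_prod rs) ^+ q - z0 ^+ q) <= e.
Proof.
move=> rs1 z01 s0 sv rel e e0.
have [m hm] := max_attained s0 sv; set M := nrm (s m) in hm.
have p0 : 0 < nrm (s 0) by rewrite nrm_gt0.
have M0 : 0 < M := lt_le_trans p0 (hm 0).
pose d := Num.min 8^-1 (e * nrm (s 0) / (2 * M)).
have d0 : 0 < d by rewrite lt_min invr_gt0 ltr0n !divr_gt0 ?mulr_gt0.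
have d8 : d <= 8^-1 by rewrite ge_min lexx.
have de : d * (2 * M) <= e * nrm (s 0) by rewrite -ler_pdivlMr ?mulr_gt0// ge_min lexx orbT.
have [K1 HK] := rotated_roots rs1 d0.
have M8 : 0 < M / 8 by rewrite divr_gt0.
have [k hk] := sv _ M8.
exists (maxn K1 (k + `|m|)) => q; rewrite gtn_max => /andP[q1 q2] qa.
have [G [_ _ Gn] GE] := HK q q1 qa.
pose ic := inner_count rs; have [A AE] : exists A, A = c * outer_prod rs by eexists.
pose w := (q * q.-1)./2.
have {}GE n : act 1 (\prod_(j < q) rot (c *: \prod_(z <- rs) ('X - z%:P)) j) s n =
   cexp (theta * w%:R) ^+ ic * A ^+ q * G s (n - (q * ic)%N%:Z).
  have -> : \prod_(j < q) rot (c *: \prod_(z <- rs) ('X - z%:P)) j =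
     c ^+ q *: \prod_(j < q) rot (\prod_(z <- rs) ('X - z%:P)) j.
    rewrite scale_prod_const.
    by apply: eq_bigr => j _; rewrite /rot comp_polyZ.
  by rewrite actZ GE AE exprMn; ring.
have E n := etrans (esym (iterated_relation rel q n)) (GE n).
have Gd n : nrm (G s n - s n) <= d * M by apply: Gn.
have En n : nrm (s (n - q%:Z * N)) = nrm A ^+ q * nrm (G s (n - (q * ic)%N%:Z)).
  have := congr1 (fun z => nrm z) (E n).
  by rewrite !nrmM !nrmX !nrm_cexp z01 !expr1n !mul1r.
set a := nrm A ^+ q in En.
have a0 : 0 <= a by rewrite exprn_ge0// nrm_ge0.
(* Compare the moduli where [G s] is nearly as large as the maximum of [s]. *)
have a2 : a <= 2.
  have := En (m + (q * ic)%N%:Z); rewrite addrK => Em.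
  have h1 : nrm (s (m + (q * ic)%N - q%:Z * N)) <= M by [].
  have h2 : M - d * M <= nrm (G s m).
    have := nrm_rev (s m) (s m - G s m); rewrite subKr nrmB -/M => h.
    by apply: le_trans h; rewrite lerD2l lerN2.
  have h3 : M / 2 <= nrm (G s m) by apply: le_trans h2; nra.
  have h4 : a * (M / 2) <= M by rewrite Em in h1; apply: le_trans h1; rewrite ler_wpM2l.
  by rewrite -(ler_pM2r M0); lra.
(* Otherwise the maximum of [s] is compared with values far out on the orbit. *)
have NE : N = ic%:Z.
  apply/eqP; apply: contraT => /eqP Nic.
  have := En (m + q%:Z * N); rewrite addrK -/M.
  set i := m + _ - _ => EM.
  have ilarge : (k <= `|i|)%N.
    exact: far_index Nic q2.
  have h1 := hk _ ilarge; have h2 : nrm (G s i) <= M / 8 + d * M.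
    have := nrmD (s i) (G s i - s i); rewrite addrC subrK => h.
    by apply: le_trans h _; apply: lerD.
  have : M <= 2 * (M / 8 + d * M).
    by rewrite {1}EM; apply: ler_pM => //; exact: nrm_ge0.
  by nra.
(* The shift having been identified, the two sides are compared at [s 0]. *)
have := E (q%:Z * N); rewrite subrr NE.
have -> : q%:Z * ic%:Z - (q * ic)%N%:Z = 0 by rewrite PoszM subrr.
have -> : cexp (theta * (q%:Z * (q%:Z * ic%:Z) - ic%:Z * (w + q)%N%:Z)%:~R) =
   cexp (theta * w%:R) ^+ ic.
  rewrite -cexpMn; congr cexp.
  have -> : q%:Z * (q%:Z * ic%:Z) - ic%:Z * (w + q)%N%:Z = (ic * w)%N%:Z.
    exact: phase_exponent.
  by rewrite -pmulrn natrM; ring.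
rewrite [LHS]mulrAC => E0.
have {}E0 : z0 ^+ q * s 0 = A ^+ q * G s 0.
  apply: (mulIf (expf_neq0 ic (cexp_neq0 (theta * w%:R)))).
  by rewrite E0; ring.
rewrite -AE -(ler_pM2r p0) -nrmM mulrBl E0 -mulrBr nrmM nrmX -/a nrmB.
apply: le_trans de; rewrite mulrCA.
by apply: ler_pM => //; exact: nrm_ge0.
Qed.

End Dynamics.

(** * Null sets and density *)

Section NullSets.
Context {R : realType}.
Local Notation C := R[i].
Local Notation mu := (@lebesgue_measure R).

Definition null (A : set R) := mu.-negligible A.

Lemma null0 : null set0.
Proof. exact: negligible_set0. Qed.

Lemma nullS (A B : set R) : B `<=` A -> null A -> null B.
Proof. by move=> BA nA; apply: negligibleS nA. Qed.

Lemma nullU (A B : set R) : null A -> null B -> null (A `|` B).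
Proof. by move=> nA nB; apply: negligibleU. Qed.

Lemma null_bigcup (T : countType) (F : T -> set R) :
  (forall i, null (F i)) -> null (\bigcup_i F i).
Proof.
move=> nF; pose G n := if unpickle n is Some i then F i else set0.
apply: (@nullS (\bigcup_n G n)).
  by move=> x [i _ Fx]; exists (pickle i) => //; rewrite /G pickleK.
by apply: negligible_bigcup => n; rewrite /G; case: unpickle => // ; exact: null0.
Qed.

(** Countable pigeonhole: bounds that depend on the point become uniform on a
    set that is still not null. *)
Lemma not_null_piece (T : countType) (F : T -> set R) (E : set R) :
  (forall t, E t -> exists i, F i t) -> ~ null E -> exists i, ~ null (E `&` F i).
Proof.
move=> cov nE; apply: contrapT => /forallNP H; apply: nE.
apply: (@nullS (\bigcup_i (E `&` F i))).
  by move=> t Et; have [i Fit] := cov t Et; exists i.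
by apply: null_bigcup => i; exact: contrapT (H i).
Qed.

Lemma null_countable (A : set R) : countable A -> null A.
Proof.
move=> cA; exists A; split=> //; last exact: countable_lebesgue_measure0.
exact: countable_measurable.
Qed.

Lemma null_set1 x : null [set x].
Proof. by apply: null_countable; exact: countable1. Qed.

Lemma null_seq (T : eqType) (s : seq T) (F : T -> set R) :
  (forall x, null (F x)) -> null [set t | exists2 x, x \in s & F x t].
Proof.
move=> nF; elim: s => [|x s IH]; first by apply: nullS null0 => t [].
apply: nullS (nullU (nF x) IH) => t [y]; rewrite inE => /orP[/eqP->|ys] Fy.
  by left.
by right; exists y.
Qed.

(** A set that misses a whole interval [t + r, t + 2 r] at arbitrarily small
    scales around each of its points has no density points. Passing to the
    closure makes the set measurable. *)
Lemma null_porous (F : set R) :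
  (forall d : R, 0 < d -> exists2 r, 0 < r < d &
     forall t t', F t -> F t' -> ~~ (r < t' - t < 2 * r)) -> null F.
Proof.
move=> por; apply: (nullS (@subset_closure _ F)).
have mF : measurable (closure F).
  by apply: measurable_realfun.closed_measurable; exact: closed_closure.
have porc (d : R) : 0 < d -> exists2 r, 0 < r < d &
    forall t t', closure F t -> closure F t' -> ~~ (r < t' - t < 2 * r).
  move=> /por[r r0d hr]; exists r => // t t' Ft Ft'; apply/negP => /andP[h1 h2].
  pose e := Num.min (t' - t - r) (2 * r - (t' - t)) / 2.
  have e0 : 0 < e by rewrite divr_gt0// lt_min !subr_gt0 h1.
  have e1 : e <= (t' - t - r) / 2 by rewrite ler_pM2r ?invr_gt0// ge_min lexx.
  have e2 : e <= (2 * r - (t' - t)) / 2 by rewrite ler_pM2r ?invr_gt0// ge_min lexx orbT.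
  have [s [Fs]] := Ft _ (nbhsx_ballx t e e0); rewrite /ball/= ltr_norml => /andP[s1 s2].
  have [s' [Fs']] := Ft' _ (nbhsx_ballx t' e e0); rewrite /ball/= ltr_norml => /andP[s3 s4].
  by have /negP := hr s s' Fs Fs'; apply; apply/andP; split; lra.
have := lebesgue_density mF; apply: negligibleS => x Fx /= dx.
move: dx; rewrite indicE mem_set// => dx.
have lt1 : ((3 / 4)%R%:E < 1%:E :> \bar R)%E by rewrite lte_fin; lra.
have := dx _ (open_nbhs_nbhs (conj (@open_ereal_gt_ereal R (3 / 4)%R%:E) lt1)).
move=> [d /= d0 hd].
have [r /andP[r0 rd] hr] := porc (d / 2) (divr_gt0 d0 (ltr0n _ 2)).
have r20 : 0 < 2 * r by rewrite mulr_gt0.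
have : ball_ Num.norm 0 d (2 * r) by rewrite /ball_/= sub0r normrN gtr0_norm//; lra.
move=> /hd /(_ r20); rewrite lebesgue_measure_ball ?ltW// => H3.
(* The ball has length [4 r] and [F] misses its last quarter. *)
have le3 : (mu (closure F `&` ball x (2 * r)) <= (3 * r)%:E)%E.
  apply: (@le_trans _ _ (mu `]x - 2 * r, x + r])).
    apply: le_measure; rewrite ?inE//.
      by apply: measurableI => //; exact: measurable_realfun.measurable_ball.
    move=> y [Fy]; rewrite /ball/= in_itv/= ltr_norml => /andP[y1 y2].
    have := hr x y Fx Fy; rewrite negb_and -!leNgt => /orP[y3|y3].
      by apply/andP; split; lra.
    by apply/andP; split; lra.
  rewrite lebesgue_measure_itv/= lte_fin ifT; last by lra.
  by rewrite -EFinB lee_fin; lra.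
have : ((3 / 4)%R%:E < (3 * r)%:E * ((2 * r *+ 2)%:E)^-1)%E.
  apply: lt_le_trans H3 _; apply: lee_wpmul2r => //.
  by rewrite inver gt_eqF ?mulrn_wgt0// lee_fin invr_ge0 mulrn_wge0// ltW.
rewrite inver gt_eqF ?mulrn_wgt0// -EFinM lte_fin.
have -> : 3 * r / (2 * r *+ 2) = 3 / 4 by field; rewrite gt_eqF.
by rewrite ltxx.
Qed.

Lemma expr_near1 (x : C) (q : nat) : q%:R * nrm x <= 1 ->
  nrm ((1 + x) ^+ q - 1 - q%:R * x) <= (q%:R * nrm x) ^+ 2.
Proof.
have x0 := nrm_ge0 x.
elim: q => [|q IH]; first by rewrite expr0 subrr !mul0r subrr nrm0 expr0n.
rewrite -natr1 mulrDl mul1r => hq.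
have h1 : q%:R * nrm x <= 1 by lra.
have {IH} := IH h1.
have -> : (1 + x) ^+ q.+1 - 1 - q.+1%:R * x =
  ((1 + x) ^+ q - 1 - q%:R * x) * (1 + x) + q%:R * (x * x) by rewrite exprS -natr1; ring.
set y := (1 + x) ^+ q - 1 - q%:R * x => hy.
apply: le_trans (nrmD _ _) _; rewrite !nrmM nrm_nat.
have h2 : nrm (1 + x) <= 1 + nrm x by apply: le_trans (nrmD _ _) _; rewrite nrm1.
have h3 : nrm y * nrm (1 + x) <= (q%:R * nrm x) ^+ 2 * (1 + nrm x).
  by apply: ler_pM => //; exact: nrm_ge0.
have q0 : 0 <= q%:R :> R by [].
move: (nrm x) (q%:R : R) x0 q0 h1 h3 => a b a0 b0 ab h3.
apply: le_trans (lerD h3 (lexx _)) _.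
have : 0 <= b * a ^+ 2 * (1 - b * a) + a ^+ 2.
  by rewrite addr_ge0 ?sqr_ge0// !mulr_ge0 ?sqr_ge0// subr_ge0.
by nra.
Qed.

(** If [B ^+ q] is close to [1] for the same large [q] at [t] and [t'] with
    [t' - t] comparable to [1 / q], then [B t' / B t] cannot be at distance
    comparable to [1 / q] from [1]. *)
Lemma null_bilipschitz (Q : set nat) (E : set R) (B : R -> C) (c1 c2 : R) :
  (forall n, exists2 q, (n < q)%N & Q q) -> 0 < c1 -> 0 < c2 ->
  (forall t e, E t -> 0 < e -> exists K, forall q, (K < q)%N -> Q q ->
     nrm (B t ^+ q - 1) <= e) ->
  (forall t t', E t -> E t' -> c1 * `|t' - t| <= nrm (B t' - B t) <= c2 * `|t' - t|) ->
  null E.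
Proof.
move=> Qinf c10 c20 lim lip; apply: contrapT => nE.
pose e := Num.min 4^-1 (c1 / c2 / 200).
have e0 : 0 < e by rewrite lt_min invr_gt0 ltr0n !divr_gt0.
have e4 : e <= 4^-1 by rewrite ge_min lexx.
have ec : e <= c1 / c2 / 200 by rewrite ge_min lexx orbT.
pose F (K : nat) := [set t | forall q, (K < q)%N -> Q q -> nrm (B t ^+ q - 1) <= e].
have [|K] := @not_null_piece nat F E _ nE; first by move=> t Et; exact: lim.
apply; apply: null_porous => d d0.
have cd0 : 0 < 16 * c2 * d by rewrite !mulr_gt0.
have [q qK Qq] := Qinf (maxn K (Num.truncn (16 * c2 * d)^-1)).
move: qK; rewrite gtn_max => /andP[qK qd].
have q0 : 0 < q%:R :> R by rewrite ltr0n (leq_ltn_trans (leq0n _) qK).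
(* With this scale [q * |x|] is at most [1 / 4] for [x = B t' / B t - 1], so that
   [(1 + x) ^ q - 1] is comparable to [q * x]. *)
pose r := (16 * c2 * q%:R)^-1.
have r0 : 0 < r by rewrite invr_gt0 !mulr_gt0.
have qr : q%:R * r * (16 * c2) = 1.
  by rewrite /r; field; rewrite !gt_eqF.
exists r.
  rewrite r0/= /r -[d]invrK ltf_pV2 ?posrE ?invr_gt0 ?mulr_gt0//.
  have h : (16 * c2 * d)^-1 < q%:R.
    by apply: lt_le_trans (truncnS_gt _) _; rewrite ler_nat.
  rewrite -ltr_pdivrMl ?mulr_gt0//; apply: le_lt_trans h.
  by rewrite le_eqVlt -invfM eqxx.
move=> t t' [Et Ft] [Et' Ft']; apply/negP => /andP[h1 h2].
have bt := Ft q qK Qq; have bt' := Ft' q qK Qq.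
have bnd s : nrm (B s ^+ q - 1) <= e -> 2^-1 <= nrm (B s) ^+ q <= 2.
  move=> hs; rewrite -nrmX.
  have := nrm_rev 1 (1 - B s ^+ q); rewrite subKr nrmB nrm1 => a1.
  have := nrmD (B s ^+ q - 1) 1; rewrite subrK nrm1 => a2.
  by apply/andP; split; lra.
have q0' : (0 < q)%N by rewrite -(ltr_nat R).
have bnd2 s : 2^-1 <= nrm (B s) ^+ q <= 2 -> 2^-1 <= nrm (B s) <= 2.
  move=> /andP[a1 a2]; apply/andP; split; rewrite leNgt; apply/negP => a3.
    have : nrm (B s) ^+ q <= nrm (B s) ^+ 1.
      by apply: ler_wiXn2l => //; [exact: nrm_ge0|lra].
    by rewrite expr1; lra.
  have : nrm (B s) ^+ 1 <= nrm (B s) ^+ q by apply: ler_weXn2l => //; lra.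
  by rewrite expr1; lra.
have bq := bnd _ bt; have bq' := bnd _ bt'.
have /andP[b1 b2] := bnd2 _ bq.
have B0 : B t != 0 by rewrite -nrm_gt0; lra.
pose x := B t' / B t - 1.
have xE : nrm x * nrm (B t) = nrm (B t' - B t).
  by rewrite -nrmM /x mulrBl divfK// mul1r.
have /andP[l1 l2] := lip t t' Et Et'.
have tt : `|t' - t| = t' - t by rewrite ger0_norm//; lra.
rewrite tt -xE in l1 l2.
have x0 := nrm_ge0 x.
have xup : nrm x <= 4 * c2 * r by nra.
have xlo : c1 * r / 2 <= nrm x by nra.
have qx1 : q%:R * nrm x <= 4^-1.
  have := ler_wpM2l (ltW q0) xup.
  have -> : q%:R * (4 * c2 * r) = q%:R * r * (16 * c2) / 4 by field.
  by rewrite qr mul1r.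
have qx2 : c1 / c2 / 32 <= q%:R * nrm x.
  have := ler_wpM2l (ltW q0) xlo.
  have -> : q%:R * (c1 * r / 2) = (q%:R * r * (16 * c2)) * (c1 / c2 / 32).
    by field; rewrite gt_eqF.
  by rewrite qr mul1r.
have h4 := @expr_near1 x q.
have {}h4 : nrm ((1 + x) ^+ q - 1 - q%:R * x) <= (q%:R * nrm x) ^+ 2 by apply: h4; lra.
have h5 := nrm_rev (q%:R * x) (q%:R * x - ((1 + x) ^+ q - 1)).
rewrite subKr nrmM nrm_nat [nrm (_ - (_ - 1))]nrmB in h5.
have h6 : nrm ((1 + x) ^+ q - 1) * nrm (B t) ^+ q = nrm (B t' ^+ q - B t ^+ q).
  have xB : (1 + x) * B t = B t' by rewrite /x addrC subrK divfK.
  by rewrite -nrmX -nrmM mulrBl mul1r -exprMn xB.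
have h7 : nrm (B t' ^+ q - B t ^+ q) <= 2 * e.
  by apply: le_trans (nrm_tri _ 1 _) _; rewrite [nrm (1 - _)]nrmB; lra.
have /andP[bq1 _] := bq.
have h8 : nrm ((1 + x) ^+ q - 1) <= 4 * e.
  have := nrm_ge0 ((1 + x) ^+ q - 1); nra.
have c0 : 0 < c1 / c2 by rewrite divr_gt0.
by nra.
Qed.

End NullSets.

(** * First-order expansions *)

Section Smooth.
Context {R : realType}.
Local Notation C := R[i].
Implicit Types F G : R -> C -> C.

Lemma nrm_addC (x y : C) : nrm (x + y) = nrm (y + x).
Proof. by rewrite addrC. Qed.

Lemma nrm_expi_taylor (y : R) : nrm (expi y - 1 - y%:C%C * 'i%C) <= 2 * y ^+ 2.
Proof.
have cos_le (c : R) : `|cos c - 1| <= `|c|.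
  have := nrm_expiB c 0; rewrite subr0; apply: le_trans.
  by have := le_Re_nrm (expi c - expi 0); rewrite /= cos0.
have sin_le : `|sin y - y| <= y ^+ 2.
  wlog y0 : y / 0 <= y.
    move=> H; have [/H//|/ltW y0] := leP 0 y.
    have := H (- y); rewrite oppr_ge0 => /(_ y0).
    by rewrite sinN -opprD normrN sqrrN.
  have [->|yn0] := eqVneq y 0; first by rewrite sin0 subrr normr0 expr0n.
  have yp : 0 < y by rewrite lt_def yn0.
  have [|c + ] := @MVT _ (@sin R) (@cos R) 0 y yp.
    by apply: continuous_subspaceT => z; exact: continuous_sin.
  rewrite in_itv/= sin0 !subr0 => /andP[c0 cy] ->.
  have -> : cos c * y - y = (cos c - 1) * y by ring.
  rewrite normrM expr2 [`|y|]ger0_norm// ler_wpM2r//.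
  by apply: le_trans (cos_le c) _; rewrite gtr0_norm// ltW.
have cos_le2 : `|cos y - 1| <= y ^+ 2.
  have -> : cos y - 1 = - (2 * sin (y / 2) ^+ 2).
    rewrite sin2cos2; have {1}-> : y = y / 2 *+ 2 by rewrite mulr2n; field.
    by rewrite cos_mulr2n; ring.
  rewrite normrN normrM normrX.
  have := sin_le_id (y / 2); rewrite normrM [`|2^-1|]ger0_norm ?invr_ge0// => h.
  have := normr_ge0 (sin (y / 2)); have := real_normK (num_real y).
  by rewrite [`|2|]ger0_norm//; nra.
apply: le_trans (nrm_le_ReIm _) _ => /=.
by rewrite !mul0r !mulr0 !mulr1 ?subr0 ?addr0 ?add0r ?subr0; lra.
Qed.

(** Stands for twice differentiability with locally bounded second derivatives:
    a first-order expansion whose error is quadratic, uniformly on bounded sets.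
    The second variable is complex and the dependence on it holomorphic. *)
Definition smooth F Ft Fz := forall L : R, exists2 K : R, 0 <= K &
  forall t t' z z', `|t| <= L -> `|t'| <= L -> nrm z <= L -> nrm z' <= L ->
  [/\ nrm (F t z) <= K, nrm (Ft t z) <= K, nrm (Fz t z) <= K &
   nrm (F t' z' - F t z - Ft t z * (t' - t)%:C%C - Fz t z * (z' - z)) <=
     K * (`|t' - t| + nrm (z' - z)) ^+ 2].

Lemma smooth_ext F Ft Fz G Gt Gz : smooth F Ft Fz ->
  (forall t z, F t z = G t z) -> (forall t z, Ft t z = Gt t z) ->
  (forall t z, Fz t z = Gz t z) -> smooth G Gt Gz.
Proof.
move=> sF e1 e2 e3 L; have [K K0 H] := sF L; exists K => // t t' z z' h1 h2 h3 h4.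
by have := H t t' z z' h1 h2 h3 h4; rewrite !e1 !e2 !e3.
Qed.

Lemma smooth_cst c : smooth (fun _ _ => c) (fun _ _ => 0) (fun _ _ => 0).
Proof.
move=> L; exists (nrm c); first exact: nrm_ge0.
move=> t t' z z' _ _ _ _; rewrite !mul0r subrr !subr0 nrm0 nrm_ge0; split=> //.
by rewrite mulr_ge0 ?sqr_ge0// nrm_ge0.
Qed.

Lemma smooth_var : smooth (fun _ z => z) (fun _ _ => 0) (fun _ _ => 1).
Proof.
move=> L; exists (`|L| + 1); first by rewrite addr_ge0.
move=> t t' z z' _ _ hz _; rewrite !mul0r mul1r subr0 subrr !nrm0 nrm1.
have := ler_norm L => hL; split; rewrite ?addr_ge0//.
- by apply: le_trans hz _; rewrite (le_trans hL)// lerDl.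
- by rewrite lerDr.
- by rewrite mulr_ge0 ?addr_ge0// sqr_ge0.
Qed.

Lemma smooth_cexp (a : R) : smooth (fun t _ => cexp (a * t))
  (fun t _ => (2 * pi * a)%:C%C * 'i%C * cexp (a * t)) (fun _ _ => 0).
Proof.
move=> L; pose b := 2 * pi * a.
exists (1 + `|b| + 2 * b ^+ 2).
  by rewrite !addr_ge0// mulr_ge0// sqr_ge0.
have b2 : 0 <= b ^+ 2 by exact: sqr_ge0.
move=> t t' z z' _ _ _ _; rewrite nrm0 !mul0r subr0; split.
- by rewrite nrm_cexp -addrA lerDl addr_ge0// mulr_ge0.
- rewrite nrmM nrm_cexp mulr1 nrmM nrm_real -/b.
  have -> : nrm ('i%C : C) = 1 by rewrite nrmE /= expr0n expr1n add0r sqrtr1.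
  by rewrite mulr1 addrAC lerDr addr_ge0// mulr_ge0.
- by rewrite !addr_ge0// mulr_ge0.
have -> : cexp (a * t') - cexp (a * t) - (2 * pi * a)%:C%C * 'i%C * cexp (a * t) * (t' - t)%:C%C
  = cexp (a * t) * (expi (b * (t' - t)) - 1 - (b * (t' - t))%:C%C * 'i%C).
  have -> : expi (b * (t' - t)) = cexp (a * t') / cexp (a * t).
    by rewrite -cexpB /cexp /b -mulrBr mulrA.
  rewrite [(b * (t' - t))%:C%C](rmorphM (real_complex R)) mulrBr mulrBr mulr1 mulrCA divff ?cexp_neq0//.
  by rewrite /b; ring.
rewrite nrmM nrm_cexp mul1r; apply: le_trans (nrm_expi_taylor _) _.
have s0 := nrm_ge0 (z' - z); have := normr_ge0 (t' - t).
rewrite exprMn -[X in 2 * (_ * X)]real_normK ?num_real// => h.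
have h1 : `|t' - t| ^+ 2 <= (`|t' - t| + nrm (z' - z)) ^+ 2.
  by rewrite ler_sqr ?nnegrE ?addr_ge0// lerDl.
have h2 := sqr_ge0 (`|t' - t| + nrm (z' - z)).
rewrite mulrA; apply: le_trans (ler_wpM2l _ h1) _; first by rewrite mulr_ge0.
by rewrite ler_wpM2r// lerDr addr_ge0.
Qed.

Lemma smoothD F Ft Fz G Gt Gz : smooth F Ft Fz -> smooth G Gt Gz ->
  smooth (fun t z => F t z + G t z) (fun t z => Ft t z + Gt t z) (fun t z => Fz t z + Gz t z).
Proof.
move=> sF sG L; have [K K0 H] := sF L; have [K' K'0 H'] := sG L.
exists (K + K'); first by rewrite addr_ge0.
move=> t t' z z' h1 h2 h3 h4.
have [a1 a2 a3 a4] := H t t' z z' h1 h2 h3 h4.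
have [b1 b2 b3 b4] := H' t t' z z' h1 h2 h3 h4.
split; try by apply: le_trans (nrmD _ _) _; apply: lerD.
rewrite [leRHS]mulrDl; apply: le_trans (lerD a4 b4); apply: le_trans (nrmD _ _).
by rewrite le_eqVlt; apply/orP; left; apply/eqP; congr nrm; ring.
Qed.

Lemma smoothM F Ft Fz G Gt Gz : smooth F Ft Fz -> smooth G Gt Gz ->
  smooth (fun t z => F t z * G t z) (fun t z => Ft t z * G t z + F t z * Gt t z)
    (fun t z => Fz t z * G t z + F t z * Gz t z).
Proof.
move=> sF sG L; have [K K0 H] := sF L; have [K' K'0 H'] := sG L.
exists (K * K' * (3 + 4 * `|L|)); first by rewrite !mulr_ge0// addr_ge0// mulr_ge0.
move=> t t' z z' h1 h2 h3 h4.
have [a1 a2 a3 a4] := H t t' z z' h1 h2 h3 h4.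
have [b1 b2 b3 b4] := H' t t' z z' h1 h2 h3 h4.
have [c1 _ _ _] := H' t' t z' z h2 h1 h4 h3.
have nM (x y : C) (u v : R) : nrm x <= u -> nrm y <= v -> nrm (x * y) <= u * v.
  by move=> hx hy; rewrite nrmM ler_pM ?nrm_ge0.
have KK0 : 0 <= K * K' by rewrite mulr_ge0.
have L0 := normr_ge0 L.
have KL : K * K' <= K * K' * (3 + 4 * `|L|) by rewrite ler_peMr//; lra.
have KL2 : K * K' + K * K' <= K * K' * (3 + 4 * `|L|) by nra.
split; first by apply: le_trans KL; exact: nM.
- apply: le_trans KL2; apply: le_trans (nrmD _ _) _; apply: lerD; exact: nM.
- apply: le_trans KL2; apply: le_trans (nrmD _ _) _; apply: lerD; exact: nM.
set s := `|t' - t| + nrm (z' - z) in a4 b4 *.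
have s1 : `|t' - t| <= s by rewrite lerDl nrm_ge0.
have s2 : nrm (z' - z) <= s by rewrite lerDr.
have s0 : 0 <= s by rewrite addr_ge0// nrm_ge0.
have sL : s <= 4 * `|L|.
  have := ler_norm L; have := ler_normB t' t; have := nrmBD z' z.
  by rewrite /s; lra.
pose dF := Ft t z * (t' - t)%:C%C + Fz t z * (z' - z).
pose dG := Gt t z * (t' - t)%:C%C + Gz t z * (z' - z).
have ndF : nrm dF <= K * s.
  rewrite /s mulrDr; apply: le_trans (nrmD _ _) _.
  by apply: lerD; apply: nM => //; rewrite nrm_real.
have ndG : nrm dG <= K' * s.
  rewrite /s mulrDr; apply: le_trans (nrmD _ _) _.
  by apply: lerD; apply: nM => //; rewrite nrm_real.
have ra : nrm (F t' z' - F t z - dF) <= K * s ^+ 2 by rewrite /dF opprD addrA.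
have rb : nrm (G t' z' - G t z - dG) <= K' * s ^+ 2 by rewrite /dG opprD addrA.
have nG : nrm (G t' z' - G t z) <= K' * (1 + 4 * `|L|) * s.
  have -> : G t' z' - G t z = (G t' z' - G t z - dG) + dG by ring.
  apply: le_trans (nrmD _ _) _; apply: le_trans (lerD rb ndG) _.
  have : K' * s * s <= K' * s * (4 * `|L|) by rewrite ler_wpM2l// mulr_ge0.
  by rewrite expr2; lra.
have -> : F t' z' * G t' z' - F t z * G t z - (Ft t z * G t z + F t z * Gt t z) * (t' - t)%:C%C
   - (Fz t z * G t z + F t z * Gz t z) * (z' - z)
   = (F t' z' - F t z - dF) * G t' z' + dF * (G t' z' - G t z) + F t z * (G t' z' - G t z - dG).
  by rewrite /dF /dG; ring.
apply: le_trans (nrmD _ _) _.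
apply: le_trans (lerD (nrmD _ _) (lexx _)) _.
have h5 := nM _ _ _ _ ra c1; have h6 := nM _ _ _ _ ndF nG; have h7 := nM _ _ _ _ a1 rb.
apply: le_trans (lerD (lerD h5 h6) h7) _.
by rewrite le_eqVlt; apply/orP; left; apply/eqP; ring.
Qed.

End Smooth.

(** * Functions algebraic over an exponential *)

Section Bivariate.
Context {R : realType}.
Local Notation C := R[i].
Implicit Types P : {poly {poly C}}.

(** A polynomial in [w] with coefficients in [C[z]]; [ev P z w] is its value. *)
Definition ev P (z w : C) : C := P.[w%:P].[z].

Lemma evD P Q z a : ev (P + Q) z a = ev P z a + ev Q z a.
Proof. by rewrite /ev !hornerD. Qed.

Lemma evM P Q z a : ev (P * Q) z a = ev P z a * ev Q z a.
Proof. by rewrite /ev !hornerM. Qed.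

Lemma evN P z a : ev (- P) z a = - ev P z a.
Proof. by rewrite /ev !hornerN. Qed.

Lemma evC (c : {poly C}) z a : ev c%:P z a = c.[z].
Proof. by rewrite /ev hornerC. Qed.

Lemma evX z a : ev 'X z a = a.
Proof. by rewrite /ev hornerX hornerC. Qed.

Lemma evE P z a : ev P z a = \sum_(i < size P) (P`_i).[z] * a ^+ i.
Proof.
rewrite /ev [P.[_]]horner_coef horner_sum; apply: eq_bigr => i _.
by rewrite hornerM -polyC_exp hornerC.
Qed.

(** The derivation of [C[z][w]] for which [z = cexp t] and [w] proportional to
    [cexp (theta t)] satisfy [d z = z] and [d w = theta w]. *)
Definition tderiv (theta : R) P : {poly {poly C}} :=
  \poly_(i < size P) ('X * (P`_i)^`() + (i%:R * theta%:C%C) *: P`_i).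

Lemma coef_tderiv theta P i :
  (tderiv theta P)`_i = 'X * (P`_i)^`() + (i%:R * theta%:C%C) *: P`_i.
Proof.
rewrite coef_poly; case: ltnP => // /(nth_default 0)->.
by rewrite deriv0 mulr0 scaler0 addr0.
Qed.

Lemma tderivC theta (c : {poly C}) : tderiv theta c%:P = ('X * c^`())%:P.
Proof.
apply/polyP => i; rewrite coef_tderiv !coefC.
by case: i => [|i]; rewrite ?mul0r ?scale0r ?addr0// deriv0 mulr0 scaler0 addr0.
Qed.

Lemma tderivD theta P Q : tderiv theta (P + Q) = tderiv theta P + tderiv theta Q.
Proof.
by apply/polyP => i; rewrite coefD !coef_tderiv coefD derivD mulrDr scalerDr; ring.
Qed.

Lemma tderivMX theta P :
  tderiv theta (P * 'X) = tderiv theta P * 'X + (theta%:C%C)%:P%:P * (P * 'X).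
Proof.
apply/polyP => i; rewrite coefD coefCM !coefMX !coef_tderiv !coefMX.
case: i => [|i] /=; first by rewrite deriv0 !mulr0 scaler0 !addr0.
by rewrite mul_polyC -natr1 mulrDl mul1r scalerDl addrA.
Qed.

Lemma smooth_ev (omega theta : R) P :
  smooth (fun t b => ev P (cexp (omega * t)) (b * cexp (theta * omega * t)))
   (fun t b => (2 * pi * omega)%:C%C * 'i%C *
      ev (tderiv theta P) (cexp (omega * t)) (b * cexp (theta * omega * t)))
   (fun t b => cexp (theta * omega * t) *
      ev P^`() (cexp (omega * t)) (b * cexp (theta * omega * t))).
Proof.
have smC (c : {poly C}) : smooth (fun t (_ : C) => c.[cexp (omega * t)])
    (fun t _ => (2 * pi * omega)%:C%C * 'i%C * ('X * c^`()).[cexp (omega * t)]) (fun _ _ => 0).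
  elim/poly_ind: c => [|c d IH].
    by apply: smooth_ext (@smooth_cst R 0) _ _ _ => t z; rewrite ?deriv0 ?mulr0 ?horner0 ?mulr0.
  apply: smooth_ext (smoothD (smoothM IH (smooth_cexp omega)) (smooth_cst d)) _ _ _ => t z.
  - by rewrite !hornerE.
  - rewrite derivD derivM derivX derivC !(hornerD, hornerM, hornerX, hornerC).
    by ring.
  - by rewrite !mul0r mulr0 !addr0.
elim/poly_ind: P => [|P c IH].
  apply: smooth_ext (@smooth_cst R 0) _ _ _ => t z.
  - by rewrite -polyC0 evC horner0.
  - by rewrite -polyC0 tderivC evC deriv0 mulr0 horner0 mulr0.
  - by rewrite deriv0 -polyC0 evC horner0 mulr0.
have smW := smoothM (@smooth_var R) (smooth_cexp (theta * omega)).
apply: smooth_ext (smoothD (smoothM IH smW) (smC c)) _ _ _ => t z.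
- by rewrite evD evM evX evC.
- rewrite tderivD tderivMX tderivC !evD !evM evX !evC hornerC.
  rewrite !(rmorphM (real_complex R)) /=; ring.
- rewrite derivD derivM derivX derivC mulr1 !addr0 !evD !evM evX; ring.
Qed.

Lemma null_cexp_roots (omega : R) (c : {poly C}) : omega != 0 -> c != 0 ->
  null [set t | c.[cexp (omega * t)] = 0].
Proof.
move=> om0 c0; have [rs cE] := closed_field_poly_normal c.
have nullpt z : null [set t | cexp (omega * t) = z].
  have [->|/set0P[t0 /= ht0]] := eqVneq [set t | cexp (omega * t) = z] set0.
    exact: null0.
  apply: nullS (null_bigcup (fun n : int => null_set1 (t0 + n%:~R / omega))) => t /= ht.
  have : cexp (omega * (t - t0)) = 1.
    by rewrite mulrBr cexpB ht ht0 divff// -ht cexp_neq0.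
  by move=> /cexp_eq1[n hn]; exists n => //=; rewrite -hn; field; exact: om0.
apply: nullS (null_seq rs nullpt) => t /= /eqP; rewrite -/(root c _) cE.
rewrite rootZ ?lead_coef_eq0// root_prod_XsubC => ht.
by exists (cexp (omega * t)).
Qed.

Lemma lc_neq0 (S : idomainType) (P : {poly S}) : P != 0 -> lead_coef P != 0.
Proof. by rewrite lead_coef_eq0. Qed.

Lemma coefM_top (p q : {poly C}) i j :
  (size p <= i.+1)%N -> (size q <= j.+1)%N -> (p * q)`_(i + j) = p`_i * q`_j.
Proof.
move=> pi qj; rewrite coefM.
have ij : (i < (i + j).+1)%N by rewrite ltnS leq_addr.
rewrite (bigD1 (Ordinal ij))//= addKn big1 ?addr0// => k ki.
have [ik|ki'] := ltnP i k.
  by rewrite [p`_k]nth_default ?mul0r// (leq_trans pi).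
rewrite [q`_ _]nth_default ?mulr0// (leq_trans qj)//.
have : (k < i)%N.
  by rewrite ltn_neqAle ki' andbT; apply: contraNneq ki => e; apply/eqP/val_inj.
by clear; lia.
Qed.

Lemma coef_XD (p : {poly C}) i : ('X * p^`())`_i = i%:R * p`_i.
Proof.
by rewrite mulrC coefMX; case: i => [|i]; rewrite ?mul0r//= coef_deriv mulr_natl.
Qed.

Lemma size_XD (p : {poly C}) i : (size p <= i.+1)%N -> (size ('X * p^`())%R <= i.+1)%N.
Proof.
move=> sp; apply/leq_sizeP => j ij; rewrite coef_XD nth_default ?mulr0//.
exact: leq_trans ij.
Qed.

Lemma quadratic_error (K M eta x y : R) : 0 <= K <= M -> 0 < M ->
  eta * (16 * M * M) = 1 -> 0 <= x -> 0 <= y -> x <= eta -> y <= 2 * eta ->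
  K * (x + y) ^+ 2 <= (x + y) / (4 * M).
Proof.
move=> /andP[K0 KM] M0 etaM x0 y0 xe ye.
rewrite ler_pdivlMr ?mulr_gt0// expr2 -!mulrA mulrCA ler_piMr ?addr_ge0//.
have : K * ((x + y) * (4 * M)) <= M * ((3 * eta) * (4 * M)).
  apply: ler_pM => //; first by rewrite mulr_ge0 ?addr_ge0// mulr_ge0// ltW.
  by apply: ler_wpM2r; [rewrite mulr_ge0// ltW|lra].
by lra.
Qed.

(** If [F] vanishes at two points and both its partial derivatives are bounded
    above and away from zero, the increments [x] and [y] of the two variables are
    comparable. *)
Lemma comparable_of_relation (M a b x y : R) : 1 <= M -> 0 <= x -> 0 <= y ->
  1 <= M * a -> 1 <= M * b -> a <= M -> b <= M ->
  a * x - b * y <= (x + y) / (4 * M) -> b * y - a * x <= (x + y) / (4 * M) ->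
  (2 * M * M)^-1 * x <= y <= 2 * M * M * x.
Proof.
move=> M1 x0 y0 Ma Mb aM bM r1 r2; have M0 : 0 < M := lt_le_trans ltr01 M1.
have v1 : x <= M * (a * x) by rewrite mulrA ler_peMl.
have v2 : y <= M * (b * y) by rewrite mulrA ler_peMl.
have v3 : b * y <= M * y by rewrite ler_wpM2r.
have v4 : a * x <= M * x by rewrite ler_wpM2r.
have s5 : M * ((x + y) / (4 * M)) = (x + y) / 4 by field; rewrite gt_eqF.
have w1 : x <= M * (M * y) + (x + y) / 4.
  by rewrite -s5 -mulrDr; apply: le_trans v1 _; rewrite ler_pM2l//; lra.
have w2 : y <= M * (M * x) + (x + y) / 4.
  by rewrite -s5 -mulrDr; apply: le_trans v2 _; rewrite ler_pM2l//; lra.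
have MM : 1 <= M * M by rewrite -[1]mulr1 ler_pM.
have My : y <= M * (M * y) by rewrite mulrA ler_peMl.
have Mx : x <= M * (M * x) by rewrite mulrA ler_peMl.
apply/andP; split; last by lra.
by rewrite mulrC ler_pdivrMr ?mulr_gt0//; lra.
Qed.

(** A polynomial relation between [cexp (omega t)] and [A t] forces
    [A t = B t * cexp (theta omega t)] with [B] bi-Lipschitz on a set that is not
    null, which [null_bilipschitz] excludes. For a relation of least degree among
    those that hold on some such set, the two partial derivatives of the relation,
    as a function of [t] and [B], vanish only on null sets: the derivative in [B]
    because its degree is smaller; the derivative in [t] because otherwise it would
    be proportional to the relation, and comparing the coefficients of degree [0]
    and of top degree would make a multiple of [theta] an integer. *)
Theorem null_algebraic (omega theta : R) (Q : set nat) (E : set R) (A : R -> C)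
    (Rel : {poly {poly C}}) :
  omega != 0 -> irrational_angle theta ->
  (forall n, exists2 q, (n < q)%N & Q q) -> Rel != 0 ->
  (forall t, E t -> ev Rel (cexp (omega * t)) (A t) = 0) ->
  (forall t e, E t -> 0 < e -> exists K, forall q, (K < q)%N -> Q q ->
     nrm ((A t / cexp (theta * omega * t)) ^+ q - 1) <= e) ->
  null E.
Proof.
move=> om0 irr Qinf Rel0 hRel lim; apply: contrapT => nE.
pose vanish (P : {poly {poly C}}) := [set t | ev P (cexp (omega * t)) (A t) = 0].
pose deg k := `[< exists E' P, [/\ E' `<=` E, ~ null E', P != 0, size P = k & E' `<=` vanish P] >].
have exk : exists k, deg k by exists (size Rel); apply/asboolP; exists E, Rel; split=> // t; exact: hRel.
case: (ex_minnP exk) => k /asboolP[E1 [P [E1E nE1 P0 sP E1P]]] kmin.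
have small P' : P' != 0 -> (size P' < k)%N -> null (E1 `&` vanish P').
  move=> P'0 sP'; apply: contrapT => nn.
  have : deg (size P') by apply/asboolP; exists (E1 `&` vanish P'), P'; split=> // t []// /E1E.
  by move/kmin; rewrite leqNgt sP'.
have A0 t : E t -> A t != 0.
  move=> Et; apply/eqP => At0; have h20 : 0 < 2^-1 :> R by rewrite invr_gt0.
  have [K hK] := lim t 2^-1 Et h20.
  have [q qK Qq] := Qinf K; have := hK q qK Qq.
  rewrite At0 mul0r expr0n gtn_eqF ?(leq_ltn_trans _ qK)// sub0r nrmN nrm1.
  by lra.
pose n := k.-1.
have k1 : (1 < k)%N.
  rewrite ltnNge; apply/negP => k1; apply: nE1.
  move: (P0) E1P; rewrite (size1_polyC (_ : size P <= 1)%N) ?sP// polyC_eq0 => c0 E1P.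
  by apply: nullS (null_cexp_roots om0 c0) => t /E1P; rewrite /vanish/= evC.
have kE : k = n.+1 by rewrite /n prednK// ltnW.
have n0 : (0 < n)%N by rewrite -ltnS -kE.
have Pn0 : P`_n != 0 by have := lc_neq0 P0; rewrite /lead_coef sP.
(* Otherwise [w] could be cancelled, as [A] has no zero. *)
have P00 : P`_0 != 0.
  apply/eqP => P00; apply: nE1.
  have [D PD] : exists D, P = D * 'X.
    exists (\poly_(i < n) P`_i.+1); apply/polyP => i; rewrite coefMX; case: i => [|i]//=.
    rewrite coef_poly; case: ltnP => // ni; rewrite nth_default// sP kE ltnS//.
  have D0 : D != 0 by apply: contra_neq P0 => D0; rewrite PD D0 mul0r.
  have sD : (size D < k)%N by rewrite -sP PD size_mulX.
  apply: nullS (small D D0 sD) => t E1t; split=> //.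
  have := E1P t E1t; rewrite /vanish/= PD evM evX => /eqP.
  by rewrite mulf_eq0 (negbTE (A0 _ (E1E _ E1t))) orbF => /eqP.
have nW : null (E1 `&` vanish P^`()).
  apply: small; last by rewrite -sP lt_size_deriv.
  apply/eqP => d0; have := congr1 (fun p : {poly {poly C}} => p`_n.-1) d0.
  rewrite coef_deriv coef0 prednK// => /eqP; apply/negP.
  by rewrite -mulr_natl mulf_neq0// -polyC1 -polyCMn polyC_eq0 pnatr_eq0 -lt0n.
pose T := tderiv theta P.
(* The top coefficients cancel, so [S] has smaller degree than [P]. *)
pose S := (P`_n)%:P * T - (T`_n)%:P * P.
have vS t : E1 t -> vanish T t -> vanish S t.
  rewrite /vanish/= => /E1P; rewrite /vanish/= => h1 h2.
  by rewrite /S evD evN !evM h1 h2 !mulr0 subr0.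
have nT : null (E1 `&` vanish T).
  have [S0|S0] := eqVneq S 0; last first.
    have sS : (size S < k)%N.
      rewrite kE ltnS; apply/leq_sizeP => i; rewrite leq_eqVlt => /orP[/eqP<-|ni].
        by rewrite coefB !coefCM mulrC subrr.
      rewrite coefB !coefCM coef_tderiv [P`_i]nth_default ?sP ?kE//.
      by rewrite deriv0 mulr0 scaler0 addr0 !mulr0 subrr.
    by apply: nullS (small S S0 sS) => t [E1t /(vS t E1t)].
  exfalso.
  have := congr1 (fun p : {poly {poly C}} => p`_0) S0.
  rewrite coefB !coefCM !coef_tderiv coef0 mul0r scale0r addr0 => /eqP.
  rewrite subr_eq0 => /eqP e0.
  pose a := (size P`_n).-1; pose b := (size P`_0).-1.
  have sa : size P`_n = a.+1 by rewrite prednK// size_poly_gt0.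
  have sb : size P`_0 = b.+1 by rewrite prednK// size_poly_gt0.
  have := congr1 (fun p : {poly C} => p`_(a + b)) e0.
  rewrite coefM_top ?sa ?size_XD ?sb// coefM_top ?sb//; last first.
    apply: leq_trans (size_polyD _ _) _; rewrite geq_max size_XD ?sa//=.
    by apply: leq_trans (size_scale_leq _ _) _; rewrite sa.
  rewrite coefD coefZ !coef_XD => e1.
  have a0 : P`_n`_a != 0 by have := lc_neq0 Pn0; rewrite /lead_coef.
  have b0 : P`_0`_b != 0 by have := lc_neq0 P00; rewrite /lead_coef.
  have e2 : b%:R = a%:R + n%:R * theta%:C%C :> C.
    apply: (mulfI (mulf_neq0 a0 b0)).
    by move: e1; rewrite -mulrDl => e1; rewrite -mulrA [_`_b * _]mulrC e1; ring.
  have e3 : n%:R * theta = (b%:Z - a%:Z)%:~R.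
    apply: (@complexI R); rewrite rmorphM rmorph_nat intrB -!pmulrn rmorphB !rmorph_nat.
    by rewrite e2; ring.
  by have := irr n n0; rewrite e3 cexp_int eqxx.
pose E2 := [set t | E1 t /\ ~ vanish P^`() t /\ ~ vanish T t].
have nE2 : ~ null E2.
  move=> nE2; apply: nE1; apply: nullS (nullU nE2 (nullU nW nT)) => t E1t.
  have [v1|v1] := pselect (vanish P^`() t); first by right; left.
  have [v2|v2] := pselect (vanish T t); first by right; right.
  by left.
pose B t := A t / cexp (theta * omega * t).
have AB t : A t = B t * cexp (theta * omega * t) by rewrite /B divfK// cexp_neq0.
pose ft t := (2 * pi * omega)%:C%C * 'i%C * ev T (cexp (omega * t)) (A t).
pose fb t := cexp (theta * omega * t) * ev P^`() (cexp (omega * t)) (A t).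
have ft0 t : E2 t -> 0 < nrm (ft t).
  move=> [_ [_ /eqP v]]; rewrite nrm_gt0 !mulf_neq0//.
    by rewrite fmorph_eq0 !mulf_neq0// gt_eqF// pi_gt0.
  by rewrite eq_complex/= oner_eq0 andbF.
have fb0 t : E2 t -> 0 < nrm (fb t).
  by move=> [_ [/eqP v _]]; rewrite nrm_gt0 mulf_neq0// cexp_neq0.
pose F3 (m : nat) := [set t | [/\ `|t| <= m%:R, nrm (B t) <= m%:R,
   1 <= m%:R * nrm (ft t) & 1 <= m%:R * nrm (fb t)]].
have [|m nE3] := @not_null_piece R nat F3 E2 _ nE2.
  move=> t E2t; pose x := `|t| + nrm (B t) + (nrm (ft t))^-1 + (nrm (fb t))^-1.
  have p1 := ft0 t E2t; have p2 := fb0 t E2t.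
  have p3 := nrm_ge0 (B t); have p4 := normr_ge0 t.
  have i1 : 0 < (nrm (ft t))^-1 by rewrite invr_gt0.
  have i2 : 0 < (nrm (fb t))^-1 by rewrite invr_gt0.
  have xm : x <= (Num.truncn x).+1%:R by apply: ltW; exact: truncnS_gt.
  exists (Num.truncn x).+1; split.
  - by apply: le_trans xm; rewrite /x; lra.
  - by apply: le_trans xm; rewrite /x; lra.
  - by rewrite -ler_pdivrMr// mul1r; apply: le_trans xm; rewrite /x; lra.
  - by rewrite -ler_pdivrMr// mul1r; apply: le_trans xm; rewrite /x; lra.
have [K K0 sm] := smooth_ev omega theta P m%:R.
pose M := K + m%:R + 1.
have m0 : 0 <= m%:R :> R by [].
have M1 : 1 <= M by rewrite /M; lra.
have M0 : 0 < M by lra.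
pose eta := (16 * M * M)^-1.
have MM0 : 0 < 16 * M * M by rewrite !mulr_gt0.
have eta0 : 0 < eta by rewrite invr_gt0.
pose cell (x : R) (i : int) := i = Num.floor (x / eta).
have cellP x y i : cell x i -> cell y i -> `|x - y| <= eta.
  move=> hx hy; have := floor_itv (x / eta); have := floor_itv (y / eta).
  rewrite -hx -hy intrD => /andP[y1 y2] /andP[x1 x2].
  have -> : x - y = (x / eta - y / eta) * eta by field; rewrite gt_eqF.
  by rewrite normrM (gtr0_norm eta0); apply: ler_piMl; [exact: ltW|rewrite ler_norml; apply/andP; split; lra].
(* Cells so small that the quadratic error is absorbed by the linear terms. *)
pose F4 (i : int * int * int) := [set t | [/\ cell t i.1.1,
  cell (complex.Re (B t)) i.1.2 & cell (complex.Im (B t)) i.2]].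
have [|[[i j] l] nE4] := @not_null_piece R _ F4 (E2 `&` F3 m) _ nE3.
  by move=> t _; exists (Num.floor (t / eta), Num.floor (complex.Re (B t) / eta),
    Num.floor (complex.Im (B t) / eta)).
apply: nE4; apply: (@null_bilipschitz R Q _ B (2 * M * M)^-1 (2 * M * M)) => //.
- by rewrite invr_gt0 !mulr_gt0.
- by rewrite !mulr_gt0.
- by move=> t e [[[/E1E Et _] _] _] e0; exact: lim.
move=> t t' [[E2t [t1 t2 t3 t4]] [/= c1 c2 c3]] [[E2t' [u1 u2 u3 u4]] [/= d1 d2 d3]].
have [_ f2 f3 f4] := sm t t' (B t) (B t') t1 u1 t2 u2.
have z1 : ev P (cexp (omega * t)) (A t) = 0 by have [/E1P] := E2t.
have z2 : ev P (cexp (omega * t')) (A t') = 0 by have [/E1P] := E2t'.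
rewrite -!AB z1 z2 subrr sub0r -/T -/(ft t) -/(fb t) in f2 f3 f4.
set x := `|t' - t| in f4 *; set y := nrm (B t' - B t) in f4 *.
have x0 : 0 <= x by exact: normr_ge0.
have y0 : 0 <= y by exact: nrm_ge0.
have xe : x <= eta by exact: cellP d1 c1.
have ye : y <= 2 * eta.
  apply: le_trans (nrm_le_ReIm _) _; rewrite mulr_natl mulr2n.
  by apply: lerD; rewrite raddfB; [exact: cellP d2 c2|exact: cellP d3 c3].
have KM : K <= M by rewrite /M; lra.
have mM : m%:R <= M by rewrite /M; lra.
have etaM : eta * (16 * M * M) = 1 by rewrite mulVf// gt_eqF.
have s4 : nrm (ft t * (t' - t)%:C%C + fb t * (B t' - B t)) <= (x + y) / (4 * M).
  rewrite -nrmN opprD; apply: le_trans f4 _.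
  by apply: quadratic_error etaM x0 y0 xe ye => //; rewrite K0.
have n1 : nrm (ft t * (t' - t)%:C%C) = nrm (ft t) * x by rewrite nrmM nrm_real.
have n2 : nrm (fb t * (B t' - B t)) = nrm (fb t) * y by rewrite nrmM.
have r1 := nrm_rev (ft t * (t' - t)%:C%C) (- (fb t * (B t' - B t))).
have r2 := nrm_rev (fb t * (B t' - B t)) (- (ft t * (t' - t)%:C%C)).
rewrite nrmN opprK n1 n2 in r1; rewrite nrmN opprK n1 n2 nrm_addC in r2.
apply: (@comparable_of_relation _ (nrm (ft t)) (nrm (fb t))) => //.
- by rewrite (le_trans t3)// ler_wpM2r// nrm_ge0.
- by rewrite (le_trans t4)// ler_wpM2r// nrm_ge0.
- exact: le_trans f2 KM.
- exact: le_trans f3 KM.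
- exact: le_trans r1 s4.
- exact: le_trans r2 s4.
Qed.

End Bivariate.

(** * Integral elements of rings of functions *)

Section IntegralElements.
Variables (A K : comNzRingType) (f : {rmorphism A -> K}).

(** The factor [y] exempts the points at which [y] vanishes from the equation,
    when [K] is a ring of functions. *)
Lemma integral_of_equation (y : K) m (c : nat -> A) :
  y * (y ^+ m + \sum_(j < m) f (c j) * y ^+ j) = 0 -> integralOver f y.
Proof.
move=> e; pose p : {poly K} := \poly_(j < m.+1) (if j == m then 1 else f (c j)).
have pm : p \is monic by rewrite monicE lead_coef_poly ?eqxx// oner_eq0.
apply: (@integral_root_monic _ _ f _ ('X * p)).
- by rewrite monicMl// monicX.
- apply/rootP; rewrite hornerM hornerX horner_poly big_ord_recr/= eqxx mul1r addrC.
  rewrite -[RHS]e; congr (_ * (_ + _)); apply: eq_bigr => j _.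
  by rewrite ltn_eqF.
- apply/integral_poly => j; rewrite mulrC coefMX; case: j => [|j]/=.
    exact: mxpoly.integral0.
  rewrite coef_poly; case: ifP => _; last exact: mxpoly.integral0.
  by case: ifP => _; [exact: integral1|exact: integral_id].
Qed.

Lemma integral_idempotent (o : K) : o * o = o -> integralOver f o.
Proof.
move=> oo; apply: (@integral_of_equation o 1 (fun=> -1)).
by rewrite big_ord1 expr1 expr0 mulr1 rmorphN1 mulrDr oo mulrN1 subrr.
Qed.

(** The idempotent [o] selects [- y] where it is [1] and [c] where it is [0]. *)
Lemma integral_select (o y : K) (c : A) : o * o = o -> integralOver f y ->
  integralOver f (o * - y + (1 - o) * f c).
Proof.
move=> /integral_idempotent io iy.
apply: integral_add; apply: integral_mul => //; first exact: integral_opp.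
  by apply: integral_sub => //; exact: integral1.
exact: integral_id.
Qed.

Lemma integral_scaled_prod m (x : nat -> K) (c : A) :
  (forall i, (i < m)%N -> integralOver f (x i)) ->
  integralOver f (f c * \prod_(i < m) x i).
Proof.
move=> ix; apply: integral_mul; first exact: integral_id.
elim/big_ind : _ => [|a b ha hb|i _]; first exact: integral1.
  exact: integral_mul.
exact: ix.
Qed.

End IntegralElements.

Section Integrality.
Context {R : realType}.
Local Notation C := R[i].
Variable omega : R.

(** Polynomials in [z], read as functions of the real parameter [t] through
    [z = cexp (omega t)]. *)
Definition cfun (c : {poly C}) : R -> C := fun t => c.[cexp (omega * t)].

Lemma cfun_is_zmod_morphism : zmod_morphism cfun.
Proof. by move=> p q; apply/funext => t; rewrite /cfun hornerD hornerN. Qed.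

Lemma cfun_is_monoid_morphism : monoid_morphism cfun.
Proof.
split; first by apply/funext => t; rewrite /cfun hornerC.
by move=> p q; apply/funext => t; rewrite /cfun hornerM.
Qed.

HB.instance Definition _ := GRing.isZmodMorphism.Build {poly C} (R -> C) cfun
  cfun_is_zmod_morphism.
HB.instance Definition _ := GRing.isMonoidMorphism.Build {poly C} (R -> C) cfun
  cfun_is_monoid_morphism.

Lemma ev_horner (P : {poly {poly C}}) (u : {poly C}) z : P.[u].[z] = ev P z u.[z].
Proof.
rewrite evE [P.[_]]horner_coef horner_sum; apply: eq_bigr => i _.
by rewrite hornerM horner_exp.
Qed.

Lemma cfun_horner (P : {poly {poly C}}) (x : R -> C) t :
  (map_poly cfun P).[x] t = ev P (cexp (omega * t)) (x t).
Proof.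
have sP : (size (map_poly cfun P) <= size P)%N by rewrite /map_poly size_poly.
rewrite evE (horner_coef_wide _ sP).
rewrite fct_sumE; apply: eq_bigr => i _; rewrite coef_map.
by rewrite mulrfctE exprfctE.
Qed.

(** Products of roots are algebraic functions of [z]. Integrality over [C[z]] is
    tested in the ring of all functions of [t], so that the enumeration of the
    roots may be chosen independently for each [t]; so may the set of the roots
    that enter the product, an idempotent of that ring being integral. *)
Lemma outer_algebraic (Q : {poly {poly C}}) (rs : R -> seq C) : Q != 0 ->
  (forall t, cfun (lead_coef Q) t != 0 ->
     map_poly (horner_eval (cexp (omega * t))) Q =
     cfun (lead_coef Q) t *: \prod_(x <- rs t) ('X - x%:P)) ->
  exists2 Rel : {poly {poly C}}, Rel != 0 & forall t, cfun (lead_coef Q) t != 0 ->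
    ev Rel (cexp (omega * t)) (cfun (lead_coef Q) t * outer_prod (rs t)) = 0.
Proof.
move=> Q0 hrs; set lc := lead_coef Q in hrs *.
pose m := (size Q).-1.
have sQ : size Q = m.+1 by rewrite prednK// size_poly_gt0.
have lcE : lc = Q`_m by [].
pose K : comNzRingType := R -> C.
pose f : {rmorphism {poly C} -> K} := cfun.
have srs t : cfun lc t != 0 -> size (rs t) = m.
  move=> h; have := congr1 (fun p : {poly C} => size p) (hrs t h).
  rewrite size_scale// size_prod_XsubC size_map_poly_id0 ?sQ; last by [].
  by case.
pose y i : K := fun t => if cfun lc t == 0 then 0 else cfun lc t * (rs t)`_i.
pose o i : K := fun t => if nrm (rs t)`_i < 1 then 0 else 1.
have int_y i : (i < m)%N -> integralOver f (y i).
  move=> im; have m0 : (0 < m)%N by apply: leq_trans im.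
  apply: (@integral_of_equation _ _ f _ m (fun j => Q`_j * lc ^+ (m.-1 - j))).
  apply/funext => t; rewrite mulrfctE addrfctE exprfctE fct_sumE.
  rewrite /y; case: eqP => [_|/eqP h]; first by rewrite mul0r.
  apply/eqP; rewrite mulf_eq0; apply/orP; right; apply/eqP.
  set rho := (rs t)`_i.
  have : root (map_poly (horner_eval (cexp (omega * t))) Q) rho.
    by rewrite hrs// rootZ// root_prod_XsubC mem_nth// srs.
  move/rootP; rewrite horner_coef size_map_poly_id0// sQ big_ord_recr/= coef_map/= addrC.
  set S := (X in X = 0) => e0.
  apply: (@eq_trans _ _ (cfun lc t ^+ m.-1 * S)); last by rewrite e0 mulr0.
  rewrite mulrDr mulr_sumr; congr (_ + _).
    by rewrite -lcE /horner_eval -[lc.[_]]/(cfun lc t) mulrA -exprSr prednK// exprMn.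
  apply: eq_bigr => j _; rewrite mulrfctE exprfctE (negbTE h) coef_map/= /horner_eval exprMn.
  have jm' : (j <= m.-1)%N by rewrite -ltnS prednK.
  rewrite /f /= /cfun hornerM horner_exp -{2}(subnK jm') exprD.
  by ring.
pose x i : K := o i * (- y i) + (1 - o i) * f lc.
have int_x i : (i < m)%N -> integralOver f (x i).
  move=> im; apply: integral_select; last exact: int_y.
  by apply/funext => t; rewrite mulrfctE /o; case: ifP => _; rewrite ?mul0r ?mul1r.
pose X : K := f lc * \prod_(i < m) x i.
have [p pm pX] : integralOver f X by exact: integral_scaled_prod.
have XE t : cfun lc t != 0 -> X t = cfun lc t ^+ m * (cfun lc t * outer_prod (rs t)).
  move=> h; rewrite /X mulrfctE -mulrCA; congr (_ * _).
  rewrite fct_prodE /outer_prod (big_nth 0) srs// big_mkord.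
  have -> : cfun lc t ^+ m = \prod_(i < m) cfun lc t by rewrite prodr_const card_ord.
  rewrite [X in _ = _ * X]big_mkcond -big_split/=; apply: eq_bigr => i _.
  rewrite /x !(addrfctE, mulrfctE, opprfctE) /o /y (negbTE h).
  rewrite -[(1 : K) t]/(1 : C) -[f lc t]/(cfun lc t).
  by case: ifP => _ /=; rewrite ?(mul0r, mul1r, subrr, subr0, add0r, addr0, mulr1, mulrN).
exists (p \Po (lc ^+ m *: 'X)).
  rewrite comp_poly2_eq0 ?monic_neq0// size_scale ?size_polyX// expf_neq0//.
  by rewrite lead_coef_eq0.
move=> t h; rewrite /ev horner_comp hornerZ hornerX ev_horner hornerM hornerC horner_exp.
rewrite -[lc.[_]]/(cfun lc t) -XE// -cfun_horner.
by move/rootP: pX => ->.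
Qed.

End Integrality.

(** * Translates and decay along orbits *)

Section Translation.
Context {R : realType}.
Local Notation C := R[i].
Local Notation mu := (@lebesgue_measure R).

Lemma measurable_fun_shift (a : R) :
  measurable_fun setT ((fun x => x - a) : measurableTypeR R -> measurableTypeR R).
Proof. by apply: measurable_funB. Qed.

Lemma lebesgue_measure_shift (a : R) (A : set R) : measurable A ->
  pushforward mu ((fun x => x - a) : measurableTypeR R -> measurableTypeR R) A = mu A.
Proof.
move=> mA; apply/esym.
pose mphi := isMeasurableFun.Build _ _ _ _ _ (measurable_fun_shift a).
pose phi : {mfun _ >-> _} := HB.pack ((fun x => x - a) : measurableTypeR R -> measurableTypeR R) mphi.
apply: (@lebesgue_measure_unique R (pushforward mu phi)) => //= _ [[b c]] _ <-.
rewrite /pushforward /=.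
have -> : (fun x : R => x - a) @^-1` `]b, c] = `]b + a, c + a]%classic.
  by apply/seteqP; split => x /=; rewrite !in_itv/= ltrBrDr lerBlDr.
by rewrite !lebesgue_measure_itv/= !lte_fin ltrD2r -!EFinB; congr (if _ then (_)%:E else _); ring.
Qed.

Lemma ge0_integral_shift (a : R) (D : set R) (g : R -> \bar R) : measurable D ->
  measurable_fun D g -> (forall x, 0 <= g x)%E ->
  (\int[mu]_(x in (fun x => x - a)%R @^-1` D) g (x - a)%R = \int[mu]_(x in D) g x)%E.
Proof.
move=> mD mg g0; have := @ge0_integral_pushforward _ _ _ _ _ _ (measurable_fun_shift a) mu D g mD mg
  (fun x _ => g0 x).
move=> e; apply: (eq_trans (esym e)); apply: eq_measure_integral => [|mf A mA _].
  exact: measurable_fun_shift.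
exact: lebesgue_measure_shift.
Qed.

Lemma null_shift (a : R) (A : set R) : null A -> null [set t | A (t - a)].
Proof.
move=> [B [mB B0 AB]]; exists ((fun x => x - a) @^-1` B); split.
- by rewrite -[X in measurable X]setTI; apply: measurable_fun_shift.
- by rewrite -[LHS]/(pushforward mu _ B) lebesgue_measure_shift.
- by move=> t /AB.
Qed.

Lemma null_shifts (h : R) (A : set R) : null A ->
  null [set t | exists n : int, A (t + n%:~R * h)].
Proof.
move=> nA; apply: nullS (null_bigcup (fun n : int => null_shift (- (n%:~R * h)) nA)).
by move=> t [n An]; exists n => //=; rewrite opprK.
Qed.

(** The translates of an interval of length [`|h|] by multiples of [h] are
    disjoint, so the series of the values along almost every orbit converges. *)
Lemma null_no_decay (g : R -> R) (h : R) : h != 0 -> measurable_fun setT g ->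
  (forall x, 0 <= g x) -> (\int[mu]_x (g x)%:E < +oo)%E ->
  null [set t | ~ forall e : R, 0 < e -> exists K : nat, forall n : nat, (K <= n)%N ->
     g (t + n%:R * h) <= e].
Proof.
move=> h0 mg g0 ig.
have mG : measurable_fun setT (EFin \o g) by exact/measurable_EFinP.
pose J (k : int) : set R := `[k%:~R * `|h|, (k + 1)%:~R * `|h|[%classic.
have nh : 0 < `|h| by rewrite normr_gt0.
set bad := [set t | _].
apply: (@nullS _ (\bigcup_k (J k `&` bad))).
  move=> t bt; exists (Num.floor (t / `|h|)) => //; split=> //.
  by rewrite /J/= in_itv/= -ler_pdivlMr// -ltr_pdivrMr// floor_itv.
apply: null_bigcup => k; rewrite /J.
set I := `[_, _[%classic.
pose F (n : nat) : set R := (fun x => x - n%:R * h) @^-1` I.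
have mF n : measurable (F n).
  by rewrite -[X in measurable X]setTI; apply: measurable_fun_shift => //; exact: measurable_itv.
have tF : trivIset setT F.
  move=> n m _ _ [t [/= ]]; rewrite /F/I/= !in_itv/= => /andP[a1 a2] /andP[b1 b2].
  apply/eqP; rewrite -(eqr_nat R) -subr_eq0 -normr_eq0.
  have : `|n%:R - m%:R| * `|h| < `|h|.
    rewrite -normrM mulrBl ltr_norml intrD mulrDl mul1r in a2 b2 *.
    by apply/andP; split; lra.
  rewrite gtr_pMl// => l1.
  have e : n%:R - m%:R = (n%:Z - m%:Z)%:~R :> R by rewrite intrB -!pmulrn.
  move: l1; rewrite e -intr_norm ltrz1 => l1.
  by rewrite intr_eq0; lia.
have sumI : (\sum_(n <oo) \int[mu]_(x in I) (g (x + n%:R * h))%:E < +oo)%E.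
  apply: le_lt_trans ig.
  under eq_eseriesr.
    move=> n _.
    have -> : (\int[mu]_(x in I) (g (x + n%:R * h))%:E = \int[mu]_(x in F n) (g x)%:E)%E.
      rewrite -(@ge0_integral_shift (n%:R * h) I (fun x => (g (x + n%:R * h))%:E)).
      - by rewrite /F; apply: eq_integral => x _; rewrite subrK.
      - exact: measurable_itv.
      - apply/measurable_EFinP; apply: (measurableT_comp mg).
        by have := measurable_fun_shift (- (n%:R * h)); rewrite opprK; apply: measurable_funS.
      - by move=> x; rewrite lee_fin.
    over.
  rewrite -ge0_integral_bigcup//.
  - apply: ge0_subset_integral => //.
    + by apply: bigcup_measurable => n _; exact: mF.
    + by move=> x _; rewrite lee_fin.
  - exact: measurable_funS mG.
  - by move=> x _; rewrite lee_fin.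
have mI : measurable I by exact: measurable_itv.
have mgn n : measurable_fun I (fun x => (g (x + n%:R * h))%:E).
  apply/measurable_EFinP; apply: (measurableT_comp mg).
  by have := measurable_fun_shift (- (n%:R * h)); rewrite opprK; apply: measurable_funS.
have gn0 n x : I x -> (0 <= (g (x + n%:R * h))%:E)%E by rewrite lee_fin.
rewrite -(integral_nneseries mu mI mgn gn0) in sumI.
have mS : measurable_fun I (fun x => \sum_(n <oo) (g (x + n%:R * h))%:E)%E.
  exact: (@ge0_emeasurable_sum _ _ R I (fun n x => (g (x + n%:R * h))%:E) xpredT
    (fun n x Ix _ => gn0 n x Ix) (fun n _ => mgn n)).
have iS : mu.-integrable I (fun x => \sum_(n <oo) (g (x + n%:R * h))%:E)%E.
  apply/integrableP; split=> //.
  apply: le_lt_trans sumI; rewrite le_eqVlt; apply/orP; left; apply/eqP.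
  apply: eq_integral => x /set_mem Ix.
  by rewrite gee0_abs//; apply: nneseries_ge0 => n _ _; exact: gn0.
have := @integrable_ae _ _ _ mu I mI _ iS; apply: negligibleS => t [It bt] /= /(_ It) fin.
apply: bt => e e0.
have lty : (\sum_(n <oo) (g (t + n%:R * h))%:E < +oo)%E by rewrite ltey_eq fin.
have := nnseries_is_cvg (fun n => g0 _) lty.
move=> /cvg_series_cvg_0 /cvgrPdist_le /(_ e e0) [K _ hK]; exists K => n Kn.
have := hK n Kn; rewrite /= sub0r normrN; apply: le_trans; exact: ler_norm.
Qed.

End Translation.

(** * Lines on the unit torus *)

Section TorusZeros.
Context {R : realType}.
Local Notation C := R[i].

Lemma sqr_nrm_conj (z : C) : ((nrm z ^+ 2)%:C)%C = z * (z^*)%C.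
Proof.
rewrite sqr_nrm; case: z => a b; apply/eqP; rewrite eq_complex /=.
by apply/andP; split; apply/eqP; ring.
Qed.

(** On the unit circle the conjugate of [X] is its inverse, so that the condition
    [|b0 + b1 X| ^ 2 = r ^ 2] is a quadratic equation. *)
Lemma circle_roots (b0 b1 : C) (r : R) : b0 != 0 -> b1 != 0 ->
  exists s : seq C, forall X, nrm X = 1 -> nrm (b0 + b1 * X) = r -> X \in s.
Proof.
move=> b00 b10.
pose p : {poly C} := (b0 * (b1^*)%C)%:P +
  (b0 * (b0^*)%C + b1 * (b1^*)%C - ((r ^+ 2)%:C)%C)%:P * 'X + ((b0^*)%C * b1)%:P * 'X^2.
have p0 : p != 0.
  apply/eqP => /(congr1 (fun q : {poly C} => q`_2)).
  rewrite !coefD !coefCM coefC coefX coefXn coef0 /= !mulr0 !add0r mulr1 => /eqP.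
  by rewrite mulf_eq0 conjc_eq0 (negbTE b00) (negbTE b10).
have [s sE] := closed_field_poly_normal p; exists s => X X1 hr.
have : root p X.
  apply/rootP; have XX : X * (X^*)%C = 1 by rewrite -sqr_nrm_conj X1 expr1n.
  have e : ((r ^+ 2)%:C)%C = (b0 + b1 * X) * ((b0^*)%C + (b1^*)%C * (X^*)%C).
    by rewrite -hr sqr_nrm_conj; congr (_ * _); rewrite rmorphD rmorphM.
  rewrite /p !(hornerD, hornerM, hornerC, hornerX, hornerXn) e.
  move: (X^*)%C XX => X' XX.
  transitivity (b0 * (b1^*)%C * (1 - X * X') + b1 * (b1^*)%C * X * (1 - X * X')).
    by ring.
  by rewrite XX subrr !mulr0 addr0.
by rewrite sE rootZ ?lead_coef_eq0// root_prod_XsubC.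
Qed.

(** On the unit torus a line [b0 + b1 X + b2 Y = 0] with nonzero coefficients has
    finitely many points, as [|b0 + b1 X| = |b2|] is a quadratic equation. *)
Lemma null_torus_zeros (omega : R) (b0 b1 b2 : C) (X1 Y1 X2 Y2 : int) :
  omega != 0 -> b0 != 0 -> b1 != 0 -> b2 != 0 -> X1 * Y2 - X2 * Y1 != 0 ->
  null [set t | exists2 w, nrm w = 1 &
    b0 + b1 * (cexp (- (Y1%:~R * (omega * t))) * w ^ X1) +
         b2 * (cexp (- (Y2%:~R * (omega * t))) * w ^ X2) = 0].
Proof.
move=> om0 b00 b10 b20 D0.
have [sU hU] := circle_roots (nrm b2) b00 b10.
have [sV hV] := circle_roots (nrm b1) b00 b20.
pose D : R := (X1 * Y2 - X2 * Y1)%:~R * omega.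
have D0' : D != 0 by rewrite mulf_neq0// intr_eq0.
pose F (U V : C) := [set t | exists2 w, nrm w = 1 &
  cexp (- (Y1%:~R * (omega * t))) * w ^ X1 = U /\ cexp (- (Y2%:~R * (omega * t))) * w ^ X2 = V].
have nF U V : null (F U V).
  have pol0 : ('X - (U ^ X2 * V ^ (- X1))%:P : {poly C}) != 0 by rewrite polyXsubC_eq0.
  apply: nullS (null_cexp_roots D0' pol0) => t [w w1 [<- <-]] /=.
  have w0 : w != 0 by rewrite -nrm_gt0 w1.
  rewrite hornerXsubC; apply/eqP; rewrite subr_eq0; apply/eqP.
  rewrite !expfzMl -!cexpMz !exprz_exp.
  have -> : cexp (D * t) = cexp (X2%:~R * - (Y1%:~R * (omega * t))) *
      cexp ((- X1)%:~R * - (Y2%:~R * (omega * t))).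
    by rewrite -cexpD /D; congr cexp; rewrite intrB !intrM mulrNz; ring.
  rewrite mulrACA -expfzDr//; have -> : X1 * X2 + X2 * - X1 = 0 by ring.
  by rewrite expr0z mulr1.
apply: nullS (null_seq sU (fun U => null_seq sV (fun V => nF U V))) => t [w w1 e].
have nU : nrm (cexp (- (Y1%:~R * (omega * t))) * w ^ X1) = 1.
  rewrite nrmM nrm_cexp mul1r; case: X1 {D D0 D0' nF F e} => n; rewrite ?NegzE -?exprnN ?nrmV.
    by rewrite -exprnP nrmX w1 expr1n.
  by rewrite nrmX w1 expr1n invr1.
have nV : nrm (cexp (- (Y2%:~R * (omega * t))) * w ^ X2) = 1.
  rewrite nrmM nrm_cexp mul1r; case: X2 {D D0 D0' nF F e} => n; rewrite ?NegzE -?exprnN ?nrmV.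
    by rewrite -exprnP nrmX w1 expr1n.
  by rewrite nrmX w1 expr1n invr1.
set U := _ * w ^ X1 in e nU; set V := _ * w ^ X2 in e nV.
exists U.
  apply: hU => //; have -> : b0 + b1 * U = - (b2 * V) by apply/eqP; rewrite -addr_eq0 e.
  by rewrite nrmN nrmM nV mulr1.
exists V; last by exists w.
apply: hV => //; have -> : b0 + b2 * V = - (b1 * U) by apply/eqP; rewrite -addr_eq0 addrAC e.
by rewrite nrmN nrmM nU mulr1.
Qed.

End TorusZeros.

(** * Four points in an adapted frame *)

Section Vertical.
Context {R : realType}.
Local Notation C := R[i].

Lemma irrational_angle_affine (theta : R) (m n : int) : m != 0 ->
  irrational_angle theta -> irrational_angle (m%:~R * theta + n%:~R).
Proof.
move=> m0 irr k k0.
rewrite mulrDr cexpD.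
have -> : cexp (k%:R * n%:~R) = 1 :> C by rewrite cexpMn cexp_int expr1n.
rewrite mulr1 mulrA; apply/negP => /eqP h.
have k' : (0 < k * `|m|)%N by rewrite muln_gt0 k0 absz_gt0.
have := irr _ k'; rewrite natrM; case: (intP m) m0 h k' => // i _ h _.
  by rewrite -pmulrn in h; rewrite h eqxx.
rewrite mulrNz -pmulrn mulrN mulNr cexpN in h.
by rewrite abszN -(invr_eq1 (cexp _)) h eqxx.
Qed.

Variables (h omega theta : R) (d : nat) (p sigma : int).
Variables (a0 a1 a2 : C) (X1 Y1 X2 Y2 : int).
Hypotheses (h0 : h != 0) (d0 : (0 < d)%N) (sigma0 : sigma != 0).
(* The exponentials [cexp (Y omega t)] are thus constant along the orbits of the
   translation by [d h]. *)
Hypothesis lattice : omega * (d%:R * h) = sigma%:~R.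
Hypothesis irr : irrational_angle theta.
Hypotheses (a00 : a0 != 0) (a10 : a1 != 0) (a20 : a2 != 0).
Hypothesis indep : X1 * Y2 - X2 * Y1 != 0.

Let e := (`|X1| + `|X2|)%N.
Let E := (`|Y1| + `|Y2|)%N.
(* The commutation factor of the shifts by [(p h, theta omega)] and by
   [(X d h, Y omega)]. *)
Let kappa (X Y : int) : C := cexp (Y%:~R * omega * (p%:~R * h) - theta * omega * X%:~R * (d%:R * h)).

(** After [j] iterations of the relation, the operator on an orbit of the
    translation by [d h], as a polynomial in the shift [w] whose coefficients
    are polynomials in [z = cexp (omega t)]; the factor [z ^+ E * w ^+ e]
    clears the negative powers. *)
Definition iterate_poly (j : nat) : {poly {poly C}} :=
  (a0 *: 'X^E)%:P * 'X^e +
  (a1 * kappa X1 Y1 ^+ j *: 'X^(absz (E%:Z - Y1)))%:P * 'X^(absz (e%:Z + X1)) +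
  (a2 * kappa X2 Y2 ^+ j *: 'X^(absz (E%:Z - Y2)))%:P * 'X^(absz (e%:Z + X2)).

Variable f : R -> C.

(** The [J]-th power of the time-frequency shift by [(p h, theta omega)]. *)
Definition iterate (J : nat) (t : R) : C :=
  cexp (- (J%:R * theta * omega * t) + theta * omega * (p%:~R * h) * (J%:R * (J%:R - 1) / 2)) *
  f (t - J%:R * (p%:~R * h)).

(** The points are [(p h, theta omega)], the origin, [(X1 d h, Y1 omega)] and
    [(X2 d h, Y2 omega)]; the coefficient of the first one is normalised. *)
Definition four_relation (t : R) :=
  cexp (- (theta * omega * t)) * f (t - p%:~R * h) =
  a0 * f t + a1 * (cexp (- (Y1%:~R * omega * t)) * f (t - X1%:~R * (d%:R * h)))
  + a2 * (cexp (- (Y2%:~R * omega * t)) * f (t - X2%:~R * (d%:R * h))).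

(** Commuting the [J]-th power of the shift past the shifts by the lattice points
    produces the powers of [kappa]. *)
Lemma iterateS J t : four_relation (t - J%:R * (p%:~R * h)) ->
  iterate J.+1 t = a0 * iterate J t +
  a1 * kappa X1 Y1 ^+ J * cexp (- (Y1%:~R * omega * t)) * iterate J (t - X1%:~R * (d%:R * h)) +
  a2 * kappa X2 Y2 ^+ J * cexp (- (Y2%:~R * omega * t)) * iterate J (t - X2%:~R * (d%:R * h)).
Proof.
rewrite /four_relation => rel.
set A := cexp (- (J%:R * theta * omega * t) + theta * omega * (p%:~R * h) * (J%:R * (J%:R - 1) / 2)).
transitivity (A * (cexp (- (theta * omega * (t - J%:R * (p%:~R * h)))) *
   f (t - J%:R * (p%:~R * h) - p%:~R * h))).
  rewrite mulrA -cexpD /iterate; congr (cexp _ * f _); rewrite -natr1; last by ring.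
  by field.
have term X Y : A * (cexp (- (Y%:~R * omega * (t - J%:R * (p%:~R * h)))) *
      f (t - J%:R * (p%:~R * h) - X%:~R * (d%:R * h))) =
    kappa X Y ^+ J * cexp (- (Y%:~R * omega * t)) * iterate J (t - X%:~R * (d%:R * h)).
  rewrite mulrA -cexpD /iterate -cexpMn [RHS]mulrA -!cexpD; congr (cexp _ * f _); last by ring.
  by field.
rewrite rel !(mulrDr A); congr (_ + _ + _); first by rewrite mulrCA.
  by rewrite mulrCA term !mulrA.
by rewrite mulrCA term !mulrA.
Qed.

Definition at_z (t : R) : {rmorphism {poly {poly C}} -> {poly C}} :=
  map_poly (horner_eval (cexp (omega * t))).

Lemma at_zC t (c : {poly C}) : at_z t c%:P = (c.[cexp (omega * t)])%:P.
Proof. by rewrite /at_z /= map_polyC. Qed.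

Lemma at_zX t : at_z t 'X = 'X.
Proof. by rewrite /at_z /= map_polyX. Qed.

Lemma at_iterate_poly t j : at_z t (iterate_poly j) =
  cexp (omega * t) ^+ E *: (a0 *: 'X^e +
  (a1 * kappa X1 Y1 ^+ j * cexp (- (Y1%:~R * omega * t))) *: 'X^(absz (e%:Z + X1)) +
  (a2 * kappa X2 Y2 ^+ j * cexp (- (Y2%:~R * omega * t))) *: 'X^(absz (e%:Z + X2))).
Proof.
have z0 := cexp_neq0 (omega * t).
have zY (Y : int) : (Y <= E%:Z) -> cexp (omega * t) ^+ absz (E%:Z - Y) =
    cexp (omega * t) ^+ E * cexp (- (Y%:~R * omega * t)).
  move=> YE; rewrite !exprnP gez0_abs ?subr_ge0// -!cexpMz -cexpD; congr cexp.
  by rewrite intrB; ring.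
rewrite /iterate_poly !rmorphD !rmorphM !rmorphXn !at_zX !at_zC !hornerZ !hornerXn.
rewrite !zY; try by rewrite /E; lia.
rewrite !mul_polyC !scalerDr !scalerA; congr (_ *: _ + _ *: _ + _ *: _); ring.
Qed.

(** The absence of roots on the unit circle is what [outer_value_limit] requires. *)
Lemma iterate_poly_unit_roots :
  null [set t | exists j, exists2 w, nrm w = 1 & root (at_z t (iterate_poly j)) w].
Proof.
have nk X Y j : kappa X Y ^+ j != 0 by rewrite expf_neq0// cexp_neq0.
have om0 : omega != 0.
  by apply/eqP => om0; move: lattice; rewrite om0 mul0r => /esym/eqP; rewrite intr_eq0 (negbTE sigma0).
have nj j := null_torus_zeros om0 a00 (mulf_neq0 a10 (nk X1 Y1 j)) (mulf_neq0 a20 (nk X2 Y2 j)) indep.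
apply: nullS (null_bigcup nj) => t [j [w w1]] /=; rewrite at_iterate_poly.
have w0 : w != 0 by rewrite -nrm_gt0 w1.
rewrite rootZ ?expf_neq0 ?cexp_neq0// => /rootP; rewrite !(hornerD, hornerZ, hornerXn) => rt.
exists j => //; exists w => //.
apply: (mulfI (expf_neq0 e w0)); rewrite mulr0 -[RHS]rt.
have wX (X : int) : (0 <= e%:Z + X) -> w ^+ absz (e%:Z + X) = w ^+ e * w ^ X.
  by move=> ?; rewrite exprnP gez0_abs// expfzDr.
rewrite !wX; try by rewrite /e; lia.
by rewrite !mulrA; ring.
Qed.

Definition iterated_poly (J : nat) : {poly {poly C}} := \prod_(j < J) iterate_poly j.

Lemma act_iterated J (t : R) (n : int) :
  (forall m : int, four_relation (t + m%:~R * h)) ->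
  act 1 (at_z t (iterated_poly J)) (fun m => f (t + m%:~R * (d%:R * h))) n =
  cexp (omega * t) ^+ (E * J) * iterate J (t + (n - (J * e)%N%:Z)%:~R * (d%:R * h)).
Proof.
move=> rel; elim: J n => [|J IH] n.
  rewrite /iterated_poly big_ord0 rmorph1 act1 muln0 expr0 mul1r /iterate mul0n subr0.
  by rewrite !(mulr0n, mul0r, mulr0, oppr0, add0r, addr0) cexp0 mul1r.
rewrite /iterated_poly big_ord_recr/= rmorphM mulrC actM (eq_act _ _ _ IH).
have actXn (c : C) k s m : act 1 (c *: 'X^k) s m = c * s (m - k%:Z).
  rewrite actZ; congr (_ * _); elim: k m => [|k IHk] m; first by rewrite act1 subr0.
  by rewrite exprSr actMX IHk; congr s; lia.
rewrite at_iterate_poly actZ !actD !actXn.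
set t' := t + (n - (J.+1 * e)%N%:Z)%:~R * (d%:R * h).
have rel' : four_relation (t' - J%:R * (p%:~R * h)).
  have -> : t' - J%:R * (p%:~R * h) =
      t + ((n - (J.+1 * e)%N%:Z) * d%:Z - J%:Z * p)%:~R * h.
    by rewrite /t' [in RHS]intrB !intrM -!pmulrn; ring.
  exact: rel.
rewrite (iterateS rel') [(E * J.+1)%N]mulnS exprD -[RHS]mulrA; congr (_ * _).
have eX (X : int) : 0 <= e%:Z + X -> t + (n - (absz (e%:Z + X))%:Z - (J * e)%N%:Z)%:~R * (d%:R * h) =
   t' - X%:~R * (d%:R * h).
  move=> eX0.
  have -> : n - (absz (e%:Z + X))%:Z - (J * e)%N%:Z = n - (J.+1 * e)%N%:Z - X.
    by rewrite gez0_abs// mulSn; lia.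
  by rewrite /t' [in LHS]intrB; ring.
rewrite !eX; try by rewrite /e; lia.
have -> : t + (n - e%:Z - (J * e)%N%:Z)%:~R * (d%:R * h) = t'.
  by rewrite /t' mulSn; congr (_ + _%:~R * _); lia.
have per (Y : int) : cexp (- (Y%:~R * omega * t')) = cexp (- (Y%:~R * omega * t)) :> C.
  rewrite /t'; move: (n - (J.+1 * e)%N%:Z) => m.
  have -> : - (Y%:~R * omega * (t + m%:~R * (d%:R * h))) = - (Y%:~R * omega * t) + (- (Y * m * sigma))%:~R.
    by rewrite mulrNz !intrM -lattice; ring.
  by rewrite cexpD cexp_int mulr1.
by rewrite !per !mulrDr !mulrA; congr (_ + _ + _); ring.
Qed.

Lemma not_null_setT : ~ null (@setT R).
Proof.
move=> /(nullS (subsetT `[0, 1]%classic)); rewrite /null => n01.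
have m01 : measurable (`[0, 1]%classic : set R) by exact: measurable_itv.
have : lebesgue_measure (`[0, 1]%classic : set R) = 0%E by exact: measure_negligible.
rewrite lebesgue_measure_itv /= lte_fin ltr01 oppr0 adde0 => /eqP.
by rewrite eqe oner_eq0.
Qed.

Lemma iterated_poly_neq0 J : iterated_poly J != 0.
Proof.
apply/eqP => /eqP/prodf_eq0[j _ /eqP j0].
apply: not_null_setT; apply: nullS iterate_poly_unit_roots => t _ /=.
by exists j; exists 1; rewrite ?nrm1// j0 rmorph0 root0.
Qed.

(** After [d] iterations, the shift by [(p h, theta omega)] moves the orbits of the
    translation by [d h] into themselves, by [p] steps. The relation along an orbit
    then has the form required by [outer_value_limit], and [null_algebraic] shows
    that the set of the [t] with [f t != 0] that start good orbits is null. *)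
Theorem vertical_four : null [set t | ~ four_relation t] ->
  null [set t | ~ forall eps : R, 0 < eps -> exists k : nat, forall n : int, (k <= `|n|)%N ->
    nrm (f (t + n%:~R * (d%:R * h))) <= eps] ->
  null [set t | f t != 0].
Proof.
move=> nrel ndecay.
have om0 : omega != 0.
  by apply/eqP => om0; move: lattice; rewrite om0 mul0r => /esym/eqP; rewrite intr_eq0 (negbTE sigma0).
(* Along the orbit [t + n d h] the phase [cexp (- d theta omega t)] rotates by
   [theta1]; at the base point it combines with the factor [z ^ (E d)] of
   [act_iterated] into [cexp (theta2 omega t)], up to the constant [C1]. *)
pose theta1 : R := (- (d%:Z * sigma))%:~R * theta + 0%:~R.
have irr1 : irrational_angle theta1.
  apply: irrational_angle_affine irr; rewrite oppr_eq0 mulf_neq0//.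
  by rewrite -lt0n.
pose theta2 : R := (- d%:Z)%:~R * theta + (E * d)%N%:Z%:~R.
have irr2 : irrational_angle theta2.
  by apply: irrational_angle_affine irr; lia.
pose C1 : C := cexp (theta * omega * (p%:~R * h) * (d%:R * (d%:R - 1) / 2) + theta1 * p%:~R).
have C10 : C1 != 0 := cexp_neq0 _.
pose Q : {poly {poly C}} := (C1^-1)%:P%:P * iterated_poly d.
have Q0 : Q != 0 by rewrite mulf_neq0 ?iterated_poly_neq0// !polyC_eq0 invr_eq0.
pose rs t := sval (closed_field_poly_normal (at_z t Q)).
have rsE t : cfun omega (lead_coef Q) t != 0 ->
    at_z t Q = cfun omega (lead_coef Q) t *: \prod_(x <- rs t) ('X - x%:P).
  move=> lt0; rewrite /rs; case: closed_field_poly_normal => /= r {1}->.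
  by rewrite lead_coef_map_eq.
have [Rel Rel0 hRel] := outer_algebraic Q0 rsE.
have lc0 : lead_coef Q != 0 by rewrite lead_coef_eq0.
pose bad := [set t | exists n : int, ~ four_relation (t + n%:~R * h)] `|`
  [set t | ~ forall eps : R, 0 < eps -> exists k : nat, forall n : int, (k <= `|n|)%N ->
    nrm (f (t + n%:~R * (d%:R * h))) <= eps] `|`
  ([set t | exists j, exists2 w, nrm w = 1 & root (at_z t (iterate_poly j)) w] `|`
   [set t | (lead_coef Q).[cexp (omega * t)] = 0]).
have nbad : null bad.
  apply: nullU; apply: nullU => //; first exact: (null_shifts h nrel).
    exact: iterate_poly_unit_roots.
  exact: null_cexp_roots.
apply: (@nullS _ ([set t | f t != 0 /\ ~ bad t] `|` bad)).
  by move=> t ft; have [bt|bt] := pselect (bad t); [right|left].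
apply: nullU => //.
apply: (@null_algebraic _ omega theta2 [set q | approximant theta1 q] _
  (fun t => cfun omega (lead_coef Q) t * outer_prod (rs t)) Rel) => //.
- by move=> n; apply: approximant_infinite.
- by move=> t [ft bt]; apply: hRel; apply/eqP => l0; apply: bt; right; right.
move=> t eps [ft bt] eps0.
have rel m : four_relation (t + m%:~R * h).
  by apply: contrapT => nr; apply: bt; left; left; exists m.
have decay : forall eps : R, 0 < eps -> exists k : nat, forall n : int, (k <= `|n|)%N ->
    nrm (f (t + n%:~R * (d%:R * h))) <= eps.
  by apply: contrapT => nr; apply: bt; left; right.
have lt0 : cfun omega (lead_coef Q) t != 0.
  by apply/eqP => l0; apply: bt; right; right.
have nz1 : nrm (cexp (theta2 * omega * t)) = 1 := nrm_cexp _.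
have [] := @outer_value_limit _ theta1 irr1 (cfun omega (lead_coef Q) t) (rs t)
  (fun n => f (t + n%:~R * (d%:R * h))) (cexp (theta2 * omega * t)) ((d * e)%N%:Z + p)
  _ nz1 _ decay _ eps eps0.
- apply/allP => x xr; apply/eqP => x1; apply: bt; right; left.
  have : root (at_z t Q) x by rewrite rsE// rootZ// root_prod_XsubC.
  rewrite /Q rmorphM at_zC hornerC mul_polyC rootZ ?invr_eq0//.
  rewrite rmorph_prod => /rootP; rewrite horner_prod => /eqP/prodf_eq0[j _ rj].
  by exists j; exists x.
- by rewrite mul0r addr0.
- move=> n; rewrite -rsE// /Q rmorphM at_zC hornerC mul_polyC actZ act_iterated//.
  rewrite /iterate -cexpMn /C1 -cexpN !mulrA; congr (_ * f _); last first.
    by rewrite !(intrB, intrD); ring.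
  rewrite -!cexpD; set m := n - (d * e)%N%:Z.
  have -> : n - ((d * e)%N%:Z + p) = m - p by rewrite opprD addrA.
  congr cexp.
  have lat : d%:R * theta * omega * (t + m%:~R * d%:R * h) =
      d%:R * theta * omega * t + d%:R * theta * m%:~R * sigma%:~R.
    by rewrite -lattice; ring.
  rewrite /theta1 /theta2 lat !(mulrNz, intrM, intrB) -!pmulrn natrM.
  by field.
move=> K hK; exists K => q Kq aq.
have z0 := cexp_neq0 (theta2 * omega * t).
have -> : forall x z : C, z != 0 -> (x / z) ^+ q - 1 = (x ^+ q - z ^+ q) * (z ^+ q)^-1.
  by move=> x z zn; rewrite mulrBl divff ?expf_neq0// expr_div_n.
  by rewrite nrmM nrmV nrmX nz1 expr1n invr1 mulr1; apply: hK.
exact: z0.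
Qed.

End Vertical.

(** * Three points, two of them on a vertical line *)

Section ThreePoints.
Context {R : realType}.
Local Notation C := R[i].
Local Notation mu := (@lebesgue_measure R).

(** Near a density point, a set and its translate by a small amount cannot both
    fill three quarters of an interval without meeting. *)
Lemma null_missed_shift (A : set R) : measurable A ->
  (forall eta : R, 0 < eta -> exists2 d, `|d| < eta & forall t, A t -> ~ A (t + d)) ->
  null A.
Proof.
move=> mA hA.
have := lebesgue_density mA; apply: negligibleS => x Ax /= dx.
move: dx; rewrite indicE mem_set// => dx.
have lt1 : ((3 / 4)%R%:E < 1%:E :> \bar R)%E by rewrite lte_fin; lra.
have := dx _ (open_nbhs_nbhs (conj (@open_ereal_gt_ereal R (3 / 4)%R%:E) lt1)).
move=> [d /= d0 hd].
pose r := d / 2; have r0 : 0 < r by rewrite divr_gt0.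
have rd : ball_ Num.norm 0 d r by rewrite /ball_/= sub0r normrN gtr0_norm// /r; lra.
have := hd _ rd r0; rewrite lebesgue_measure_ball ?ltW// inver gt_eqF ?mulrn_wgt0// => dens.
have [s sr miss] := hA (r / 2) (divr_gt0 r0 (ltr0n _ 2)).
pose I := A `&` ball x r.
have mI : measurable I by apply: measurableI => //; exact: measurable_realfun.measurable_ball.
pose J := (fun y : R => y - s) @^-1` I.
have mJ : measurable J.
  by rewrite -[X in measurable X]setTI; apply: measurable_fun_shift.
have muJ : mu J = mu I by exact: lebesgue_measure_shift.
have dIJ : I `&` J = set0.
  rewrite -subset0 => y [[Ay _] [Ays _]].
  by apply: (miss _ Ays); rewrite subrK.
(* Two disjoint sets of measure more than [3 r / 2] in an interval of length [3 r]. *)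
have : (mu (I `|` J) <= mu `](x - (3 / 2) * r)%R, (x + (3 / 2) * r)%R])%E.
  apply: le_measure; rewrite ?inE//; first exact: measurableU.
  move: sr; rewrite ltr_norml => /andP[s1 s2] y [[_]|[_]]; rewrite /ball/= in_itv/= ltr_norml => /andP[y1 y2].
    by apply/andP; split; lra.
  by apply/andP; split; lra.
have -> : (mu (I `|` J) = mu I + mu I)%E by rewrite -[X in (_ + X)%E]muJ; exact: measureU.
rewrite lebesgue_measure_itv/= lte_fin ifT; last by lra.
rewrite -EFinB => le3.
have fI : mu I \is a fin_num.
  rewrite ge0_fin_numE//; apply: le_lt_trans (ltry _).
  by apply: le_trans le3; exact: leeDl.
move: le3 dens; rewrite -/I -(fineK fI) -EFinD lee_fin -EFinM lte_fin => le3.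
by rewrite ltr_pdivlMr ?mulrn_wgt0// mulr2n; lra.
Qed.

(** Multiplying a Dirichlet denominator by [N] makes it late, and the error
    stays small when the bound of the denominators is large compared with [N]. *)
Lemma late_recurrence (theta eta : R) (N : nat) : 0 < eta ->
  exists2 n : nat, (N <= n)%N & exists p : int, `|n%:R * theta - p%:~R| < eta.
Proof.
move=> eta0.
pose m := (Num.truncn (N%:R / eta)).+1.
have hm : N%:R < m%:R * eta by rewrite -ltr_pdivrMr// truncnS_gt.
have [q [p [q0 _ qm]]] := @dirichlet R theta m isT.
exists (N * q)%N; first by rewrite leq_pmulr.
exists (N%:Z * p); rewrite natrM intrM -pmulrn -mulrA -mulrBr normrM normr_nat.
have m0 : 0 < m%:R :> R by rewrite ltr0n.
rewrite -(ltr_pM2l m0) mulrCA; apply: le_lt_trans hm.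
by rewrite -[leRHS]mulr1; apply: ler_wpM2l.
Qed.

Lemma measurable_nrm_cexp (a b : C) (kappa : R) :
  measurable_fun setT (fun t => nrm (a + b * cexp (kappa * t))).
Proof.
apply: continuous_measurable_fun => t; apply/cvgrPdist_le => e e0.
have K0 : 0 < nrm b * 8 * `|kappa| + 1 by rewrite ltr_wpDl// !mulr_ge0 ?nrm_ge0.
near=> u.
apply: le_trans (_ : nrm b * (8 * `|kappa * t - kappa * u|) <= _).
  have rev (x y : C) : `|nrm x - nrm y| <= nrm (x - y).
    by rewrite ler_norml nrm_rev andbT lerNl opprB nrmB nrm_rev.
  apply: le_trans (rev _ _) _.
  rewrite opprD addrACA subrr add0r -mulrBr nrmM ler_wpM2l ?nrm_ge0//.
  exact: nrm_cexpB.
rewrite -mulrBr normrM !mulrA.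
apply: le_trans (_ : (nrm b * 8 * `|kappa| + 1) * `|t - u| <= _).
  by rewrite ler_wpM2r// lerDl.
rewrite -ler_pdivlMl//.
near: u; apply/nbhs_ballP; exists ((nrm b * 8 * `|kappa| + 1)^-1 * e).
  by rewrite /= mulr_gt0// invr_gt0.
by move=> u /ltW.
Unshelve. all: by end_near.
Qed.

(** The multiplier [h] is periodic, so translating by multiples of [s] is a
    rotation of its argument. Along an orbit on which [f] is not zero, the decay
    of [f] in both directions makes the products of [h] small to one side and
    large to the other, while recurrence of the rotation makes the two products
    agree up to an arbitrarily small translation. *)
Lemma null_two_sided_decay (f : R -> C) (a b : C) (kappa s : R) : kappa != 0 ->
  null [set t | nrm (f (t - s)) != nrm (a + b * cexp (kappa * t)) * nrm (f t)] ->
  null [set t | ~ forall eps : R, 0 < eps -> exists k : nat, forall n : int, (k <= `|n|)%N ->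
    nrm (f (t + n%:~R * s)) <= eps] ->
  null [set t | f t != 0].
Proof.
move=> k0 nrel ndecay.
pose h t := nrm (a + b * cexp (kappa * t)).
pose A (n : nat) t := \prod_(j < n) h (t - j%:R * s).
have mA n : measurable_fun setT (A n).
  apply: measurable_prod => j _.
  have := measurable_nrm_cexp a (b * cexp (- (kappa * (j%:R * s)))) kappa.
  apply: eq_measurable_fun => t _; rewrite /h -mulrA -cexpD; congr (nrm (_ + _ * cexp _)).
  by ring.
pose CN (N : nat) := \bigcap_(n in [set n | (N <= n)%N])
  ([set t | A n t <= 1 / 2] `&` [set t | 2 <= A n (t + n%:R * s)]).
have mCN N : measurable (CN N).
  apply: bigcap_measurable; first by exists N => /=.
  move=> n _; apply: measurableI.
    have -> : [set t | A n t <= 1 / 2] = A n @^-1` `]-oo, (1 / 2)].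
      by apply/seteqP; split => t /=; rewrite in_itv.
    by rewrite -[X in measurable X]setTI; apply: mA.
  have -> : [set t | 2 <= A n (t + n%:R * s)] =
      (fun t => t - - (n%:R * s)) @^-1` (A n @^-1` `[2, +oo[).
    by apply/seteqP; split => t /=; rewrite in_itv andbT opprK.
  rewrite -[X in measurable X]setTI; apply: measurable_fun_shift => //.
  by rewrite -[X in measurable X]setTI; apply: mA.
have nCN N : null (CN N).
  apply: null_missed_shift => // eta eta0.
  have ek : 0 < eta * `|kappa| by rewrite mulr_gt0// normr_gt0.
  have [n Nn [p hp]] := late_recurrence (s * kappa) N ek.
  (* The multiplier has period [1 / kappa]. *)
  exists (n%:R * s - p%:~R / kappa).
    have -> : n%:R * s - p%:~R / kappa = (n%:R * (s * kappa) - p%:~R) / kappa by field.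
    by rewrite normrM normfV ltr_pdivrMr ?normr_gt0.
  move=> t Ct /(_ n Nn) [/= + _]; have [_ /=] := Ct n Nn.
  have -> : A n (t + (n%:R * s - p%:~R / kappa)) = A n (t + n%:R * s).
    apply: eq_bigr => j _; rewrite /h.
    have -> : kappa * (t + (n%:R * s - p%:~R / kappa) - j%:R * s) =
      kappa * (t + n%:R * s - j%:R * s) + (- p)%:~R by rewrite mulrNz; field.
    by rewrite cexpD cexp_int mulr1.
  by move=> h1 h2; lra.
pose bad := [set t | exists n : int, nrm (f (t + n%:~R * s - s)) != h (t + n%:~R * s) * nrm (f (t + n%:~R * s))].
have nbad : null bad by exact: (null_shifts s nrel).
apply: nullS (nullU (nullU nbad ndecay) (null_bigcup nCN)) => t /= ft.
have [bt|bt] := pselect (bad t); first by left; left.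
have [dt|dt] := pselect (forall eps : R, 0 < eps -> exists k : nat, forall n : int,
  (k <= `|n|)%N -> nrm (f (t + n%:~R * s)) <= eps); last by left; right.
have rel (n : int) : nrm (f (t + n%:~R * s - s)) = h (t + n%:~R * s) * nrm (f (t + n%:~R * s)).
  by apply/eqP; apply: contrapT => nr; apply: bt; exists n; apply/negP.
have relA (n : nat) (m : int) : nrm (f (t + (m - n%:Z)%:~R * s)) = A n (t + m%:~R * s) * nrm (f (t + m%:~R * s)).
  elim: n => [|n IH]; first by rewrite subr0 /A big_ord0 mul1r.
  have -> : t + (m - n.+1%:Z)%:~R * s = t + (m - n%:Z)%:~R * s - s.
    by rewrite !intrB -!pmulrn -natr1; ring.
  rewrite rel IH /A big_ord_recr/= mulrA; congr (_ * _); rewrite mulrC; congr (_ * h _).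
  by rewrite intrB -!pmulrn; ring.
have f0 : 0 < nrm (f t) by rewrite nrm_gt0.
have [K hK] := dt (nrm (f t) / 2) (divr_gt0 f0 (ltr0n _ 2)).
right; exists K => // n /= Kn; split=> /=.
  have := relA n 0; rewrite mul0r addr0 sub0r => e.
  have := hK (- n%:Z); rewrite abszN => /(_ Kn); rewrite e mulrC -[_ / 2]mulr1 -mulrA ler_pM2l//.
  by lra.
have := relA n n; rewrite subrr mul0r addr0 -pmulrn => e.
have := hK n%:Z Kn; rewrite -pmulrn => l2.
have A0 : 0 <= A n (t + n%:R * s) by apply: prodr_ge0 => j _; exact: nrm_ge0.
have := ler_wpM2l A0 l2; rewrite -e => l3.
by rewrite -(ler_pM2r f0); lra.
Qed.

Lemma null_cexp_affine (omega : R) (a b : C) : omega != 0 -> (a != 0) || (b != 0) ->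
  null [set t | a + b * cexp (omega * t) = 0].
Proof.
move=> om0 ab.
have c0 : (a%:P + b *: 'X : {poly C}) != 0.
  apply: contraTneq ab => c0; rewrite negb_or !negbK; apply/andP; split; apply/eqP.
    by have := congr1 (fun p : {poly C} => p`_0) c0; rewrite coefD coefZ coefC coefX coef0 /= mulr0 addr0.
  by have := congr1 (fun p : {poly C} => p`_1) c0; rewrite coefD coefZ coefC coefX coef0 /= mulr1 add0r.
apply: nullS (null_cexp_roots om0 c0) => t /= <-.
by rewrite !(hornerD, hornerZ, hornerC, hornerX).
Qed.

Lemma null_cexp_three (x y : R) (c0 c1 c2 : C) : x != 0 -> y != 0 -> x != y ->
  [|| c0 != 0, c1 != 0 | c2 != 0] ->
  null [set t | c0 + c1 * cexp (- (x * t)) + c2 * cexp (- (y * t)) = 0].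
Proof.
move=> x0 y0 xy.
have [->|c00] := eqVneq c0 0.
  move=> /= c12; have yx : x - y != 0 by rewrite subr_eq0.
  apply: nullS (null_cexp_affine yx c12) => t /= e.
  apply: (mulIf (cexp_neq0 (- (x * t)))); rewrite mul0r -[RHS]e add0r mulrDl -mulrA -cexpD.
  by congr (_ + _ * cexp _); ring.
move=> _; have [->|c10] := eqVneq c1 0.
  have yN : - y != 0 by rewrite oppr_eq0.
  have := @null_cexp_affine (- y) c0 c2 yN; rewrite c00 => /(_ isT); apply: nullS => t /= <-.
  by rewrite mul0r addr0 mulNr.
have [s hs] := circle_roots (nrm c2) c00 c10.
have xN : - x != 0 by rewrite oppr_eq0.
have nz (z : C) : null [set t | cexp (- x * t) = z].
  have zP : ('X - z%:P : {poly C}) != 0 by rewrite polyXsubC_eq0.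
  by apply: nullS (null_cexp_roots xN zP) => t /= <-; rewrite hornerXsubC subrr.
apply: nullS (null_seq s nz) => t /= e; exists (cexp (- x * t)) => //.
apply: hs; first exact: nrm_cexp.
rewrite mulNr; have -> : c0 + c1 * cexp (- (x * t)) = - (c2 * cexp (- (y * t))).
  by apply/eqP; rewrite -addr_eq0 e.
by rewrite nrmN nrmM nrm_cexp mulr1.
Qed.

Lemma L2_decay (f : R -> C) (s : R) : L2fun f -> s != 0 ->
  null [set t | ~ forall eps : R, 0 < eps -> exists k : nat, forall n : int, (k <= `|n|)%N ->
    nrm (f (t + n%:~R * s)) <= eps].
Proof.
move=> [mRe mIm fin] s0.
have mg : measurable_fun setT (fun t => nrm (f t) ^+ 2).
  have := measurable_funD (measurable_funX 2 mRe) (measurable_funX 2 mIm).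
  by apply: eq_measurable_fun => t _; rewrite sqr_nrm.
have g0 t : 0 <= nrm (f t) ^+ 2 by exact: sqr_ge0.
have sN : - s != 0 by rewrite oppr_eq0.
apply: nullS (nullU (null_no_decay s0 mg g0 fin) (null_no_decay sN mg g0 fin)) => t /= bt.
apply: contrapT => /not_orP[/contrapT d1 /contrapT d2]; apply: bt => e e0.
have e2 : 0 < e ^+ 2 by rewrite exprn_gt0.
have [K1 h1] := d1 _ e2; have [K2 h2] := d2 _ e2.
exists (maxn K1 K2) => n; rewrite geq_max => /andP[n1 n2].
rewrite -ler_sqr ?nnegrE ?nrm_ge0 ?(ltW e0)//.
case: (intP n) n1 n2 => [|m|m] n1 n2.
- by have := h1 0%N; rewrite mul0r; apply.
- by rewrite -pmulrn; apply: h1.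
by rewrite mulrNz -pmulrn mulNr -mulrN; apply: h2; rewrite abszN in n2.
Qed.

(** If the third point is on the same vertical line, [f] is annihilated by a
    trigonometric polynomial; otherwise the moduli satisfy the relation of
    [null_two_sided_decay]. *)
Lemma three_points_vertical (f : R -> C) (kappa s y : R) (c0 c1 c2 : C) :
  L2fun f -> kappa != 0 -> (s, y) != 0 -> (s, y) != (0, kappa) ->
  [|| c0 != 0, c1 != 0 | c2 != 0] ->
  null [set t | c0 * f t + c1 * (cexp (- (kappa * t)) * f t) +
    c2 * (cexp (- (y * t)) * f (t - s)) != 0] ->
  null [set t | f t != 0].
Proof.
move=> Lf k0 sy0 sy1 c nrel.
have [s0|s0] := eqVneq s 0.
  rewrite s0 in sy0 sy1 nrel.
  have y0 : y != 0 by apply: contraNneq sy0 => ->.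
  have ky : kappa != y by apply: contraNneq sy1 => ->.
  apply: nullS (nullU nrel (null_cexp_three k0 y0 ky c)) => t /= ft.
  apply/or_asboolP; rewrite -implyNb; apply/implyP => /asboolPn/negP; rewrite negbK => /eqP e.
  apply/asboolP; apply: (mulIf ft); rewrite mul0r -[RHS]e subr0; ring.
have kN : - kappa != 0 by rewrite oppr_eq0.
have [c20|c20] := eqVneq c2 0.
  rewrite c20 eqxx orbF in c.
  apply: nullS (nullU nrel (null_cexp_affine kN c)) => t /= ft.
  apply/or_asboolP; rewrite -implyNb; apply/implyP => /asboolPn/negP; rewrite negbK => /eqP e.
  apply/asboolP; apply: (mulIf ft); rewrite mul0r -[RHS]e c20 mulNr; ring.
apply: (null_two_sided_decay (a := c0 / c2) (b := c1 / c2) kN) (L2_decay Lf s0).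
apply: nullS nrel => t /=; apply: contraNN => /eqP e.
have : c2 * (cexp (- (y * t)) * f (t - s)) = - (c0 + c1 * cexp (- (kappa * t))) * f t.
  by apply/eqP; rewrite -subr_eq0 -[X in _ == X]e; apply/eqP; ring.
move=> /(congr1 (fun z : C => nrm z)); rewrite !nrmM nrm_cexp mul1r nrmN => e2.
have -> : c0 / c2 + c1 / c2 * cexp (- kappa * t) = (c0 + c1 * cexp (- (kappa * t))) / c2.
  by rewrite mulNr mulrDl mulrAC.
rewrite nrmM nrmV mulrAC -e2 mulrAC divff ?mul1r//.
by rewrite gt_eqF// nrm_gt0.
Qed.

End ThreePoints.

(** * Cosine and sine transforms *)

Section Transform.
Context {R : realType}.
Local Notation mu := (@lebesgue_measure R).

Definition L1fun (g : R -> R) := mu.-integrable setT (EFin \o g).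

(** The boolean selects the cosine or the sine, so that both transforms are
    studied at once. *)
Definition trig (c : bool) (x : R) : R := if c then cos (2 * pi * x) else sin (2 * pi * x).

Definition transform (c : bool) (g : R -> R) (xi : R) : R :=
  \int[mu]_(x in setT) (g x * trig c (x * xi)).

Lemma trig_le1 c x : `|trig c x| <= 1.
Proof. by case: c; rewrite /trig ler_norml ?cos_le1 ?cos_geN1 ?sin_le1 ?sin_geN1. Qed.

Lemma measurable_trig c (h : R -> R) : measurable_fun setT h -> measurable_fun setT (fun x => trig c (h x)).
Proof.
move=> mh; apply: (@measurableT_comp _ _ _ _ _ _ (trig c)) => //.
have m2 : measurable_fun setT (fun x : R => 2 * pi * x) by apply: measurable_funM.
case: c; rewrite /trig; apply: (measurableT_comp _ m2); apply: continuous_measurable_fun.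
  exact: continuous_cos.
exact: continuous_sin.
Qed.

Lemma L1fun_measurable g : L1fun g -> measurable_fun setT g.
Proof. by move=> sg; apply/measurable_EFinP; exact: measurable_int sg. Qed.

Lemma L1funM (g b : R -> R) (B : R) : L1fun g -> measurable_fun setT b ->
  (forall x, `|b x| <= B) -> L1fun (fun x => g x * b x).
Proof.
move=> sg mb hB; have mg := L1fun_measurable sg.
apply: (le_integrable measurableT _ _ (integrableZl measurableT B sg)).
  by apply/measurable_EFinP; exact: measurable_funM.
move=> x _ /=; rewrite lee_fin !normrM mulrC ler_wpM2r//.
by apply: le_trans (hB x) _; exact: ler_norm.
Qed.

Lemma joint_trig c : measurable_fun setT
  (fun z : measurableTypeR R * measurableTypeR R => trig c (z.1 * z.2)).
Proof.
apply: (@measurableT_comp _ _ _ _ _ _ (trig c)).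
  by have := @measurable_trig c id; apply.
by apply: measurable_funM.
Qed.

Lemma integrable_joint c (g h : R -> R) : L1fun g -> L1fun h ->
  (mu \x mu)%E.-integrable setT (fun z => (g z.1 * (h z.2 * trig c (z.1 * z.2)))%:E).
Proof.
move=> sg sh.
have mg : measurable_fun setT g by exact: L1fun_measurable.
have mh : measurable_fun setT h by exact: L1fun_measurable.
have [_ fg] := integrableP _ _ _ sg; have [_ fh] := integrableP _ _ _ sh.
have mj : measurable_fun setT (fun z : measurableTypeR R * measurableTypeR R =>
    g z.1 * (h z.2 * trig c (z.1 * z.2))).
  apply: measurable_funM; first by apply: (measurableT_comp mg).
  apply: measurable_funM; last exact: joint_trig.
  by apply: (measurableT_comp mh).
apply/integrable12ltyP; first exact/measurable_EFinP.
have fhE : (\int[mu]_y `|(h y)%:E|)%E \is a fin_num.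
  by rewrite ge0_fin_numE//; exact: integral_ge0.
apply: (@le_lt_trans _ _ (\int[mu]_x (`|(g x)%:E| * (\int[mu]_y `|(h y)%:E|)))%E).
  apply: ge0_le_integral => //.
  - by move=> x _; apply: integral_ge0.
  - apply: (@measurable_fun_fubini_tonelli_F _ _ _ _ _ mu
      (fun z => `|(g z.1 * (h z.2 * trig c (z.1 * z.2)))%:E|%E)) => //.
    by apply/measurable_EFinP; apply: measurableT_comp.
  - apply: emeasurable_funM => //.
    by apply/measurable_EFinP; apply: measurableT_comp.
  move=> x _; rewrite -ge0_integralZl//; last first.
    by apply/measurable_EFinP; apply: measurableT_comp.
  apply: ge0_le_integral => //.
  - apply/measurable_EFinP; apply: measurableT_comp => //=.
    apply: measurable_funM; first exact: measurable_cst.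
    apply: measurable_funM => //; apply: measurable_trig; exact: measurable_funM.
  - apply: measurable_funeM; apply/measurable_EFinP; exact: measurableT_comp.
  - move=> y _; rewrite /= lee_fin normrM ler_wpM2l// normrM ler_piMr//.
    exact: trig_le1.
rewrite ge0_integralZr//; last exact: integral_ge0.
  apply: lte_mul_pinfty => //; first exact: integral_ge0.
  by rewrite ge0_fin_numE//; exact: integral_ge0.
by apply/measurable_EFinP; apply: measurableT_comp.
Qed.

Lemma L1fun_trig c g (xi : R) : L1fun g -> L1fun (fun x => g x * trig c (x * xi)).
Proof.
move=> sg; apply: (@L1funM _ _ 1) => //; last by move=> x; exact: trig_le1.
by apply: measurable_trig; exact: measurable_funM.
Qed.

Definition norm1 (g : R -> R) : R := \int[mu]_(x in setT) `|g x|.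

Lemma transform_le c g xi : L1fun g -> `|transform c g xi| <= norm1 g.
Proof.
move=> sg; apply: le_trans (le_normr_Rintegral _ _) _ => //; first exact: L1fun_trig.
apply: le_Rintegral => //.
- exact: (integrable_norm (L1fun_trig c xi sg)).
- exact: (integrable_norm sg).
by move=> x _ /=; rewrite normrM ler_piMr// trig_le1.
Qed.

Lemma L1fun1 : forall a b : R, L1fun (\1_(`[a, b]%classic)).
Proof.
move=> a b; apply/integrableP; split; first exact/measurable_EFinP.
under eq_integral => x _ do rewrite /= ger0_norm//.
have -> : (\int[mu]_x (\1_(`[a, b]%classic) x)%:E = mu `[a, b]%classic)%E by rewrite integral_indic// setIT.
rewrite lebesgue_measure_itv /=.
by case: ifP => _; rewrite ltry.
Qed.

Lemma measurable_Rintegral_param (F : R -> R -> R) :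
  measurable_fun setT (fun z : measurableTypeR R * measurableTypeR R => F z.1 z.2) ->
  measurable_fun setT (fun x : R => \int[mu]_(y in setT) F x y).
Proof.
move=> mF; pose G (z : measurableTypeR R * measurableTypeR R) := (F z.1 z.2)%:E.
have mG : measurable_fun setT G by exact/measurable_EFinP.
have -> : (fun x : R => \int[mu]_(y in setT) F x y) =
    fine \o (fun x => fubini_F mu (G^\+)%E x - fubini_F mu (G^\-)%E x)%E.
  apply/funext => x; rewrite /Rintegral integralE /= /fubini_F.
  by congr (fine (_ - _)%E); apply: eq_integral => y _; rewrite ?funeposE ?funenegE.
apply: (measurableT_comp (@fine_measurable R _ measurableT)) => //.
apply: emeasurable_funB.
  by apply: measurable_fun_fubini_tonelli_F => //; exact: measurable_funepos.
by apply: measurable_fun_fubini_tonelli_F => //; exact: measurable_funeneg.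
Qed.

Lemma measurable_transform c g : L1fun g -> measurable_fun setT (transform c g).
Proof.
move=> sg; have mg := L1fun_measurable sg.
apply: (@measurable_Rintegral_param (fun xi x => g x * trig c (x * xi))).
apply: measurable_funM; first by apply: (measurableT_comp mg).
apply: (@measurableT_comp _ _ _ _ _ _ (trig c)); first by have := @measurable_trig c id; apply.
by apply: measurable_funM.
Qed.

Lemma RintegralE (D : set R) (f : R -> R) : measurable D -> mu.-integrable D (EFin \o f) ->
  (\int[mu]_(x in D) f x)%:E = (\int[mu]_(x in D) (f x)%:E)%E.
Proof. by move=> mD sf; rewrite /Rintegral fineK//; exact: integrable_fin_num. Qed.

(** Fubini's theorem, the kernel being symmetric. *)
Lemma transform_swap c g h : L1fun g -> L1fun h ->
  \int[mu]_(x in setT) (g x * transform c h x) = \int[mu]_(y in setT) (h y * transform c g y).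
Proof.
move=> sg sh; rewrite /Rintegral.
have := Fubini (integrable_joint c sg sh) => /= e.
have inner (k : R -> R) (x r : R) : L1fun k ->
    (r * transform c k x)%:E = (\int[mu]_y (r * (k y * trig c (x * y)))%:E)%E.
  move=> sk; have sk' := L1fun_trig c x sk.
  rewrite /transform -(RintegralZl r measurableT sk') (@RintegralE setT (fun y => r * (k y * trig c (y * x)))) //.
    by apply: eq_integral => y _; rewrite [x * y]mulrC.
  exact: (integrableZl measurableT r sk').
congr fine; under eq_integral => x _ do rewrite (inner h _ _ sh).
rewrite e; apply: eq_integral => y _; rewrite (inner g _ _ sg).
by apply: eq_integral => x _; rewrite mulrCA [x * y]mulrC.
Qed.

Lemma expR_decay (a : R) : 0 < a -> expR (- (a * x)) @[x --> +oo] --> (0 : R).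
Proof.
move=> a0.
have -> : (fun x => expR (- (a * x))) = (fun y => expR (- y)) \o (fun x => a * x) by [].
apply: (@cvg_comp _ _ _ _ _ _ (pinfty_nbhs R)); last exact: cvgr_expR.
by apply: gt0_cvgMry => //; exact: cvg_id.
Qed.

Lemma is_derive_damped (a b p q r x : R) :
  is_derive x 1 (fun x => expR (- (a * x)) * (p + q * cos (b * x) + r * sin (b * x)))
   (expR (- (a * x)) * (- a * p + (b * r - a * q) * cos (b * x) + (- a * r - b * q) * sin (b * x))).
Proof.
apply: is_derive_eq.
rewrite /GRing.scale /=; ring.
Qed.

(** Both the weight alone and its product with [1 + cos] are derivatives of a damped
    combination of [1], [cos] and [sin]. *)
Lemma integral_damped (a b p q r : R) : 0 < a ->
  (forall x, 0 <= - a * p + (b * r - a * q) * cos (b * x) + (- a * r - b * q) * sin (b * x)) ->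
  (\int[mu]_(x in `[0%R, +oo[) (expR (- (a * x)) *
     (- a * p + (b * r - a * q) * cos (b * x) + (- a * r - b * q) * sin (b * x)))%:E = (- (p + q))%:E)%E.
Proof.
move=> a0 f0.
have dF := is_derive_damped a b p q r.
rewrite (@ge0_continuous_FTC2y _ _ (fun x => expR (- (a * x)) * (p + q * cos (b * x) + r * sin (b * x))) 0 0).
- by rewrite !mulr0 oppr0 expR0 cos0 sin0 mulr0 addr0 mulr1 mul1r sub0e.
- by move=> x _; rewrite mulr_ge0 ?expR_ge0.
- apply: continuous_subspaceT => x.
  by apply: differentiable_continuous; apply/derivable1_diffP; apply: ex_derive.
- apply/cvgr0Pnorm_le => e e0.
  pose M := `|p| + `|q| + `|r| + 1.
  have M0 : 0 < M by rewrite ltr_wpDl// !addr_ge0.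
  have := expR_decay a0 => /cvgr0Pnorm_le /(_ (e / M) (divr_gt0 e0 M0)).
  apply: filterS => x; rewrite ger0_norm ?expR_ge0// => hx.
  rewrite normrM ger0_norm ?expR_ge0//.
  apply: le_trans (_ : e / M * M <= _); last by rewrite divfK// gt_eqF.
  apply: ler_pM => //.
  apply: le_trans (ler_normD _ _) _; apply: le_trans (lerD (ler_normD _ _) (lexx _)) _.
  rewrite /M !normrM -[leLHS]addr0; apply: lerD => //.
  by apply: lerD; [apply: lerD => //|]; rewrite ler_piMr// ler_norml ?cos_le1 ?cos_geN1 ?sin_le1 ?sin_geN1.
- by move=> x _; apply: ex_derive.
- apply: cvg_at_right_filter.
  have df : derivable (fun x => expR (- (a * x)) * (p + q * cos (b * x) + r * sin (b * x))) 0 1.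
    exact: ex_derive.
  by have /derivable1_diffP/differentiable_continuous := df.
- by move=> x _; rewrite derive1E derive_val.
Qed.

(** A one-sided weight, whose cosine transform is the Poisson kernel. *)
Definition psi (a : R) (x : R) : R := expR (- (a * x)) * \1_(`[0, +oo[%classic) x.

Lemma psi_ge0 a x : 0 <= psi a x.
Proof. by rewrite mulr_ge0 ?expR_ge0. Qed.

Lemma integral_psi (a : R) (g : R -> R) : (\int[mu]_x (psi a x * g x)%:E =
  \int[mu]_(x in `[0%R, +oo[) (expR (- (a * x)) * g x)%:E)%E.
Proof.
rewrite [RHS]integral_mkcond; apply: eq_integral => x _.
rewrite /psi patchE indicE; case: ifP => _; first by rewrite mulr1.
by rewrite mulr0 mul0r.
Qed.

Lemma measurable_psi (a : R) : measurable_fun setT (psi a).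
Proof.
apply: measurable_funM => //; apply: measurableT_comp => //.
by apply: measurableT_comp => //; apply: measurable_funM.
Qed.

Lemma integral_psi1 (a : R) : 0 < a -> (\int[mu]_x (psi a x)%:E = (a^-1)%:E)%E.
Proof.
move=> a0; have aN0 : a != 0 by rewrite gt_eqF.
have one x : - a * - a^-1 + (0 * 0 - a * 0) * cos (0 * x) + (- a * 0 - 0 * 0) * sin (0 * x) = 1.
  by field.
under eq_integral => x _ do rewrite -[psi a x]mulr1.
rewrite integral_psi -[a^-1]opprK -[- a^-1]addr0 -(@integral_damped a 0 (- a^-1) 0 0 a0).
  by apply: eq_integral => x _; rewrite one.
by move=> x; rewrite one.
Qed.

Lemma L1fun_psi (a : R) : 0 < a -> L1fun (psi a).
Proof.
move=> a0; apply/integrableP; split; first by apply/measurable_EFinP; exact: measurable_psi.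
under eq_integral => x _ do rewrite /= ger0_norm ?psi_ge0//.
by rewrite integral_psi1// ltry.
Qed.

(** The fundamental theorem of calculus on a half-line wants a nonnegative
    integrand, so [1 + cos] is integrated and the integral of the weight is
    subtracted. *)
Lemma integral_psi_cos (a s : R) : 0 < a ->
  \int[mu]_(x in setT) (psi a x * trig true (s * x)) = a / (a ^+ 2 + (2 * pi * s) ^+ 2).
Proof.
move=> a0; set b := 2 * pi * s; set D := a ^+ 2 + b ^+ 2.
have D0 : D != 0 by rewrite gt_eqF// ltr_wpDr ?sqr_ge0// exprn_gt0.
have aN0 : a != 0 by rewrite gt_eqF.
have s0 := L1fun_psi a0.
have s1 : L1fun (fun x => psi a x * trig true (s * x)).
  apply: (@L1funM _ _ 1) => //; last by move=> x; exact: trig_le1.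
  by apply: measurable_trig; exact: measurable_funM.
have s2 : L1fun (fun x => psi a x * (1 + trig true (s * x))).
  have := integrableD measurableT s0 s1; apply: eq_integrable => // x _.
  by congr (_%:E); rewrite [RHS](mulrDr (psi a x)) mulr1.
have e1 : \int[mu]_(x in setT) psi a x = a^-1.
  by apply: EFin_inj; rewrite RintegralE// integral_psi1.
have e2 : \int[mu]_(x in setT) (psi a x * (1 + trig true (s * x))) = a^-1 + a / D.
  apply: EFin_inj; rewrite RintegralE// integral_psi.
  have := @integral_damped a b (- a^-1) (- (a / D)) (b / D) a0.
  have -> : - a * - a^-1 = 1 by rewrite mulrNN divff.
  have -> : b * (b / D) - a * - (a / D) = 1 by rewrite -[RHS](divff D0) /D; field.
  have -> : - a * (b / D) - b * - (a / D) = 0 by ring.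
  rewrite opprD !opprK => e; rewrite -e.
    by apply: eq_integral => x _; rewrite mul1r mul0r addr0 /trig mulrA.
  by move=> x; rewrite mul1r mul0r addr0 -lerBlDl sub0r cos_geN1.
apply: (addrI (a^-1)); rewrite -e2 -[in LHS]e1 -RintegralD//.
by apply: eq_Rintegral => x _; rewrite [RHS](mulrDr (psi a x)) mulr1.
Qed.

End Transform.

(** * The Poisson kernel and Plancherel's inequality *)

Section Poisson.
Context {R : realType}.
Local Notation mu := (@lebesgue_measure R).

Lemma measurable_opp : measurable_fun setT (-%R : measurableTypeR R -> measurableTypeR R).
Proof. exact: measurable_funN. Qed.

Lemma lebesgue_measure_opp (A : set R) : measurable A ->
  pushforward mu (-%R : measurableTypeR R -> measurableTypeR R) A = mu A.
Proof.
move=> mA; apply/esym.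
pose phi : {mfun _ >-> _} := HB.pack (-%R : measurableTypeR R -> measurableTypeR R)
  (isMeasurableFun.Build _ _ _ _ _ measurable_opp).
apply: (@lebesgue_measure_unique R (pushforward mu phi)) => //= _ [[b c]] _ <-.
rewrite /pushforward /=.
have -> : (-%R : R -> R) @^-1` `]b, c] = `[- c, - b[%classic.
  by apply/seteqP; split => x /=; rewrite !in_itv/= ltrNr lerNl andbC.
by rewrite !lebesgue_measure_itv/= !lte_fin ltrN2 -!EFinB; congr (if _ then (_)%:E else _); ring.
Qed.

Lemma null_opp (A : set R) : null A -> null [set t | A (- t)].
Proof.
move=> [B [mB B0 AB]]; exists (-%R @^-1` B); split.
- by rewrite -[X in measurable X]setTI; apply: measurable_opp.
- by rewrite -[LHS]/(pushforward mu _ B) lebesgue_measure_opp.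
- by move=> t /AB.
Qed.

Lemma ge0_integral_opp (g : R -> \bar R) : measurable_fun setT g -> (forall x, 0 <= g x)%E ->
  (\int[mu]_x g (- x)%R = \int[mu]_x g x)%E.
Proof.
move=> mg g0.
have := @ge0_integral_pushforward _ _ _ _ _ _ measurable_opp mu setT g measurableT mg (fun x _ => g0 x).
rewrite preimage_setT => e; apply: (eq_trans (esym e)).
apply: eq_measure_integral => A mA _.
exact: lebesgue_measure_opp.
Qed.

Lemma ge0_even_integral_le (g : R -> R) : measurable_fun setT g -> (forall x, 0 <= g x) ->
  (forall x, g (- x) = g x) ->
  (\int[mu]_x (g x)%:E <= \int[mu]_(x in `[0%R, +oo[) (g x)%:E + \int[mu]_(x in `[0%R, +oo[) (g x)%:E)%E.
Proof.
move=> mg g0 gN.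
pose G (x : R) := g x * \1_(`[0, +oo[%classic) x.
have G0 x : 0 <= G x by rewrite mulr_ge0.
have mG : measurable_fun setT G by apply: measurable_funM.
have mGN : measurable_fun setT (fun x : R => G (- x)).
  by apply: (measurableT_comp mG); exact: measurable_funN.
have -> : (\int[mu]_(x in `[0%R, +oo[) (g x)%:E = \int[mu]_x (G x)%:E)%E.
  rewrite integral_mkcond; apply: eq_integral => x _.
  by rewrite patchE /G indicE; case: ifP => _; rewrite ?mulr1 ?mulr0.
rewrite -{2}(@ge0_integral_opp (fun x => (G x)%:E))//; last exact/measurable_EFinP.
rewrite -ge0_integralD//; try by move=> *; rewrite lee_fin.
- apply: ge0_le_integral => //.
  + by move=> x _; rewrite lee_fin.
  + exact/measurable_EFinP.
  + by apply: emeasurable_funD; apply/measurable_EFinP.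
  move=> x _; rewrite -EFinD lee_fin /G !indicE gN -mulrDr ler_peMr// -natrD ler1n.
  have [x0|x0] := leP 0 x; first by rewrite mem_set//= in_itv/= x0.
  by rewrite [in X in (_ + X)%N]mem_set ?addn1//= in_itv/= andbT oppr_ge0 ltW.
- exact/measurable_EFinP.
- exact/measurable_EFinP.
Qed.

(** The weight being one-sided, the total mass is one half. *)
Definition poisson (a s : R) : R := a / (a ^+ 2 + (2 * pi * s) ^+ 2).

Lemma poisson_ge0 a s : 0 < a -> 0 <= poisson a s.
Proof. by move=> a0; rewrite divr_ge0 ?(ltW a0)// addr_ge0 ?sqr_ge0. Qed.

Lemma poissonN a s : poisson a (- s) = poisson a s.
Proof. by rewrite /poisson mulrN sqrrN. Qed.

Lemma measurable_poisson (a : R) (h : R -> R) : 0 < a -> measurable_fun setT h ->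
  measurable_fun setT (fun x => poisson a (h x)).
Proof.
move=> a0 mh; apply: (@measurableT_comp _ _ _ _ _ _ (poisson a)) => //.
apply: continuous_measurable_fun => x; rewrite /poisson.
apply: cvgM; first exact: cvg_cst.
apply: cvgV; first by rewrite gt_eqF// ltr_wpDr ?sqr_ge0// exprn_gt0.
apply: cvgD; first exact: cvg_cst.
by apply: cvgM; apply: cvgM => //; exact: cvg_cst.
Qed.

Definition poisson_prim (a x : R) : R := atan (2 * pi * x / a) / (2 * pi).

Lemma is_derive_poisson_prim (a x : R) : 0 < a -> is_derive x 1 (poisson_prim a) (poisson a x).
Proof.
move=> a0; have p0 : 2 * pi != 0 :> R by rewrite gt_eqF// mulr_gt0// pi_gt0.
have D0 : a ^+ 2 + (2 * pi * x) ^+ 2 != 0 by rewrite gt_eqF// ltr_wpDr ?sqr_ge0// exprn_gt0.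
have aN0 : a != 0 by rewrite gt_eqF.
apply: is_derive_eq; rewrite /GRing.scale /= /poisson.
have D1 : 1 + (2 * pi * x / a) ^+ 2 != 0 by rewrite gt_eqF// ltr_wpDr ?sqr_ge0.
have -> : 1 + (2 * pi * x / a) ^+ 2 = (a ^+ 2 + (2 * pi * x) ^+ 2) / a ^+ 2 by field.
rewrite !mulr0 add0r mulr1; move: (2 * pi) p0 D0 {D1} => w p0 D0; field.
by rewrite ?p0 ?D0 ?aN0.
Qed.

Lemma integral_poisson (a x : R) : 0 < a -> (\int[mu]_y (poisson a (x - y))%:E <= (1 / 2)%:E)%E.
Proof.
move=> a0; have p0 : 0 < 2 * pi :> R by rewrite mulr_gt0// pi_gt0.
have mp : measurable_fun setT (poisson a) by exact: measurable_poisson.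
have -> : (\int[mu]_y (poisson a (x - y))%:E = \int[mu]_y (poisson a y)%:E)%E.
  rewrite -(@ge0_integral_shift _ x setT (fun y => (poisson a y)%:E))//.
  - by rewrite preimage_setT; apply: eq_integral => y _; rewrite -poissonN opprB.
  - exact/measurable_EFinP.
  - by move=> y; rewrite lee_fin poisson_ge0.
apply: le_trans (ge0_even_integral_le mp (fun y => poisson_ge0 y a0) (poissonN a)) _.
rewrite (@ge0_continuous_FTC2y _ _ (poisson_prim a) 0 (1 / 4)).
- by rewrite /poisson_prim mulr0 mul0r atan0 mul0r sube0 -EFinD lee_fin; lra.
- by move=> y _; exact: poisson_ge0.
- apply: continuous_subspaceT => y; rewrite /poisson.
  apply: cvgM; first exact: cvg_cst.
  apply: cvgV; first by rewrite gt_eqF// ltr_wpDr ?sqr_ge0// exprn_gt0.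
  apply: cvgD; first exact: cvg_cst.
  by apply: cvgM; apply: cvgM => //; exact: cvg_cst.
- have ppi : (pi : R) != 0 by apply: lt0r_neq0; exact: pi_gt0.
  have -> : 1 / 4 = pi / 2 / (2 * pi) :> R by move: (pi) ppi => w w0; field.
  apply: cvgM; last exact: cvg_cst.
  have -> : (fun y => atan (2 * pi * y / a)) = atan \o (fun y => 2 * pi * y / a) by [].
  apply: (@cvg_comp _ _ _ _ _ _ (pinfty_nbhs R)); last exact: cvgy_atan.
  apply: gt0_cvgMly; first by rewrite invr_gt0.
  by apply: gt0_cvgMry => //; exact: cvg_id.
- by move=> y _; apply: ex_derive; exact: is_derive_poisson_prim.
- apply: cvg_at_right_filter.
  have dp := is_derive_poisson_prim 0 a0.
  have df : derivable (poisson_prim a) 0 1 by exact: ex_derive.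
  by have /derivable1_diffP/differentiable_continuous := df.
- by move=> y _; have dp := is_derive_poisson_prim y a0; rewrite derive1E derive_val.
Qed.

Lemma L1funD (g h : R -> R) : L1fun g -> L1fun h -> L1fun (fun x => g x + h x).
Proof. by move=> sg sh; exact: (integrableD measurableT sg sh). Qed.

Lemma L1fun_mul_transform (g h : R -> R) c : L1fun g -> L1fun h ->
  L1fun (fun x => g x * transform c h x).
Proof.
move=> sg sh; apply: (@L1funM _ g _ (norm1 h)) => //; first exact: measurable_transform.
by move=> x; exact: transform_le.
Qed.

(** The weight [psi a] turns the product of the transforms of two functions into
    a double integral against the Poisson kernel: [transform_swap] is used twice, and
    the addition formula for the cosine merges the two transforms. *)
Lemma poisson_identity (a : R) (g h : R -> R) : 0 < a -> L1fun g -> L1fun h ->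
  \int[mu]_(x in setT) (psi a x * (transform true g x * transform true h x)) +
  \int[mu]_(x in setT) (psi a x * (transform false g x * transform false h x)) =
  \int[mu]_(x in setT) (g x * \int[mu]_(y in setT) (h y * poisson a (x - y))).
Proof.
move=> a0 sg sh; have sp := L1fun_psi a0.
pose phi c x := psi a x * transform c h x.
have sphi c : L1fun (phi c) by exact: L1fun_mul_transform.
have stp c x : L1fun (fun xi => psi a xi * trig c (xi * x)) by exact: L1fun_trig.
have e c : \int[mu]_(x in setT) (psi a x * (transform c g x * transform c h x)) =
    \int[mu]_(x in setT) (g x * transform c (phi c) x).
  rewrite -transform_swap//; apply: eq_Rintegral => x _.
  by rewrite /phi mulrA mulrAC.
have e2 c x : transform c (phi c) x =
    \int[mu]_(y in setT) (h y * transform c (fun xi => psi a xi * trig c (xi * x)) y).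
  rewrite -transform_swap//; apply: eq_Rintegral => xi _.
  by rewrite /phi mulrAC.
rewrite !e -RintegralD//; try exact: L1fun_mul_transform.
apply: eq_Rintegral => x _; rewrite -mulrDr; congr (_ * _).
rewrite !e2 -RintegralD//; try exact: L1fun_mul_transform.
apply: eq_Rintegral => y _; rewrite -mulrDr; congr (_ * _).
rewrite /poisson -integral_psi_cos// /transform -RintegralD//; try exact: L1fun_trig.
apply: eq_Rintegral => xi _.
rewrite -!(mulrA (psi a xi)) -mulrDr; congr (_ * _); rewrite /trig.
by rewrite -cosB; congr cos; ring.
Qed.

Definition sqint (g : R -> R) : \bar R := (\int[mu]_x (g x ^+ 2)%:E)%E.

Lemma measurable_sqr (g : R -> R) : measurable_fun setT g ->
  measurable_fun setT (fun x => (g x ^+ 2)%:E).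
Proof. by move=> mg; apply/measurable_EFinP; exact: measurable_funX. Qed.

(** Schur's test for the Poisson kernel, whose integral is at most one half. *)
Lemma poisson_schur (a : R) (g : R -> R) : 0 < a -> L1fun g ->
  ((\int[mu]_(x in setT) (g x * \int[mu]_(y in setT) (g y * poisson a (x - y))))%:E
   <= (1 / 2)%:E * sqint g)%E.
Proof.
move=> a0 sg; have mg := L1fun_measurable sg.
have Pa s : `|poisson a s| <= a^-1.
  rewrite ger0_norm ?poisson_ge0// /poisson ler_pdivrMr ?ltr_wpDr ?sqr_ge0 ?exprn_gt0//.
  by rewrite mulrDr expr2 mulrA mulVf ?gt_eqF// mul1r lerDl mulr_ge0 ?sqr_ge0// invr_ge0 ltW.
have mP x : measurable_fun setT (fun y : R => poisson a (x - y)).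
  by apply: measurable_poisson => //; exact: measurable_funB.
have sP x : L1fun (fun y => g y * poisson a (x - y)).
  by apply: (@L1funM _ _ _ (a^-1)).
pose u x := g x * \int[mu]_(y in setT) (g y * poisson a (x - y)).
pose F (z : measurableTypeR R * measurableTypeR R) := (1 / 2 * g z.2 ^+ 2 * poisson a (z.1 - z.2))%:E.
have F0 z : (0 <= F z)%E.
  by rewrite lee_fin mulr_ge0 ?poisson_ge0// mulr_ge0 ?sqr_ge0// divr_ge0.
have mF : measurable_fun setT F.
  apply/measurable_EFinP; apply: measurable_funM.
    apply: measurable_funM; first exact: measurable_cst.
    by apply: measurable_funX; apply: (measurableT_comp mg).
  apply: (@measurableT_comp _ _ _ _ _ _ (poisson a)); last exact: measurable_funB.
  by have := @measurable_poisson a id a0; apply.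
pose H x := ((1 / 4 * g x ^+ 2)%:E + \int[mu]_y F (x, y))%E.
have mK : measurable_fun setT (fun x : R => \int[mu]_(y in setT) (g y * poisson a (x - y))).
  apply: (@measurable_Rintegral_param _ (fun x y => g y * poisson a (x - y))).
  apply: measurable_funM; first by apply: (measurableT_comp mg).
  apply: (@measurableT_comp _ _ _ _ _ _ (poisson a)); last exact: measurable_funB.
  by have := @measurable_poisson a id a0; apply.
have su : L1fun u.
  apply: (@L1funM _ _ _ (norm1 g * a^-1)) => // x.
  apply: le_trans (le_normr_Rintegral measurableT (sP x)) _.
  rewrite /norm1 -RintegralZr//; last exact: (integrable_norm sg).
  apply: le_Rintegral => //.
  - exact: (integrable_norm (sP x)).
  - exact: (integrableZr measurableT _ (integrable_norm sg)).
  by move=> y _ /=; rewrite normrM ler_wpM2l.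
have mHF : measurable_fun setT (fun x => \int[mu]_y F (x, y))%E.
  exact: measurable_fun_fubini_tonelli_F.
have uH x : (`|(u x)%:E| <= H x)%E.
  have mP1 : measurable_fun setT (fun y : R => (1 / 2 * g x ^+ 2 * poisson a (x - y))%:E).
    by apply/measurable_EFinP; apply: measurable_funM => //; exact: measurable_cst.
  have mP2 : measurable_fun setT (fun y => F (x, y)).
    apply/measurable_EFinP; apply: measurable_funM; last exact: mP.
    by apply: measurable_funM => /=; [exact: measurable_cst|exact: measurable_funX].
  rewrite /H -[(1 / 4 * g x ^+ 2)%R]mulrC (_ : 1 / 4 = 1 / 2 * (1 / 2)); last by field.
  apply: (@le_trans _ _ (\int[mu]_y ((1 / 2 * g x ^+ 2 * poisson a (x - y))%:E + F (x, y)))%E).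
    rewrite /u /= normrM.
    apply: (@le_trans _ _ (`|g x| * \int[mu]_(y in setT) `|g y * poisson a (x - y)|)%:E).
      by rewrite lee_fin; apply: ler_wpM2l => //; exact: (le_normr_Rintegral measurableT (sP x)).
    have sn : L1fun (fun y => `|g y * poisson a (x - y)|) := integrable_norm (sP x).
    rewrite -RintegralZl// RintegralE//; last exact: (integrableZl measurableT _ sn).
    apply: ge0_le_integral => //.
    - apply/measurable_EFinP; apply: measurable_funM; first exact: measurable_cst.
      exact: L1fun_measurable sn.
    - exact: emeasurable_funD.
    move=> y _; rewrite -EFinD lee_fin /= normrM (ger0_norm (poisson_ge0 _ a0)) mulrA -mulrDl.
    rewrite ler_wpM2r ?poisson_ge0//.
    have := sqr_ge0 (`|g x| - `|g y|); rewrite sqrrB !real_normK ?num_real//.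
    by rewrite mulr2n; lra.
  rewrite ge0_integralD//.
  - rewrite leeD2r//.
    under eq_integral => y _ do rewrite EFinM.
    have c0 : 0 <= 1 / 2 * g x ^+ 2 by rewrite mulr_ge0 ?sqr_ge0// divr_ge0.
    rewrite ge0_integralZl_EFin//.
    + rewrite (_ : g x ^+ 2 * (1 / 2 * (1 / 2)) = 1 / 2 * g x ^+ 2 * (1 / 2)); last by ring.
      by rewrite [leRHS]EFinM; apply: lee_wpmul2l; rewrite ?lee_fin//; exact: integral_poisson.
    + by move=> y _; rewrite lee_fin poisson_ge0.
    + by apply/measurable_EFinP; exact: mP.
  - by move=> y _; rewrite lee_fin mulr_ge0 ?poisson_ge0// mulr_ge0 ?sqr_ge0// divr_ge0.
rewrite -/u RintegralE//.
apply: le_trans (lee_abs _) _; apply: le_trans (le_abse_integral _ _ _) _ => //.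
  by apply/measurable_EFinP; exact: L1fun_measurable su.
have g40 x : (0 <= (1 / 4 * g x ^+ 2)%:E)%E by rewrite lee_fin mulr_ge0 ?sqr_ge0// divr_ge0.
have mg4 : measurable_fun setT (fun x => (1 / 4 * g x ^+ 2)%:E).
  apply/measurable_EFinP; apply: measurable_funM; first exact: measurable_cst.
  exact: measurable_funX.
have HF0 x : (0 <= \int[mu]_y F (x, y))%E by apply: integral_ge0.
apply: (@le_trans _ _ (\int[mu]_x H x)%E).
  apply: ge0_le_integral => //.
  - apply/measurable_EFinP; apply: measurableT_comp => //; exact: L1fun_measurable su.
  - exact: emeasurable_funD.
  - by move=> x _; exact: uH.
rewrite ge0_integralD// /sqint.
have -> : ((1 / 2)%:E * \int[mu]_x (g x ^+ 2)%:E =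
    (1 / 4)%:E * \int[mu]_x (g x ^+ 2)%:E + (1 / 4)%:E * \int[mu]_x (g x ^+ 2)%:E)%E.
  by rewrite -ge0_muleDl ?lee_fin ?divr_ge0// -EFinD; congr (_%:E * _)%E; field.
apply: leeD.
  rewrite -ge0_integralZl_EFin//.
  - by move=> x _; rewrite lee_fin sqr_ge0.
  - exact: measurable_sqr.
rewrite fubini_tonelli//.
rewrite -ge0_integralZl_EFin//; last 2 first.
- by move=> x _; rewrite lee_fin sqr_ge0.
- exact: measurable_sqr.
apply: ge0_le_integral => //.
- by move=> y _; apply: integral_ge0.
- exact: measurable_fun_fubini_tonelli_G.
move=> y _; rewrite /F /=.
under eq_integral => x _ do rewrite EFinM -poissonN opprB.
rewrite ge0_integralZl_EFin//.
- have -> : ((1 / 4)%:E * (g y ^+ 2)%:E = (1 / 2 * g y ^+ 2)%:E * (1 / 2)%:E)%E.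
    by rewrite -!EFinM; congr (_%:E); field.
  apply: lee_wpmul2l; last exact: integral_poisson.
  by rewrite lee_fin mulr_ge0 ?sqr_ge0// divr_ge0.
- by move=> x _; rewrite lee_fin poisson_ge0.
- by apply/measurable_EFinP; exact: mP.
- by rewrite mulr_ge0 ?sqr_ge0// divr_ge0.
Qed.

Lemma fatou_null (F : nat -> R -> R) (G : R -> R) (M : \bar R) :
  (forall n, measurable_fun setT (F n)) -> (forall n x, 0 <= F n x) -> measurable_fun setT G ->
  null [set x | ~ (F n x @[n --> \oo] --> G x)] ->
  (forall n, (\int[mu]_x (F n x)%:E <= M)%E) -> (\int[mu]_x (G x)%:E <= M)%E.
Proof.
move=> mF F0 mG nF leM.
have mFn n : measurable_fun setT (fun x => (F n x)%:E) by exact/measurable_EFinP.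
have mL : measurable_fun setT (fun x => limn_einf (fun n => (F n x)%:E)).
  have -> : (fun x => limn_einf (fun n => (F n x)%:E)) =
      (fun x => - limn_esup (fun n => - (F n x)%:E))%E.
    by apply/funext => x; rewrite (limn_esupN (fun n => (F n x)%:E)) oppeK.
  apply: measurableT_comp => //; apply: measurable_fun_limn_esup => n.
  exact: measurableT_comp.
have -> : (\int[mu]_x (G x)%:E = \int[mu]_x (limn_einf (fun n => (F n x)%:E)))%E.
  apply: ae_eq_integral => //; first exact/measurable_EFinP.
  apply: nullS nF => x /=; apply: contra_not => cv _.
  have cv' : (F n x)%:E @[n --> \oo] --> (G x)%:E by apply: cvg_EFin => //; exact: nearW.
  by rewrite (cvg_limn_einf_sup cv').1.
apply: le_trans (fatou mu measurableT mFn (fun n x _ => F0 n x)) _.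
rewrite limn_einf_lim; apply: lime_le; first exact: is_cvg_einfs.
apply: nearW => n; apply: le_trans (leM n); by apply: ereal_inf_lbound; exists n => /=.
Qed.

Lemma weighted_transform_le (a : R) c g : 0 < a -> L1fun g ->
  (\int[mu]_x (psi a x * transform c g x ^+ 2)%:E <= (1 / 2)%:E * sqint g)%E.
Proof.
move=> a0 sg.
have s2 c' : L1fun (fun x => psi a x * (transform c' g x * transform c' g x)).
  apply: (@L1funM _ _ _ (norm1 g * norm1 g)).
  - exact: L1fun_psi.
  - by apply: measurable_funM; exact: measurable_transform.
  - by move=> x; rewrite normrM ler_pM//; exact: transform_le.
have p2 c' : 0 <= \int[mu]_(x in setT) (psi a x * (transform c' g x * transform c' g x)).
  by apply: Rintegral_ge0 => // x _; rewrite mulr_ge0 ?psi_ge0// -expr2 sqr_ge0.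
apply: le_trans (poisson_schur a0 sg); rewrite -(poisson_identity a0 sg sg).
under eq_integral => x _ do rewrite expr2.
rewrite -(RintegralE measurableT (s2 c)) lee_fin; move: (p2 true) (p2 false).
by case: c => ? ?; [rewrite lerDl|rewrite lerDr].
Qed.

(** As the weight tends to one, Fatou's lemma bounds the integral over the
    half-line by half of the right-hand side; the transforms are even or odd. *)
Lemma plancherel_le c g : L1fun g -> (sqint (transform c g) <= sqint g)%E.
Proof.
move=> sg; have mt := measurable_transform c sg.
have tN x : transform c g (- x) ^+ 2 = transform c g x ^+ 2.
  rewrite /transform; case: c {mt}.
    by congr (_ ^+ 2); apply: eq_Rintegral => y _; rewrite /trig !mulrN cosN.
  have -> : \int[mu]_(y in setT) (g y * trig false (y * - x)) =
      \int[mu]_(y in setT) (-1 * (g y * trig false (y * x))).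
    by apply: eq_Rintegral => y _; rewrite /trig !mulrN sinN mulrN mulN1r.
  by rewrite RintegralZl ?mulN1r ?sqrrN//; exact: L1fun_trig.
have half : (\int[mu]_(x in `[0%R, +oo[) (transform c g x ^+ 2)%:E <= (1 / 2)%:E * sqint g)%E.
  rewrite integral_mkcond.
  have -> : (\int[mu]_x (((fun x => (transform c g x ^+ 2)%:E) \_ `[0%R, +oo[) x) =
      \int[mu]_x (transform c g x ^+ 2 * \1_(`[0, +oo[%classic) x)%:E)%E.
    apply: eq_integral => x _; rewrite patchE indicE.
    by case: ifP => _; rewrite ?mulr1 ?mulr0.
  apply: (@fatou_null (fun n x => psi n.+1%:R^-1 x * transform c g x ^+ 2)).
  - by move=> n; apply: measurable_funM; [exact: measurable_psi|exact: measurable_funX].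
  - by move=> n x; rewrite mulr_ge0 ?psi_ge0 ?sqr_ge0.
  - by apply: measurable_funM => //; exact: measurable_funX.
  - apply: (@nullS _ set0); last exact: null0.
    move=> x /=; apply; rewrite [X in _ --> X]mulrC.
    apply: cvgM; last exact: cvg_cst.
    rewrite /psi -[X in _ --> X]mul1r; apply: cvgM; last exact: cvg_cst.
    rewrite -[X in _ --> X]expR0; apply: continuous_cvg; first exact: continuous_expR.
    have cv : (fun n : nat => - (n.+1%:R^-1 * x)) @ \oo --> - (0 * x).
      by apply: cvgN; apply: cvgM; [exact: cvg_harmonic|exact: cvg_cst].
    by rewrite mul0r oppr0 in cv.
  - by move=> n; apply: weighted_transform_le.
apply: le_trans (ge0_even_integral_le _ _ _) _.
- exact: measurable_funX.
- by move=> x; exact: sqr_ge0.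
- exact: tN.
apply: le_trans (leeD half half) _.
by rewrite -ge0_muleDl ?lee_fin ?divr_ge0// -EFinD -splitr mul1e.
Qed.

End Poisson.

(** * Injectivity of the transforms *)

Section Injectivity.
Context {R : realType}.
Local Notation mu := (@lebesgue_measure R).

Lemma integral_poisson_itv (a p q x : R) : 0 < a -> p < q ->
  \int[mu]_(y in setT) (\1_(`[p, q]%classic) y * poisson a (x - y)) =
  poisson_prim a (q - x) - poisson_prim a (p - x).
Proof.
move=> a0 pq.
have dp y := is_derive_poisson_prim y a0.
have dF (y : R) : is_derive y (1 : R) (fun y : R => poisson_prim a (y - x)) (poisson a (y - x)).
  have d1 : is_derive (y - x) (1 : R) (poisson_prim a) (poisson a (y - x)) := dp _.
  have d2 : is_derive y (1 : R) (fun y : R => y - x) 1 by apply: is_derive_eq; rewrite subr0.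
  by have := @is_derive1_comp _ (poisson_prim a) (fun y : R => y - x) y _ _ d1 d2; rewrite mulr1.
have cF (y : R) : {for y, continuous (fun y : R => poisson_prim a (y - x))}.
  have df : derivable (fun y : R => poisson_prim a (y - x)) y (1 : R) by exact: ex_derive.
  by have /derivable1_diffP/differentiable_continuous := df.
have e : (\int[mu]_(y in setT) (\1_(`[p, q]%classic) y * poisson a (x - y))%:E =
   \int[mu]_(y in `[p, q]%classic) (poisson a (y - x))%:E)%E.
  rewrite [RHS]integral_mkcond; apply: eq_integral => y _.
  rewrite patchE indicE -poissonN opprB; case: ifP => _; first by rewrite mul1r.
  by rewrite mul0r.
rewrite /Rintegral e (@continuous_FTC2 _ _ (fun y => poisson_prim a (y - x)))//.
- apply: continuous_subspaceT => y; rewrite /poisson.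
  apply: cvgM; first exact: cvg_cst.
  apply: cvgV; first by rewrite gt_eqF// ltr_wpDr ?sqr_ge0// exprn_gt0.
  apply: cvgD; first exact: cvg_cst.
  have c1 : (fun y : R => 2 * pi * (y - x)) @ y --> 2 * pi * (y - x).
    by apply: cvgM; [exact: cvg_cst|apply: cvgB; [exact: cvg_id|exact: cvg_cst]].
  by apply: cvgM.
- split.
  + by move=> y _; apply: ex_derive.
  + by apply: cvg_at_right_filter; exact: cF.
  + by apply: cvg_at_left_filter; exact: cF.
- by move=> y _; rewrite derive1E derive_val.
Qed.

Lemma poisson_primN (a x : R) : poisson_prim a (- x) = - poisson_prim a x.
Proof. by rewrite /poisson_prim mulrN mulNr atanN mulNr. Qed.

Lemma poisson_prim_le (a x : R) : `|poisson_prim a x| <= 1 / 4.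
Proof.
have p0 : 0 < pi :> R := pi_gt0 R.
rewrite /poisson_prim normrM normfV (gtr0_norm (mulr_gt0 _ p0))// ler_pdivrMr ?mulr_gt0//.
have -> : 1 / 4 * (2 * pi) = pi / 2 :> R by move: (pi) => w; field.
by rewrite ler_norml; apply/andP; split; apply: ltW; [exact: atan_gtNpi2|exact: atan_ltpi2].
Qed.

Lemma measurable_poisson_prim (a : R) (h : R -> R) : 0 < a -> measurable_fun setT h ->
  measurable_fun setT (fun x => poisson_prim a (h x)).
Proof.
move=> a0 mh; apply: (@measurableT_comp _ _ _ _ _ _ (poisson_prim a)) => //.
apply: continuous_measurable_fun => y; have dp := is_derive_poisson_prim y a0.
have df : derivable (poisson_prim a) y (1 : R) by exact: ex_derive.
by have /derivable1_diffP/differentiable_continuous := df.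
Qed.

Lemma poisson_prim_cvg (x : R) : 0 < x -> (fun n : nat => poisson_prim n.+1%:R^-1 x) @ \oo --> (1 / 4 : R).
Proof.
move=> x0; have p0 : 0 < pi :> R := pi_gt0 R.
have -> : 1 / 4 = pi / 2 / (2 * pi) :> R.
  have ppi : (pi : R) != 0 by rewrite gt_eqF.
  by move: (pi) ppi => w w0; field.
rewrite /poisson_prim; apply: cvgM; last exact: cvg_cst.
have -> : (fun n : nat => atan (2 * pi * x / n.+1%:R^-1)) = atan \o (fun n : nat => 2 * pi * x * n.+1%:R).
  by apply/funext => n /=; rewrite invrK.
apply: (@cvg_comp _ _ _ _ _ _ (pinfty_nbhs R)); last exact: cvgy_atan.
have -> : (fun n : nat => 2 * pi * x * n.+1%:R) = (fun r => 2 * pi * x * r) \o (fun n : nat => n.+1%:R) by [].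
apply: (@cvg_comp _ _ _ _ _ _ (pinfty_nbhs R)).
  apply/cvgryPge => A; exists (Num.truncn A) => // n /= An.
  by apply/ltW/(lt_le_trans (truncnS_gt A)); rewrite ler_nat ltnS.
by apply: gt0_cvgMry; [rewrite !mulr_gt0|exact: cvg_id].
Qed.

Lemma poisson_prim_cvgN (x : R) : x < 0 -> (fun n : nat => poisson_prim n.+1%:R^-1 x) @ \oo --> (- (1 / 4) : R).
Proof.
move=> x0; have xN : 0 < - x by rewrite oppr_gt0.
have -> : (fun n : nat => poisson_prim n.+1%:R^-1 x) = (fun n : nat => - poisson_prim n.+1%:R^-1 (- x)).
  by apply/funext => n; rewrite poisson_primN opprK.
by apply: cvgN; exact: poisson_prim_cvg.
Qed.

(** By Lebesgue's differentiation theorem [g] is almost everywhere the limit of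
    its means over small intervals, and all these means vanish. *)
Lemma null_of_integrals (g : R -> R) : measurable_fun setT g ->
  (forall p q : R, L1fun (fun x => g x * \1_(`[p, q]%classic) x)) ->
  (forall p q : R, p < q -> \int[mu]_(x in setT) (g x * \1_(`[p, q]%classic) x) = 0) ->
  null [set x | g x != 0].
Proof.
move=> mg sg g0.
have lg : locally_integrable setT g.
  split=> //; first exact: openT.
  move=> K _ cK.
  have [M [_ hM]] := compact_bounded cK.
  have KM : K `<=` `[- (M + 1), M + 1].
    by move=> x Kx; rewrite /= in_itv /= -ler_norml; apply: hM => //; rewrite ltrDl.
  have [_] := integrableP _ _ _ (sg (- (M + 1)) (M + 1)); apply: le_lt_trans.
  rewrite integral_mkcond; apply: ge0_le_integral => //.
  - by move=> x _; rewrite patchE; case: ifP.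
  - apply: (measurable_restrictT _ _).1; first exact: compact_measurable.
    by apply/measurable_EFinP; apply: measurableT_comp => //; exact: measurable_funS mg.
  - by apply/measurable_EFinP; apply: measurableT_comp => //; exact: L1fun_measurable (sg _ _).
  move=> x _; rewrite patchE; case: ifPn => [/set_mem Kx|_]; last exact: abse_ge0.
  by rewrite /= indicE mem_set ?mulr1//; exact: KM.
pose r (n : nat) : R := n.+1%:R^-1.
have r0 n : 0 < r n by rewrite invr_gt0.
pose E (x : R) (n : nat) : set R := `[x - r n / 2, x + r n / 2]%classic.
have muE x n : mu (E x n) = (r n)%:E.
  rewrite /E lebesgue_measure_itv /= lte_fin ifT.
    by rewrite -EFinB; congr (_%:E); field.
  by have := r0 n; lra.
have hE x : nicely_shrinking x (E x).
  split; first by move=> n; exact: measurable_itv.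
  exists (2, fun n => PosNum (r0 n)); split=> //=.
  - exact: cvg_harmonic.
  - by move=> n y; rewrite /E /= in_itv /ball /= => /andP[h1 h2]; rewrite ltr_norml; have rn := r0 n; apply/andP; split; lra.
  - by move=> n; rewrite muE lebesgue_measure_ball ?(ltW (r0 n))// -EFinM lee_fin mulr_natl.
apply: nullS (lebesgue_differentiation lg) => x /= gx lx; move/eqP: gx; apply.
have := nice_lebesgue_differentiation hE lg lx.
have -> : (fun n => (mu (E x n))^-1 * \int[mu]_(y in E x n) (g y)%:E)%E = (fun n => 0%E).
  apply/funext => n; have xx : x - r n / 2 < x + r n / 2 by have := r0 n; lra.
  have -> : (\int[mu]_(y in E x n) (g y)%:E = 0)%E.
    have e0 := congr1 EFin (g0 _ _ xx); rewrite (RintegralE measurableT (sg _ _)) in e0.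
    rewrite -[RHS]e0 integral_mkcond; apply: eq_integral => y _; rewrite patchE /= indicE.
    by case: ifP => _; rewrite ?mulr1 ?mulr0.
  by rewrite mule0.
by move=> cv; apply: EFin_inj; exact: (cvg_unique (@ereal_hausdorff R) cv (cvg_cst 0%E)).
Qed.

Definition window (M : R) (g : R -> R) (x : R) : R := g x * \1_(`[- M, M]%classic) x.
Definition outside (M : R) (g : R -> R) (x : R) : R := g x * \1_(~` `[- M, M]%classic) x.

Lemma L1fun_itv (g : R -> R) (p q : R) : measurable_fun setT g -> (sqint g < +oo)%E ->
  L1fun (fun x => g x * \1_(`[p, q]%classic) x).
Proof.
move=> mg fg; have s2 : L1fun (fun x => g x ^+ 2).
  apply/integrableP; split; first by apply/measurable_EFinP; exact: measurable_funX.
  by under eq_integral => x _ do rewrite /= ger0_norm ?sqr_ge0//.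
apply: (le_integrable measurableT _ _ (L1funD s2 (L1fun1 p q))).
  by apply/measurable_EFinP; apply: measurable_funM.
move=> x _ /=; rewrite lee_fin normrM (ger0_norm (addr_ge0 (sqr_ge0 _) _))//.
rewrite indicE; case: (_ \in _) => /=; rewrite ?normr0 ?mulr0 ?addr0 ?sqr_ge0// normr1 mulr1.
by rewrite -real_normK ?num_real//; have := sqr_ge0 (`|g x| - 1 / 2); rewrite sqrrB; have := normr_ge0 (g x); rewrite mulr2n; nra.
Qed.

Lemma transformB (c : bool) (g h : R -> R) (xi : R) : L1fun g -> L1fun h ->
  transform c (fun x => g x - h x) xi = transform c g xi - transform c h xi.
Proof.
move=> sg sh; rewrite /transform -RintegralB//; try exact: L1fun_trig.
by apply: eq_Rintegral => x _; rewrite mulrBl.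
Qed.

Lemma L1funB (g h : R -> R) : L1fun g -> L1fun h -> L1fun (fun x => g x - h x).
Proof. by move=> sg sh; exact: (integrableB measurableT sg sh). Qed.

Lemma sqint_le (g h : R -> R) : measurable_fun setT g -> measurable_fun setT h ->
  (forall x, `|g x| <= `|h x|) -> (sqint g <= sqint h)%E.
Proof.
move=> mg mh gh; apply: ge0_le_integral => //; try exact: measurable_sqr.
- by move=> x _; rewrite lee_fin sqr_ge0.
- by move=> x _; rewrite lee_fin -[g x ^+ 2]real_normK ?num_real// -[h x ^+ 2]real_normK ?num_real// ler_pXn2r ?nnegrE.
Qed.

Lemma window_diff (g : R -> R) (M M' x : R) : M <= M' -> `|window M' g x - window M g x| <= `|outside M g x|.
Proof.
move=> MM'; rewrite /window /outside -mulrBr !normrM ler_wpM2l// !indicE in_setC.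
have [xM|xM] := boolP (x \in (`[- M, M]%classic : set R)).
  rewrite (_ : x \in _ = true) ?subrr ?normr0//; apply/mem_set.
  move/set_mem: xM; rewrite /= !in_itv /= => /andP[h1 h2]; apply/andP; split; lra.
by rewrite subr0 normr1; case: (_ \in _); rewrite ?normr1 ?normr0.
Qed.

(** The Cauchy-Schwarz inequality, with the parameter left free as the square
    integrals may be infinite. *)
Lemma weighted_product_le (a lambda : R) (u v : R -> R) : 0 < a -> 0 < lambda ->
  measurable_fun setT u -> measurable_fun setT v -> L1fun (fun x => psi a x * (u x * v x)) ->
  ((`|\int[mu]_(x in setT) (psi a x * (u x * v x))|)%:E <=
    (lambda / 2)%:E * sqint u + (lambda^-1 / 2)%:E * sqint v)%E.
Proof.
move=> a0 l0 mu_ mv s; have sn : L1fun (fun x => `|psi a x * (u x * v x)|) := integrable_norm s.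
apply: (@le_trans _ _ (\int[mu]_(x in setT) `|psi a x * (u x * v x)|)%:E).
  by rewrite lee_fin; exact: (le_normr_Rintegral measurableT s).
have l1 : 0 <= lambda / 2 by rewrite divr_ge0 ?(ltW l0).
have l2 : 0 <= lambda^-1 / 2 by rewrite divr_ge0 ?invr_ge0 ?(ltW l0).
rewrite (RintegralE measurableT sn) /sqint -!ge0_integralZl_EFin//; last first.
- exact: measurable_sqr.
- by move=> x _; rewrite lee_fin sqr_ge0.
- exact: measurable_sqr.
- by move=> x _; rewrite lee_fin sqr_ge0.
have mU k (w : R -> R) : measurable_fun setT w -> measurable_fun setT (fun x => (k%:E * (w x ^+ 2)%:E)%E).
  by move=> mw; apply: measurable_funeM; exact: measurable_sqr.
rewrite -ge0_integralD//; try exact: mU; try by move=> x _; rewrite -EFinM lee_fin mulr_ge0 ?sqr_ge0.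
apply: ge0_le_integral => //.
- by apply/measurable_EFinP; exact: L1fun_measurable sn.
- by apply: emeasurable_funD; exact: mU.
move=> x _; rewrite -!EFinM -EFinD lee_fin.
have p1 : psi a x <= 1.
  rewrite /psi indicE; case: (boolP (x \in _)) => [/set_mem|_]; last by rewrite mulr0.
  by rewrite /= in_itv /= andbT mulr1 => x0; rewrite expR_le1 oppr_le0 mulr_ge0 ?(ltW a0).
rewrite normrM (ger0_norm (psi_ge0 _ _)); apply: le_trans (_ : `|u x * v x| <= _).
  by rewrite ler_piMl.
rewrite normrM -[u x ^+ 2]real_normK ?num_real// -[v x ^+ 2]real_normK ?num_real//.
have -> : lambda / 2 * `|u x| ^+ 2 + lambda^-1 / 2 * `|v x| ^+ 2 = `|u x| * `|v x| +
   (lambda^-1 / 2) * (lambda * `|u x| - `|v x|) ^+ 2 by field; rewrite gt_eqF.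
by rewrite lerDl mulr_ge0 ?sqr_ge0.
Qed.

Lemma sqint_itv (p q : R) : p < q -> sqint (\1_(`[p, q]%classic) : R -> R) = (q - p)%:E.
Proof.
move=> pq; rewrite /sqint.
have -> : (\int[mu]_x (\1_(`[p, q]%classic) x ^+ 2)%:E = \int[mu]_x (\1_(`[p, q]%classic) x)%:E)%E.
  by apply: eq_integral => x _; rewrite indicE; case: (_ \in _); rewrite ?expr1n ?expr0n.
have -> : (\int[mu]_x (\1_(`[p, q]%classic) x)%:E = mu `[p, q]%classic)%E by rewrite integral_indic// setIT.
by rewrite lebesgue_measure_itv /= lte_fin pq -EFinB.
Qed.

(** The double integral of a window of [g] and the indicator of an interval
    against the Poisson kernel tends to half of the integral of [g], while the
    left-hand side of [poisson_identity] is small uniformly in the weight. *)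
Lemma transform_injective (g : R -> R) (N : nat -> R) : measurable_fun setT g ->
  (sqint g < +oo)%E -> {homo N : m n / (m <= n)%N >-> m <= n} -> (forall n, n%:R <= N n) ->
  (forall k, (sqint (outside (N k) g) <= ((16 ^+ k)^-1)%:E)%E) ->
  (forall c, null [set xi | ~ (transform c (window (N k) g) xi @[k --> \oo] --> (0 : R))]) ->
  null [set x | g x != 0].
Proof.
move=> mg fg Nle Nge tail lim0.
have sw k : L1fun (window (N k) g) by exact: L1fun_itv.
have mo k : measurable_fun setT (outside (N k) g).
  by apply: measurable_funM => //; apply: measurable_indic; exact: measurableC.
have small k c : (sqint (transform c (window (N k) g)) <= ((16 ^+ k)^-1)%:E)%E.
  apply: (@fatou_null _ (fun j x => (transform c (window (N (j + k)%N) g) x - transform c (window (N k) g) x) ^+ 2)).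
  - by move=> j; apply: measurable_funX; apply: measurable_funB; exact: measurable_transform.
  - by move=> j x; exact: sqr_ge0.
  - by apply: measurable_funX; exact: measurable_transform.
  - apply: nullS (lim0 c) => xi /=; apply: contra_not => cv.
    have -> : transform c (window (N k) g) xi ^+ 2 = (0 - transform c (window (N k) g) xi) ^+ 2.
      by rewrite sub0r sqrrN.
    have cv' : (fun j => transform c (window (N (j + k)%N) g) xi) @ \oo --> (0 : R).
      by have := cv; rewrite -(cvg_shiftn k).
    by apply: cvgM; apply: cvgB => //; exact: cvg_cst.
  move=> j; apply: le_trans (tail k).
  have -> : (\int[mu]_x ((transform c (window (N (j + k)%N) g) x - transform c (window (N k) g) x) ^+ 2)%:E =
     sqint (transform c (fun x => (window (N (j + k)%N) g x - window (N k) g x)%R)))%E.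
    by apply: eq_integral => x _; rewrite transformB.
  have sB := L1funB (sw (j + k)%N) (sw k).
  apply: le_trans (plancherel_le c sB) _; apply: sqint_le => //.
    exact: L1fun_measurable sB.
  by move=> x; apply: window_diff; apply: Nle; rewrite leq_addl.
apply: null_of_integrals => // [p q|p q pq]; first exact: L1fun_itv.
pose h : R -> R := \1_(`[p, q]%classic).
have sh : L1fun h := L1fun1 p q.
pose W n x := poisson_prim n.+1%:R^-1 (q - x) - poisson_prim n.+1%:R^-1 (p - x).
have bound k n (lambda : R) : 0 < lambda ->
  `|\int[mu]_(x in setT) (window (N k) g x * W n x)| <= lambda * (16 ^+ k)^-1 + lambda^-1 * (q - p).
  move=> l0; have a0 : 0 < n.+1%:R^-1 :> R by rewrite invr_gt0.
  have -> : \int[mu]_(x in setT) (window (N k) g x * W n x) =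
     \int[mu]_(x in setT) (window (N k) g x * \int[mu]_(y in setT) (h y * poisson n.+1%:R^-1 (x - y))).
    by apply: eq_Rintegral => x _; rewrite integral_poisson_itv.
  rewrite -poisson_identity//.
  have s2 c : L1fun (fun x => psi n.+1%:R^-1 x * (transform c (window (N k) g) x * transform c h x)).
    apply: (@L1funM _ _ _ (norm1 (window (N k) g) * norm1 h)).
    - exact: L1fun_psi.
    - by apply: measurable_funM; exact: measurable_transform.
    - by move=> x; rewrite normrM ler_pM//; exact: transform_le.
  have half c : `|\int[mu]_(x in setT) (psi n.+1%:R^-1 x * (transform c (window (N k) g) x * transform c h x))|
      <= lambda / 2 * (16 ^+ k)^-1 + lambda^-1 / 2 * (q - p).
    rewrite -lee_fin; apply: le_trans (weighted_product_le a0 l0 _ _ (s2 c)) _.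
    - exact: measurable_transform.
    - exact: measurable_transform.
    rewrite EFinD !EFinM; apply: leeD; apply: lee_wpmul2l; rewrite ?lee_fin ?divr_ge0 ?invr_ge0 ?(ltW l0)//.
    by apply: le_trans (plancherel_le c sh) _; rewrite sqint_itv.
  apply: le_trans (ler_normD _ _) _; apply: le_trans (lerD (half true) (half false)) _.
  by rewrite le_eqVlt; apply/orP; left; apply/eqP; field; rewrite gt_eqF//= expf_neq0.
have limW k : (fun n => \int[mu]_(x in setT) (window (N k) g x * W n x)) @ \oo -->
    \int[mu]_(x in setT) (window (N k) g x * (1 / 2 * h x)).
  have := @dominated_convergence _ _ _ mu setT measurableT
    (fun n x => (window (N k) g x * W n x)%:E) (fun x => (window (N k) g x * (1 / 2 * h x))%:E)
    (fun x => `|window (N k) g x|%:E).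
  case.
  - move=> n; apply/measurable_EFinP; apply: measurable_funM; first exact: L1fun_measurable (sw k).
    have a0 : 0 < n.+1%:R^-1 :> R by rewrite invr_gt0.
    apply: measurable_funB; apply: measurable_poisson_prim => //; exact: measurable_funB.
  - apply/measurable_EFinP; apply: measurable_funM; first exact: L1fun_measurable (sw k).
    by apply: measurable_funM => //; exact: L1fun_measurable sh.
  - apply: nullS (null_seq [:: p; q] (fun y => null_set1 y)) => x /=; apply: contra_notP => xpq _.
    have xp : x != p by apply/negP => /eqP e; apply: xpq; exists p; rewrite ?inE ?eqxx.
    have xq : x != q by apply/negP => /eqP e; apply: xpq; exists q; rewrite ?inE ?eqxx ?orbT.
    apply: cvg_EFin; first exact: nearW.
    apply: cvgM; first exact: cvg_cst.
    have -> : 1 / 2 * h x = (if x < q then 1 / 4 else - (1 / 4)) - (if x < p then 1 / 4 else - (1 / 4)).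
      rewrite /h indicE; case: (ltP x q) => xq'; case: (ltP x p) => xp'.
      - have nin : (x \in (`[p, q]%classic : set R)) = false.
          by apply/negbTE/negP => /set_mem; rewrite /= in_itv/= => /andP[]; lra.
        by rewrite nin mulr0 subrr.
      - by rewrite mem_set /= ?in_itv/= ?xp' ?(ltW xq')// mulr1; field.
      - by lra.
      - have nin : (x \in (`[p, q]%classic : set R)) = false.
          by apply/negbTE/negP => /set_mem; rewrite /= in_itv/= => /andP[_ xq2]; move: xq; rewrite eq_le xq2 xq'.
        by rewrite nin mulr0 subrr.
    have cq : (fun n : nat => poisson_prim n.+1%:R^-1 (q - x)) @ \oo -->
        (if x < q then 1 / 4 else - (1 / 4) : R).
      case: ltP => xq'; first by apply: poisson_prim_cvg; rewrite subr_gt0.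
      by apply: poisson_prim_cvgN; rewrite subr_lt0 lt_neqAle eq_sym xq.
    have cp : (fun n : nat => poisson_prim n.+1%:R^-1 (p - x)) @ \oo -->
        (if x < p then 1 / 4 else - (1 / 4) : R).
      case: ltP => xp'; first by apply: poisson_prim_cvg; rewrite subr_gt0.
      by apply: poisson_prim_cvgN; rewrite subr_lt0 lt_neqAle eq_sym xp.
    exact: (cvgB cq cp).
  - exact: (integrable_norm (sw k)).
  - apply: (@nullS _ set0); last exact: null0.
    move=> x /=; apply => n _; rewrite lee_fin normrM ler_piMr//.
    apply: le_trans (ler_normB _ _) _; apply: le_trans (lerD (poisson_prim_le _ _) (poisson_prim_le _ _)) _.
    lra.
  move=> _ _; rewrite -RintegralE//; last first.
    apply: (@L1funM _ _ _ 1 (sw k)).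
    - by apply: measurable_funM => //; exact: L1fun_measurable sh.
    - by move=> x; rewrite /h indicE; case: (_ \in _); rewrite ?mulr0 ?mulr1 ger0_norm//; lra.
  by move=> /fine_cvg.
set I := \int[mu]_(x in setT) _.
have [k0 hk0] : exists k0 : nat, forall k, (k0 <= k)%N -> `|p| <= N k /\ `|q| <= N k.
  exists (maxn (Num.truncn `|p|).+1 (Num.truncn `|q|).+1) => k; rewrite geq_max => /andP[k1 k2].
  by split; apply: le_trans (Nge k); [apply: le_trans (ltW (truncnS_gt `|p|)) _|apply: le_trans (ltW (truncnS_gt `|q|)) _]; rewrite ler_nat.
have main k : (k0 <= k)%N -> `|1 / 2 * I| <= (1 / 2) ^+ k * (1 + (q - p)).
  move=> /hk0[pN qN].
  have e : \int[mu]_(x in setT) (window (N k) g x * (1 / 2 * h x)) = 1 / 2 * I.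
    rewrite /I -RintegralZl//; last exact: L1fun_itv.
    apply: eq_Rintegral => x _; rewrite /window /h !indicE.
    have [xi|xi] := boolP (x \in (`[p, q]%classic : set R)); last by rewrite !mulr0.
    rewrite mem_set ?mulr1 1?mulrC//; move/set_mem: xi; rewrite /= !in_itv/= => /andP[h1 h2].
    by move: pN qN; rewrite !ler_norml => /andP[? ?] /andP[? ?]; apply/andP; split; lra.
  (* The parameter [2 ^ k] makes both terms of [bound] tend to [0]. *)
  have l0 : 0 < 2 ^+ k :> R by rewrite exprn_gt0.
  apply: le_trans (_ : 2 ^+ k * (16 ^+ k)^-1 + (2 ^+ k)^-1 * (q - p) <= _).
    rewrite -e; have cv := cvg_norm (limW k).
    rewrite -(cvg_lim (@Rhausdorff R) (cv _)); apply: limr_le; first by apply: cvgP; exact: cv.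
    by apply: nearW => n; exact: bound.
  have -> : (1 / 2) ^+ k = (2 ^+ k)^-1 :> R by rewrite mul1r exprVn.
  rewrite [leRHS](mulrDr (2 ^- k)) mulr1 lerD2r ler_pdivrMr ?exprn_gt0// ler_pdivlMl// -exprMn.
  by apply: lerXn2r; rewrite ?nnegrE//; lra.
apply/eqP; apply/negPn/negP => I0.
have i0 : 0 < `|1 / 2 * I| by rewrite normr_gt0 mulf_neq0.
have pq0 : 0 < 1 + (q - p) by lra.
have e0 : 0 < `|1 / 2 * I| / (2 * (1 + (q - p))) by rewrite divr_gt0// mulr_gt0.
have z01 : 0 <= (1 / 2 : R) < 1 by apply/andP; split; lra.
have [n hn] := expr_small z01 e0.
have := main (maxn n k0) (leq_maxr _ _); apply/negP; rewrite -ltNge.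
apply: le_lt_trans (_ : (1 / 2) ^+ n * (1 + (q - p)) < _).
  by rewrite ler_wpM2r ?(ltW pq0)// ler_wiXn2l ?leq_maxl//; lra.
apply: le_lt_trans (ler_wpM2r (ltW pq0) hn) _.
have -> : `|1 / 2 * I| / (2 * (1 + (q - p))) * (1 + (q - p)) = `|1 / 2 * I| / 2 by field; rewrite gt_eqF.
by lra.
Qed.

End Injectivity.

(** * The Fourier transform of integrable functions *)

Section ComplexIntegral.
Context {R : realType}.
Local Notation C := R[i].
Local Notation mu := (@lebesgue_measure R).
Implicit Types (F G : R -> C).

Definition L1cfun F := L1fun (fun x => complex.Re (F x)) /\ L1fun (fun x => complex.Im (F x)).

Definition cint F : C :=
  ((\int[mu]_(x in setT) complex.Re (F x)) +i* (\int[mu]_(x in setT) complex.Im (F x)))%C.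

Lemma eqc (x y : C) : complex.Re x = complex.Re y -> complex.Im x = complex.Im y -> x = y.
Proof. by case: x y => [a b] [c d] /= -> ->. Qed.

Lemma L1fun_scale (r : R) (g : R -> R) : L1fun g -> L1fun (fun x => r * g x).
Proof. by move=> sg; exact: (integrableZl measurableT r sg). Qed.

Lemma Re_mul (x y : C) : complex.Re (x * y) = complex.Re x * complex.Re y - complex.Im x * complex.Im y.
Proof. by case: x y => [a b] [c d]. Qed.

Lemma Im_mul (x y : C) : complex.Im (x * y) = complex.Re x * complex.Im y + complex.Im x * complex.Re y.
Proof. by case: x y => [a b] [c d]. Qed.

Lemma Re_add (x y : C) : complex.Re (x + y) = complex.Re x + complex.Re y.
Proof. by case: x y => [a b] [c d]. Qed.

Lemma Im_add (x y : C) : complex.Im (x + y) = complex.Im x + complex.Im y.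
Proof. by case: x y => [a b] [c d]. Qed.

Lemma eq_L1fun (g h : R -> R) : g =1 h -> L1fun g -> L1fun h.
Proof. by move=> /funext ->. Qed.

Lemma L1cfunZ (c : C) F : L1cfun F -> L1cfun (fun x => c * F x).
Proof.
move=> [s1 s2]; split.
  apply: eq_L1fun (L1funB (L1fun_scale (complex.Re c) s1) (L1fun_scale (complex.Im c) s2)) => x.
  by rewrite Re_mul.
apply: eq_L1fun (L1funD (L1fun_scale (complex.Re c) s2) (L1fun_scale (complex.Im c) s1)) => x.
by rewrite Im_mul.
Qed.

Lemma cintZ (c : C) F : L1cfun F -> cint (fun x => c * F x) = c * cint F.
Proof.
move=> [s1 s2]; apply: eqc; rewrite ?Re_mul ?Im_mul /=.
  rewrite -!RintegralZl// -RintegralB//; try exact: L1fun_scale.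
  by apply: eq_Rintegral => x _; rewrite Re_mul.
rewrite -!RintegralZl// -RintegralD//; try exact: L1fun_scale.
by apply: eq_Rintegral => x _; rewrite Im_mul.
Qed.

Lemma L1cfunD F G : L1cfun F -> L1cfun G -> L1cfun (fun x => F x + G x).
Proof.
move=> [s1 s2] [t1 t2]; split.
  by apply: eq_L1fun (L1funD s1 t1) => x; rewrite Re_add.
by apply: eq_L1fun (L1funD s2 t2) => x; rewrite Im_add.
Qed.

Lemma cintD F G : L1cfun F -> L1cfun G -> cint (fun x => F x + G x) = cint F + cint G.
Proof.
move=> [s1 s2] [t1 t2]; apply: eqc; rewrite ?Re_add ?Im_add /= -RintegralD//.
  by apply: eq_Rintegral => x _; rewrite Re_add.
by apply: eq_Rintegral => x _; rewrite Im_add.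
Qed.

Lemma Rint0 : \int[mu]_(x in setT) (0 : R) = 0.
Proof. by rewrite /Rintegral integral0_eq. Qed.

Lemma L1cfun0 : L1cfun (fun _ => 0).
Proof.
have s0 : L1fun (fun _ : R => 0 : R) := integrable0 mu setT.
by split.
Qed.

Lemma cint_sum n (F : 'I_n -> R -> C) : (forall i, L1cfun (F i)) ->
  L1cfun (fun x => \sum_(i < n) F i x) /\ cint (fun x => \sum_(i < n) F i x) = \sum_(i < n) cint (F i).
Proof.
elim: n F => [|n IH] F sF.
  have -> : (fun x => \sum_(i < 0) F i x) = (fun _ => 0) by apply/funext => x; rewrite big_ord0.
  rewrite big_ord0; split; first exact: L1cfun0.
  by apply: eqc => /=; rewrite Rint0.
have [sS eS] := IH (fun i => F (widen_ord (leqnSn n) i)) (fun i => sF _).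
have -> : (fun x => \sum_(i < n.+1) F i x) =
    (fun x => \sum_(i < n) F (widen_ord (leqnSn n) i) x + F ord_max x).
  by apply/funext => x; rewrite big_ord_recr.
split; first exact: L1cfunD.
by rewrite cintD// eS big_ord_recr.
Qed.

Lemma L1fun_shift (x : R) (g : R -> R) : L1fun g -> L1fun (fun t => g (t - x)).
Proof.
move=> /integrableP[mg fg]; apply/integrableP; split.
  by apply: (measurableT_comp mg); exact: measurable_fun_shift.
have := @ge0_integral_shift _ x setT (fun t => `|(g t)%:E|%E) measurableT.
rewrite preimage_setT => -> //.
exact: measurableT_comp.
Qed.

Lemma Rintegral_shift (x : R) (g : R -> R) : measurable_fun setT g ->
  \int[mu]_(t in setT) g (t - x) = \int[mu]_(t in setT) g t.
Proof.
move=> /measurable_EFinP mg; rewrite /Rintegral integralE [in RHS]integralE.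
have sh (h : R -> \bar R) : measurable_fun setT h -> (forall t, 0 <= h t)%E ->
    (\int[mu]_t h (t - x)%R = \int[mu]_t h t)%E.
  by move=> mh h0; have := @ge0_integral_shift _ x setT h measurableT mh h0; rewrite preimage_setT.
congr (fine (_ - _)%E).
  by rewrite -(sh _ (measurable_funepos mg))//; apply: eq_integral => t _; rewrite !funeposE.
by rewrite -(sh _ (measurable_funeneg mg))//; apply: eq_integral => t _; rewrite !funenegE.
Qed.

Lemma cint_shift (x : R) F : L1cfun F -> cint (fun t => F (t - x)) = cint F.
Proof.
move=> [s1 s2]; apply: eqc => /=.
  by rewrite (@Rintegral_shift x (fun t => complex.Re (F t)))//; exact: L1fun_measurable s1.
by rewrite (@Rintegral_shift x (fun t => complex.Im (F t)))//; exact: L1fun_measurable s2.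
Qed.

Lemma L1fun_mulcexp F (xi : R) : L1cfun F -> L1cfun (fun x => F x * cexp (- (x * xi))).
Proof.
move=> [s1 s2]; split.
  apply: eq_L1fun (L1funD (L1fun_trig true xi s1) (L1fun_trig false xi s2)) => x.
  by rewrite Re_mul /= /trig !mulrN cosN sinN mulrN opprK.
apply: eq_L1fun (L1funB (L1fun_trig true xi s2) (L1fun_trig false xi s1)) => x.
by rewrite Im_mul /= /trig !mulrN cosN sinN mulrN addrC.
Qed.

Definition fourier F (xi : R) : C := cint (fun x => F x * cexp (- (x * xi))).

Lemma fourierE F (xi : R) : L1cfun F -> fourier F xi =
  ((transform true (fun x => complex.Re (F x)) xi + transform false (fun x => complex.Im (F x)) xi) +i*
   (transform true (fun x => complex.Im (F x)) xi - transform false (fun x => complex.Re (F x)) xi))%C.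
Proof.
move=> [s1 s2]; apply: eqc => /=.
  rewrite /transform -RintegralD//; try exact: L1fun_trig.
  by apply: eq_Rintegral => x _; rewrite Re_mul /= /trig !mulrN cosN sinN mulrN opprK.
rewrite /transform -RintegralB//; try exact: L1fun_trig.
by apply: eq_Rintegral => x _; rewrite Im_mul /= /trig !mulrN cosN sinN mulrN addrC.
Qed.

Lemma tfshift_cexp (z : R * R) F (xi : R) t : tfshift z F t * cexp (- (t * xi)) =
  cexp (- (z.1 * (xi + z.2))) * (F (t - z.1) * cexp (- ((t - z.1) * (xi + z.2)))).
Proof.
rewrite tfshiftE mulrAC -cexpD mulrCA -cexpD mulrC; congr (_ * cexp _).
by ring.
Qed.

Lemma L1cfun_tfshift z F : L1cfun F -> L1cfun (tfshift z F).
Proof.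
move=> [s1 s2]; have sS : L1cfun (fun t => F (t - z.1)).
  split; first exact: (L1fun_shift z.1 s1).
  exact: (L1fun_shift z.1 s2).
have [t1 t2] := L1fun_mulcexp z.2 sS.
have e t : tfshift z F t = F (t - z.1) * cexp (- (t * z.2)).
  by rewrite tfshiftE mulrC [z.2 * t]mulrC.
split; first by apply: eq_L1fun t1 => t; rewrite e.
by apply: eq_L1fun t2 => t; rewrite e.
Qed.

Lemma fourier_tfshift z F (xi : R) : L1cfun F ->
  fourier (tfshift z F) xi = cexp (- (z.1 * (xi + z.2))) * fourier F (xi + z.2).
Proof.
move=> sF; have sF' := L1fun_mulcexp (xi + z.2) sF.
rewrite /fourier -(cint_shift z.1 sF') -cintZ.
  by congr cint; apply/funext => t; exact: tfshift_cexp.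
case: sF' => s1 s2; split; first exact: (L1fun_shift z.1 s1).
exact: (L1fun_shift z.1 s2).
Qed.

Lemma L1fun_null (g h : R -> R) : L1fun g -> measurable_fun setT h -> null [set x | g x != h x] ->
  \int[mu]_(x in setT) g x = \int[mu]_(x in setT) h x.
Proof.
move=> sg mh gh; rewrite /Rintegral; congr fine; apply: ae_eq_integral => //.
- by apply/measurable_EFinP; exact: L1fun_measurable sg.
- exact/measurable_EFinP.
apply: nullS gh => x /=; apply: contra_not_neq => -> _.
by [].
Qed.

Lemma fourier_null F xi : L1cfun F -> null [set x | F x != 0] -> fourier F xi = 0.
Proof.
move=> sF nF; have [s1 s2] := L1fun_mulcexp xi sF.
have m0 : measurable_fun setT (fun _ : R => 0 : R) by exact: measurable_cst.
apply: eqc => /=; rewrite -[RHS]Rint0; apply: L1fun_null => //; apply: nullS nF => x /=;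
  by apply: contraNneq => ->; rewrite mul0r.
Qed.

Lemma fourierB F G xi : L1cfun F -> L1cfun G ->
  fourier (fun x => F x - G x) xi = fourier F xi - fourier G xi.
Proof.
move=> sF sG; have sF' := L1fun_mulcexp xi sF; have sG' := L1fun_mulcexp xi sG.
rewrite /fourier -[- cint _]mulN1r -cintZ// -cintD//; last exact: L1cfunZ.
by congr cint; apply/funext => x; rewrite mulN1r mulrBl.
Qed.

Lemma fourier_relation n (c : 'I_n -> C) (z : 'I_n -> R * R) (F : 'I_n -> R -> C) xi :
  (forall i, L1cfun (F i)) ->
  null [set t | \sum_(i < n) c i * tfshift (z i) (F i) t != 0] ->
  \sum_(i < n) c i * (cexp (- ((z i).1 * (xi + (z i).2))) * fourier (F i) (xi + (z i).2)) = 0.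
Proof.
move=> sF nF.
have sT i : L1cfun (fun t => c i * tfshift (z i) (F i) t) by apply/L1cfunZ/L1cfun_tfshift.
have [sS _] := cint_sum sT.
apply: etrans (fourier_null xi sS nF); rewrite /fourier.
have sM i : L1cfun (fun t => c i * (tfshift (z i) (F i) t * cexp (- (t * xi)))).
  by apply/L1cfunZ/L1fun_mulcexp/L1cfun_tfshift.
have [_ eS] := cint_sum sM.
transitivity (cint (fun t => \sum_(i < n) c i * (tfshift (z i) (F i) t * cexp (- (t * xi))))).
  rewrite eS; apply: eq_bigr => i _; rewrite cintZ ?L1fun_mulcexp ?L1cfun_tfshift//.
    by congr (_ * _); exact: esym (fourier_tfshift (z i) xi (sF i)).
  by apply/L1fun_mulcexp/L1cfun_tfshift.
by congr cint; apply/funext => t; rewrite mulr_suml; apply: eq_bigr => i _; rewrite mulrA.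
Qed.

End ComplexIntegral.

(** * Transforms of square-integrable functions *)

Section Tails.
Context {R : realType}.
Local Notation C := R[i].
Local Notation mu := (@lebesgue_measure R).

Lemma tail_small (g : R -> R) (e : R) : measurable_fun setT g -> (sqint g < +oo)%E -> 0 < e ->
  exists M : nat, (sqint (outside M%:R g) <= e%:E)%E.
Proof.
move=> mg fg e0.
have mo n : measurable_fun setT (outside n%:R g).
  by apply: measurable_funM => //; apply: measurable_indic; exact: measurableC.
have := @dominated_convergence _ _ _ mu setT measurableT
  (fun n x => (outside n%:R g x ^+ 2)%:E) (fun _ => 0%E) (fun x => (g x ^+ 2)%:E).
case.
- by move=> n; exact: measurable_sqr.
- exact: measurable_cst.
- apply: (@nullS _ set0); last exact: null0.
  move=> x /=; apply => _; apply: cvg_near_cst.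
  exists (Num.truncn `|x|).+1 => // n /= xn; rewrite /outside indicE in_setC mem_set ?mulr0 ?expr0n//=.
  rewrite in_itv/= -ler_norml; apply: le_trans (ltW (truncnS_gt `|x|)) _.
  by rewrite ler_nat.
- apply/integrableP; split; first exact: measurable_sqr.
  by under eq_integral => x _ do rewrite gee0_abs ?lee_fin ?sqr_ge0//.
- apply: (@nullS _ set0); last exact: null0.
  move=> x /=; apply => n _; rewrite lee_fin ger0_norm ?sqr_ge0// /outside exprMn ler_piMr ?sqr_ge0//.
move=> _ _; set I0 := (X in _ --> X).
have -> : I0 = 0%E by rewrite /I0; exact: integral0_eq.
move=> /fine_cvg /cvgrPdist_le /(_ e e0) [M _ hM]; exists M.
have := hM M (leqnn _); rewrite /= sub0r normrN => hM'.
have fM : (sqint (outside M%:R g)) \is a fin_num.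
  rewrite ge0_fin_numE; last by apply: integral_ge0 => x _; rewrite lee_fin sqr_ge0.
  apply: le_lt_trans fg; apply: sqint_le => // x.
  by rewrite /outside normrM ler_piMr// indicE; case: (_ \in _); rewrite ?normr1 ?normr0.
by rewrite -(fineK fM) lee_fin; apply: le_trans hM'; exact: ler_norm.
Qed.

(** The series of the [4 ^ k * v k ^ 2] has a finite integral, so its sum is
    finite almost everywhere. *)
Lemma ae_geometric (v : nat -> R -> R) : (forall k, measurable_fun setT (v k)) ->
  (forall k, (sqint (v k) <= ((16 ^+ k)^-1)%:E)%E) ->
  null [set x | ~ exists2 M : R, 0 <= M & forall k, `|v k x| <= M * (2 ^+ k)^-1].
Proof.
move=> mv hv.
have m4 k : measurable_fun setT (fun x => (4 ^+ k * v k x ^+ 2)%:E).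
  apply/measurable_EFinP; apply: measurable_funM; first exact: measurable_cst.
  exact: measurable_funX.
have p4 k x : (0 <= (4 ^+ k * v k x ^+ 2)%:E)%E by rewrite lee_fin mulr_ge0 ?sqr_ge0 ?exprn_ge0.
have fin : (\int[mu]_x (\sum_(k <oo) (4 ^+ k * v k x ^+ 2)%:E) < +oo)%E.
  rewrite integral_nneseries//.
  apply: (@le_lt_trans _ _ ((1 - 4^-1)^-1)%:E); last exact: ltry.
  apply: lime_le; first by apply: is_cvg_nneseries => k _ _; exact: integral_ge0.
  apply: nearW => n; apply: (@le_trans _ _ (\sum_(0 <= k < n) ((4^-1) ^+ k)%:E)%E).
    apply: lee_sum => k _; under eq_integral => x _ do rewrite EFinM.
    rewrite ge0_integralZl_EFin ?exprn_ge0//.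
    - apply: le_trans (lee_wpmul2l _ (hv k)) _; first by rewrite lee_fin exprn_ge0.
      have -> : 16 = 4 * 4 :> R by ring.
      rewrite -EFinM lee_fin exprMn invfM mulrA divff ?expf_neq0//.
      by rewrite mul1r exprVn.
    - by move=> x _; rewrite lee_fin sqr_ge0.
    - exact: measurable_sqr.
  rewrite sumEFin lee_fin big_mkord; apply: sum_expr_le.
  by apply/andP; split; lra.
have mS : measurable_fun setT (fun x => \sum_(k <oo) (4 ^+ k * v k x ^+ 2)%:E)%E.
  exact: (@ge0_emeasurable_sum _ _ R setT (fun k x => (4 ^+ k * v k x ^+ 2)%:E) xpredT
    (fun k x _ _ => p4 k x) (fun k _ => m4 k)).
have iS : mu.-integrable setT (fun x => \sum_(k <oo) (4 ^+ k * v k x ^+ 2)%:E)%E.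
  apply/integrableP; split=> //; apply: le_lt_trans fin; rewrite le_eqVlt; apply/orP; left; apply/eqP.
  by apply: eq_integral => x _; rewrite gee0_abs//; apply: nneseries_ge0.
have := @integrable_ae _ _ _ mu setT measurableT _ iS; apply: negligibleS => x /= bx /(_ I) fx.
apply: bx; set S := (\sum_(k <oo) _)%E in fx.
have S0 : (0 <= S)%E by apply: nneseries_ge0.
have s0 : 0 <= fine S by exact: fine_ge0.
exists (fine S + 1); first by rewrite addr_ge0.
move=> k; rewrite -ler_sqr ?nnegrE ?mulr_ge0 ?addr_ge0 ?invr_ge0 ?exprn_ge0//.
rewrite exprMn -exprVn -exprM mulnC exprM real_normK ?num_real//.
have le : 4 ^+ k * v k x ^+ 2 <= fine S.
  rewrite -lee_fin (fineK fx).
  apply: le_trans (nneseries_lim_ge k.+1 (fun n _ _ => p4 n x)).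
  rewrite big_nat_recr//=; apply: leeDr; apply: sume_ge0 => i _; exact: p4.
have -> : (2^-1) ^+ 2 = 4^-1 :> R by rewrite exprVn expr2 -natrM.
rewrite exprVn ler_pdivlMr ?exprn_gt0// mulrC; apply: le_trans le _.
by nra.
Qed.

Lemma outside_le (g h : R -> R) (M M' x : R) : M <= M' -> (forall y, `|g y| <= `|h y|) ->
  `|outside M' g x| <= `|outside M h x|.
Proof.
move=> MM' gh; rewrite /outside !normrM; apply: ler_pM => //; rewrite !indicE !in_setC.
have [xM|xM] := boolP (x \in (`[- M, M]%classic : set R)); last by rewrite normr1; case: (_ \in _); rewrite ?normr1 ?normr0.
rewrite (_ : x \in _ = true) ?normr0//; apply/mem_set.
by move/set_mem: xM; rewrite /= !in_itv /= => /andP[h1 h2]; apply/andP; split; lra.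
Qed.

Lemma measurable_outside (M : R) (g : R -> R) : measurable_fun setT g -> measurable_fun setT (outside M g).
Proof. by move=> mg; apply: measurable_funM => //; apply: measurable_indic; exact: measurableC. Qed.

(** The ratio [1 / 16] leaves room for the factor [4 ^ k] of [ae_geometric]. *)
Lemma tail_sequence (g : R -> R) : measurable_fun setT g -> (sqint g < +oo)%E ->
  exists N : nat -> R, [/\ {homo N : m n / (m <= n)%N >-> m <= n}, forall n, n%:R <= N n &
    forall k, (sqint (outside (N k) g) <= ((16 ^+ k)^-1)%:E)%E].
Proof.
move=> mg fg.
have p k : 0 < (16 ^+ k)^-1 :> R by rewrite invr_gt0 exprn_gt0.
pose M k := sval (cid (tail_small mg fg (p k))).
have hM k : (sqint (outside (M k)%:R g) <= ((16 ^+ k)^-1)%:E)%E by rewrite /M; case: cid.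
exists (fun k => (\sum_(i < k.+1) (M i).+1)%:R); split.
- move=> m n mn; rewrite ler_nat -!(big_mkord xpredT (fun i => (M i).+1)).
  by rewrite [leqRHS](@big_cat_nat _ _ _ m.+1)//= leq_addr.
- move=> n; rewrite ler_nat; apply: leq_trans (leqnSn n) _.
  rewrite -[X in (X <= _)%N]card_ord -sum1_card; apply: leq_sum => i _; exact: ltn0Sn.
move=> k; apply: le_trans (hM k); apply: sqint_le; try exact: measurable_outside.
move=> x; apply: outside_le => //; rewrite ler_nat big_ord_recr /=.
by apply: leq_trans (leq_addl _ _).
Qed.

(** The limit superior makes the limit total and measurable. *)
Definition tlim (u : nat -> R -> R) (x : R) : R := fine (limn_esup (fun k => (u k x)%:E)).

Lemma tlimE u x l : u k x @[k --> \oo] --> (l : R) -> tlim u x = l.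
Proof.
move=> cv; have cv' : (u k x)%:E @[k --> \oo] --> l%:E by apply: cvg_EFin => //; exact: nearW.
by rewrite /tlim (cvg_limn_einf_sup cv').2.
Qed.

Lemma measurable_tlim u : (forall k, measurable_fun setT (u k)) -> measurable_fun setT (tlim u).
Proof.
move=> mu_; apply: (measurableT_comp (@fine_measurable R _ measurableT)) => //.
by apply: measurable_fun_limn_esup => k; apply/measurable_EFinP.
Qed.

Lemma geometric_cvg (u : nat -> R) (M : R) : 0 <= M -> (forall k, `|u k.+1 - u k| <= M * (2 ^+ k)^-1) ->
  cvgn u.
Proof.
move=> M0 hu; pose v k := u k.+1 - u k.
have cv : cvgn (series v).
  apply: normed_cvg; apply: (@series_le_cvg _ _ (geometric M 2^-1)).
  - by move=> n /=.
  - by move=> n; rewrite /geometric /= mulr_ge0// exprn_ge0// invr_ge0.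
  - by move=> n; rewrite /geometric /= exprVn; exact: hu.
  - by apply: is_cvg_geometric_series; rewrite ger0_norm ?invr_ge0//; lra.
have -> : u = (fun n => u 0 + series v n).
  by apply/funext => n; rewrite /series /= telescope_sumr// addrC subrK.
by apply: is_cvgD => //; exact: is_cvg_cst.
Qed.

Section Limits.
Variables (g : R -> R) (N : nat -> R) (c : bool).
Hypotheses (mg : measurable_fun setT g) (fg : (sqint g < +oo)%E).
Hypotheses (Nle : {homo N : m n / (m <= n)%N >-> m <= n}).
Hypotheses (tail : forall k, (sqint (outside (N k) g) <= ((16 ^+ k)^-1)%:E)%E).

(** The transform of a function that need not be integrable: the limit, almost
    everywhere, along truncations with geometrically small tails. *)
Definition ltrans : R -> R := tlim (fun k => transform c (window (N k) g)).

Lemma L1fun_window k : L1fun (window (N k) g).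
Proof. exact: L1fun_itv. Qed.

Lemma measurable_ltrans : measurable_fun setT ltrans.
Proof. by apply: measurable_tlim => k; apply: measurable_transform; exact: L1fun_window. Qed.

Lemma ltrans_cvg : null [set x | ~ (transform c (window (N k) g) x @[k --> \oo] --> ltrans x)].
Proof.
pose v k x := transform c (window (N k.+1) g) x - transform c (window (N k) g) x.
have sB k := L1funB (L1fun_window k.+1) (L1fun_window k).
have vE k x : v k x = transform c (fun x => window (N k.+1) g x - window (N k) g x) x.
  by rewrite transformB//; exact: L1fun_window.
have mv k : measurable_fun setT (v k).
  by apply: measurable_funB; apply: measurable_transform; exact: L1fun_window.
have sv k : (sqint (v k) <= ((16 ^+ k)^-1)%:E)%E.
  apply: le_trans (tail k).
  have -> : v k = transform c (fun x => window (N k.+1) g x - window (N k) g x).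
    by apply/funext => x; exact: vE.
  apply: le_trans (plancherel_le c (sB k)) _; apply: sqint_le.
  - exact: L1fun_measurable (sB k).
  - exact: measurable_outside.
  by move=> x; apply: window_diff; apply: Nle.
apply: nullS (ae_geometric mv sv) => x /=; apply: contra_not => -[M M0 hM].
have cv := @geometric_cvg (fun k => transform c (window (N k) g) x) M M0 hM.
by rewrite /ltrans (tlimE cv).
Qed.

Lemma sqint_ltrans : (sqint ltrans <= sqint g)%E.
Proof.
apply: (@fatou_null _ (fun k x => transform c (window (N k) g) x ^+ 2)).
- by move=> k; apply: measurable_funX; apply: measurable_transform; exact: L1fun_window.
- by move=> k x; exact: sqr_ge0.
- by apply: measurable_funX; exact: measurable_ltrans.
- by apply: nullS ltrans_cvg => x /=; apply: contra_not => cv; apply: cvgM.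
move=> k; apply: le_trans (plancherel_le c (L1fun_window k)) _; apply: sqint_le => //.
  exact: L1fun_measurable (L1fun_window k).
by move=> x; rewrite /window normrM ler_piMr// indicE; case: (_ \in _); rewrite ?normr1 ?normr0.
Qed.

End Limits.

Lemma transformN c g (xi : R) : L1fun g -> transform c g (- xi) = (if c then 1 else -1) * transform c g xi.
Proof.
move=> sg; rewrite /transform; case: c.
  by rewrite mul1r; apply: eq_Rintegral => x _; rewrite /trig !mulrN cosN.
rewrite -RintegralZl//; last exact: L1fun_trig.
by apply: eq_Rintegral => x _; rewrite /trig !mulrN sinN mulN1r mulrN.
Qed.

End Tails.

(** * Relations between Fourier transforms *)

Section FourierTransport.
Context {R : realType}.
Local Notation C := R[i].
Local Notation mu := (@lebesgue_measure R).

Definition ccvg (u : nat -> C) (l : C) :=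
  (complex.Re (u k) @[k --> \oo] --> complex.Re l) /\
  (complex.Im (u k) @[k --> \oo] --> complex.Im l).

Lemma ccvgD u v l m : ccvg u l -> ccvg v m -> ccvg (fun k => u k + v k) (l + m).
Proof.
move=> [u1 u2] [v1 v2]; split.
  rewrite Re_add; have -> : (fun k => complex.Re (u k + v k)) = (fun k => complex.Re (u k) + complex.Re (v k)).
    by apply/funext => k; rewrite Re_add.
  exact: cvgD.
rewrite Im_add; have -> : (fun k => complex.Im (u k + v k)) = (fun k => complex.Im (u k) + complex.Im (v k)).
  by apply/funext => k; rewrite Im_add.
exact: cvgD.
Qed.

Lemma ccvgZ (c : C) u l : ccvg u l -> ccvg (fun k => c * u k) (c * l).
Proof.
move=> [u1 u2]; split.
  rewrite Re_mul; have -> : (fun k => complex.Re (c * u k)) =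
      (fun k => complex.Re c * complex.Re (u k) - complex.Im c * complex.Im (u k)).
    by apply/funext => k; rewrite Re_mul.
  by apply: cvgB; apply: cvgM => //; exact: cvg_cst.
rewrite Im_mul; have -> : (fun k => complex.Im (c * u k)) =
    (fun k => complex.Re c * complex.Im (u k) + complex.Im c * complex.Re (u k)).
  by apply/funext => k; rewrite Im_mul.
by apply: cvgD; apply: cvgM => //; exact: cvg_cst.
Qed.

Lemma ccvg_cst (c : C) : ccvg (fun _ => c) c.
Proof. by split; exact: cvg_cst. Qed.

Lemma ccvg_sum (I : Type) (r : seq I) (u : I -> nat -> C) (l : I -> C) :
  (forall i, ccvg (u i) (l i)) -> ccvg (fun k => \sum_(i <- r) u i k) (\sum_(i <- r) l i).
Proof.
move=> ul; elim: r => [|i r IH].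
  rewrite big_nil (_ : (fun k => \sum_(i <- [::]) u i k) = (fun _ => 0)); first exact: ccvg_cst.
  by apply/funext => k; rewrite big_nil.
rewrite big_cons (_ : (fun k => \sum_(i <- i :: r) u i k) = (fun k => u i k + \sum_(i <- r) u i k)).
  exact: ccvgD.
by apply/funext => k; rewrite big_cons.
Qed.

Lemma ccvg_unique u l m : ccvg u l -> ccvg u m -> l = m.
Proof.
by move=> [u1 u2] [v1 v2]; apply: eqc; [exact: (cvg_unique (@Rhausdorff R) u1 v1)|
  exact: (cvg_unique (@Rhausdorff R) u2 v2)].
Qed.

Lemma geometric_cvg0 (u : nat -> R) (M : R) : (forall k, `|u k| <= M * (2 ^+ k)^-1) ->
  u k @[k --> \oo] --> (0 : R).
Proof.
move=> hu; apply: (@squeeze_cvgr _ _ _ _ (fun k => - (M * (2^-1) ^+ k)) (fun k => M * (2^-1) ^+ k)).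
- by apply: nearW => k; rewrite -ler_norml exprVn.
- rewrite -oppr0; apply: cvgN; rewrite -(mulr0 M); apply: cvgM; first exact: cvg_cst.
  by apply: cvg_expr; rewrite ger0_norm ?invr_ge0//; lra.
- rewrite -(mulr0 M); apply: cvgM; first exact: cvg_cst.
  by apply: cvg_expr; rewrite ger0_norm ?invr_ge0//; lra.
Qed.

Definition part (b : bool) (F : R -> C) (x : R) : R := if b then complex.Re (F x) else complex.Im (F x).

Lemma part_le b F x : `|part b F x| <= nrm (F x).
Proof. by case: b; [exact: le_Re_nrm|exact: le_Im_nrm]. Qed.

Lemma L1cfun_part F : (forall b, L1fun (part b F)) -> L1cfun F.
Proof. by move=> s; split; [exact: (s true)|exact: (s false)]. Qed.

Lemma ccvg_fourier (F : nat -> R -> C) (l : bool -> bool -> R) (xi : R) : (forall k, L1cfun (F k)) ->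
  (forall c b, transform c (part b (F k)) xi @[k --> \oo] --> l c b) ->
  ccvg (fun k => fourier (F k) xi) ((l true true + l false false) +i* (l true false - l false true))%C.
Proof.
move=> sF hl; split=> /=.
  have -> : (fun k => complex.Re (fourier (F k) xi)) =
      (fun k => transform true (part true (F k)) xi + transform false (part false (F k)) xi).
    by apply/funext => k; rewrite fourierE.
  by apply: cvgD; exact: hl.
have -> : (fun k => complex.Im (fourier (F k) xi)) =
    (fun k => transform true (part false (F k)) xi - transform false (part true (F k)) xi).
  by apply/funext => k; rewrite fourierE.
by apply: cvgB; exact: hl.
Qed.

Lemma parity_vanish (a b d e : R) : a + b = 0 -> d - e = 0 -> a + - b = 0 -> d - - e = 0 ->
  [/\ a = 0, b = 0, d = 0 & e = 0].
Proof. by move=> h1 h2 h3 h4; split; lra. Qed.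

(** The relation holds for truncations of [f] up to their edges, which contribute
    geometrically small terms, so it passes to the limit of their Fourier
    transforms. If this limit vanished, then so would, by parity, the four limits
    of the cosine and sine transforms of the real and imaginary parts, against
    [transform_injective]. *)
Theorem fourier_transport n (c : 'I_n -> C) (z : 'I_n -> R * R) (f : R -> C) : L2fun f ->
  ~ null [set t | f t != 0] ->
  null [set t | \sum_(i < n) c i * tfshift (z i) f t != 0] ->
  exists g, [/\ L2fun g, ~ null [set t | g t != 0] &
    null [set t | \sum_(i < n) (c i * cexp (- ((z i).1 * (z i).2))) *
      tfshift (- (z i).2, (z i).1) g t != 0]].
Proof.
move=> [m1 m2 fin] nf nrel.
pose q t := nrm (f t).
have mp b : measurable_fun setT (part b f) by case: b.
have mq : measurable_fun setT q.
  have := measurable_funD (measurable_funX 2 m1) (measurable_funX 2 m2) => m.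
  have -> : q = (fun x => Num.sqrt (complex.Re (f x) ^+ 2 + complex.Im (f x) ^+ 2)).
    by apply/funext => x; rewrite /q nrmE.
  by apply: (measurableT_comp _ m); apply: continuous_measurable_fun; exact: sqrt_continuous.
have fp b : (sqint (part b f) < +oo)%E.
  apply: le_lt_trans fin; apply: sqint_le => // x.
  by rewrite (ger0_norm (nrm_ge0 _)) part_le.
have [N0 [N0le N0ge tail0]] := tail_sequence mq fin.
pose L := \sum_(i < n) `|(z i).1|.
have L0 : 0 <= L by apply: sumr_ge0.
have zL i : `|(z i).1| <= L by rewrite /L (bigD1 i)//= lerDl sumr_ge0.
(* With this margin the truncations of [f] and of its translates differ only where
   the tails of [f] are small. *)
pose N k := N0 k + L.
have Nle : {homo N : m n / (m <= n)%N >-> m <= n} by move=> j k jk; rewrite lerD2r N0le.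
have Nge k : k%:R <= N k by apply: le_trans (N0ge k) _; rewrite lerDl.
have tail b k : (sqint (outside (N k) (part b f)) <= ((16 ^+ k)^-1)%:E)%E.
  apply: le_trans (tail0 k); apply: sqint_le; try exact: measurable_outside.
  move=> x; apply: outside_le; first by rewrite lerDl.
  by move=> y; rewrite (ger0_norm (nrm_ge0 _)) part_le.
pose l c b := ltrans (part b f) N c.
have ml c' b : measurable_fun setT (l c' b) by exact: measurable_ltrans.
have cvl c' b := ltrans_cvg c' (mp b) (fp b) Nle (tail b).
pose g xi : C := ((l true true xi + l false false xi) +i* (l true false xi - l false true xi))%C.
pose bad := [set xi | ~ forall c b, transform c (window (N k) (part b f)) xi @[k --> \oo] --> l c b xi].
have nbad : null bad.
  apply: nullS (null_bigcup (fun cb : bool * bool => cvl cb.1 cb.2)) => xi /=.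
  by move=> /existsNP[c' /existsNP[b h]]; exists (c', b).
have sw b k : L1fun (window (N k) (part b f)) by exact: L1fun_itv.
exists g; split.
- split.
  + by apply: measurable_funD; exact: ml.
  + by apply: measurable_funB; exact: ml.
  have s2 c' b : L1fun (fun x => l c' b x ^+ 2).
    apply/integrableP; split; first by apply/measurable_EFinP; apply: measurable_funX; exact: ml.
    under eq_integral => x _ do rewrite /= ger0_norm ?sqr_ge0//.
    exact: le_lt_trans (sqint_ltrans c' (mp b) (fp b) Nle (tail b)) (fp b).
  have := L1fun_scale 2 (L1funD (L1funD (s2 true true) (s2 false false)) (L1funD (s2 true false) (s2 false true))).
  move=> /integrableP[mS]; apply: le_lt_trans; apply: ge0_le_integral => //.
  + by move=> x _; rewrite lee_fin sqr_ge0.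
  + apply/measurable_EFinP.
    have -> : (fun x => nrm (g x) ^+ 2) = (fun x => (l true true x + l false false x) ^+ 2 +
        (l true false x - l false true x) ^+ 2) by apply/funext => x; rewrite sqr_nrm.
    by apply: measurable_funD; apply: measurable_funX; [apply: measurable_funD; exact: ml|apply: measurable_funB; exact: ml].
  + by apply: measurableT_comp.
  move=> x _; rewrite [X in (_ <= X)%E]/= lee_fin; apply: le_trans (ler_norm _).
  rewrite sqr_nrm /=; set a := l _ _ x; set b := l _ _ x; set d := l _ _ x; set e := l _ _ x.
  by have := sqr_ge0 (a - b); have := sqr_ge0 (d + e); nra.
- move=> ng; apply: nf.
  have lim0 c' b : null [set xi | ~ (transform c' (window (N k) (part b f)) xi @[k --> \oo] --> (0 : R))].
    apply: nullS (nullU (nullU nbad (null_opp nbad)) (nullU ng (null_opp ng))) => xi /= nc.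
    apply: contrapT => /not_orP[/not_orP[/contrapT h1 /contrapT h2] /not_orP[h3 h4]].
    have g1 : g xi = 0 by apply: contrapT => h; apply: h3; exact/eqP.
    have g2 : g (- xi) = 0 by apply: contrapT => h; apply: h4; exact/eqP.
    apply: nc.
    have lN c1 b1 : l c1 b1 (- xi) = (if c1 then 1 else -1) * l c1 b1 xi.
      apply: tlimE; have -> : (fun k => transform c1 (window (N k) (part b1 f)) (- xi)) =
        (fun k => (if c1 then 1 else -1) * transform c1 (window (N k) (part b1 f)) xi).
        by apply/funext => k; rewrite transformN.
      by apply: cvgM; [exact: cvg_cst|exact: h1].
    suff -> : (0 : R) = l c' b xi by exact: h1.
    have e1 : l true true xi + l false false xi = 0 := congr1 (@complex.Re R) g1.
    have e2 : l true false xi - l false true xi = 0 := congr1 (@complex.Im R) g1.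
    have e3 : l true true (- xi) + l false false (- xi) = 0 := congr1 (@complex.Re R) g2.
    have e4 : l true false (- xi) - l false true (- xi) = 0 := congr1 (@complex.Im R) g2.
    rewrite !lN !mul1r !mulN1r in e3 e4.
    by case: (parity_vanish e1 e2 e3 e4) => z1 z2 z3 z4; case: c'; case: b; rewrite ?z1 ?z2 ?z3 ?z4.
  have nz b : null [set x | part b f x != 0].
    exact: (transform_injective (mp b) (fp b) Nle Nge (tail b) (fun c' => lim0 c' b)).
  apply: nullS (nullU (nz true) (nz false)) => x /= fx.
  apply: contrapT => /not_orP[h1 h2].
  move/eqP: fx; apply; apply: eqc; apply: contrapT => h.
    by apply: h1; exact/eqP.
  by apply: h2; exact/eqP.
pose W k x : C := if `|x| <= N k then f x else 0.
(* The truncation of [f] whose shift by [z i] is supported in the window. *)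
pose F k i x : C := if `|x + (z i).1| <= N k then f x else 0.
have WE b k : part b (W k) = window (N k) (part b f).
  apply/funext => x; rewrite /part /W /window indicE.
  have -> : (x \in (`[- N k, N k]%classic : set R)) = (`|x| <= N k).
    by apply/idP/idP => [/set_mem|h]; [rewrite /= in_itv/= -ler_norml|apply/mem_set; rewrite /= in_itv/= -ler_norml].
  by case: (_ <= _); case: b; rewrite ?mulr1 ?mulr0.
have sW k : L1cfun (W k) by apply: L1cfun_part => b; rewrite WE.
have sF k i : L1cfun (F k i).
  apply: L1cfun_part => b.
  apply: eq_L1fun (L1fun_itv (- N k - (z i).1) (N k - (z i).1) (mp b) (fp b)) => x.
  rewrite /part /F indicE.
  have -> : (x \in (`[- N k - (z i).1, N k - (z i).1]%classic : set R)) = (`|x + (z i).1| <= N k).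
    apply/idP/idP => [/set_mem|]; rewrite /= ?in_itv/= ler_norml => /andP[a1 a2].
      by apply/andP; split; lra.
    by apply/mem_set; rewrite /= in_itv/=; apply/andP; split; lra.
  by case: (_ <= _); case: b; rewrite ?mulr1 ?mulr0.
pose D k i x := F k i x - W k x.
have sD k i : L1cfun (D k i).
  have -> : D k i = (fun x => F k i x + -1 * W k x) by apply/funext => x; rewrite mulN1r.
  by apply: L1cfunD => //; exact: L1cfunZ.
have sDp k i b : L1fun (part b (D k i)) by have [? ?] := sD k i; case: b.
have Dle k i b x : `|part b (D k i) x| <= `|outside (N0 k) q x|.
  rewrite /outside indicE in_setC normrM.
  have [xN|xN] := boolP (x \in (`[- N0 k, N0 k]%classic : set R)).
    move/set_mem: xN; rewrite /= in_itv/= -ler_norml => xN.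
    have D0 : D k i x = 0.
      rewrite /D /F /W !ifT ?subrr//; first by apply: le_trans xN _; rewrite lerDl.
      by apply: le_trans (ler_normD _ _) _; apply: lerD.
    by rewrite /part D0 /=; case: b; rewrite normr0 mulr0.
  rewrite normr1 mulr1 (ger0_norm (nrm_ge0 _)); apply: le_trans (part_le _ _ _) _.
  rewrite /D /F /W /q; case: ifP => _; case: ifP => _; rewrite ?subrr ?sub0r ?subr0 ?nrmN ?nrm0 ?nrm_ge0//.
have sDt k i c' b : (sqint (transform c' (part b (D k i))) <= ((16 ^+ k)^-1)%:E)%E.
  apply: le_trans (plancherel_le c' (sDp k i b)) _; apply: le_trans (tail0 k); apply: sqint_le.
  - exact: L1fun_measurable (sDp k i b).
  - exact: measurable_outside.
  - exact: Dle.
pose badD i := [set xi | ~ forall c b, transform c (part b (D k i)) xi @[k --> \oo] --> (0 : R)].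
have nbadD i : null (badD i).
  have nD c' b : null [set xi | ~ (transform c' (part b (D k i)) xi @[k --> \oo] --> (0 : R))].
    have mt k : measurable_fun setT (transform c' (part b (D k i))) by exact: measurable_transform.
    apply: nullS (ae_geometric mt (fun k => sDt k i c' b)) => xi /=; apply: contra_not => -[M _ hM].
    exact: geometric_cvg0 hM.
  apply: nullS (null_bigcup (fun cb : bool * bool => nD cb.1 cb.2)) => xi /=.
  by move=> /existsNP[c' /existsNP[b h]]; exists (c', b).
apply: nullS (null_bigcup (fun i : 'I_n => null_shift (- (z i).2) (nullU nbad (nbadD i)))) => xi /=.
apply: contraNP => good; apply/eqP.
have hW i : ccvg (fun k => fourier (W k) (xi + (z i).2)) (g (xi + (z i).2)).
  apply: (@ccvg_fourier W (fun c b => l c b (xi + (z i).2))) => // c' b.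
  have -> : (fun k => transform c' (part b (W k)) (xi + (z i).2)) =
     (fun k => transform c' (window (N k) (part b f)) (xi + (z i).2)) by apply/funext => k; rewrite WE.
  apply: contrapT => h; apply: good; exists i => //=; left; rewrite opprK => h'.
  by apply: h; exact: h'.
have hD i : ccvg (fun k => fourier (D k i) (xi + (z i).2)) 0.
  have := @ccvg_fourier (D^~ i) (fun _ _ => 0) (xi + (z i).2) (sD^~ i).
  rewrite addr0 subr0; apply => c' b.
  apply: contrapT => h; apply: good; exists i => //=; right; rewrite opprK => h'.
  by apply: h; exact: h'.
have hF i : ccvg (fun k => fourier (F k i) (xi + (z i).2)) (g (xi + (z i).2)).
  have -> : (fun k => fourier (F k i) (xi + (z i).2)) =
     (fun k => fourier (D k i) (xi + (z i).2) + fourier (W k) (xi + (z i).2)).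
    by apply/funext => k; rewrite /D fourierB// subrK.
  by rewrite -[g _]add0r; exact: ccvgD.
have rel k : \sum_(i < n) c i * (cexp (- ((z i).1 * (xi + (z i).2))) * fourier (F k i) (xi + (z i).2)) = 0.
  apply: fourier_relation => //; apply: nullS nrel => t /=; apply: contraNneq => e0.
  have -> : \sum_(i < n) c i * tfshift (z i) (F k i) t =
      (if `|t| <= N k then 1 else 0) * \sum_(i < n) c i * tfshift (z i) f t.
    rewrite mulr_sumr; apply: eq_bigr => i _; rewrite !tfshiftE /F subrK.
    by case: ifP => _; rewrite ?mul1r// mul0r !mulr0.
  by rewrite e0 mulr0.
have lim : ccvg (fun k => \sum_(i < n) c i * (cexp (- ((z i).1 * (xi + (z i).2))) * fourier (F k i) (xi + (z i).2)))
    (\sum_(i < n) c i * (cexp (- ((z i).1 * (xi + (z i).2))) * g (xi + (z i).2))).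
  by apply: ccvg_sum => i; apply: ccvgZ; apply: ccvgZ; exact: hF.
have -> : \sum_(i < n) c i * cexp (- ((z i).1 * (z i).2)) * tfshift (- (z i).2, (z i).1) g xi =
    \sum_(i < n) c i * (cexp (- ((z i).1 * (xi + (z i).2))) * g (xi + (z i).2)).
  apply: eq_bigr => i _; rewrite tfshiftE /= opprK -mulrA; congr (_ * _).
  by rewrite mulrA -cexpD; congr (cexp _ * _); ring.
apply: ccvg_unique lim _.
have -> : (fun k => \sum_(i < n) c i * (cexp (- ((z i).1 * (xi + (z i).2))) * fourier (F k i) (xi + (z i).2))) = (fun _ => 0).
  by apply/funext => k; exact: rel.
exact: ccvg_cst.
Qed.

End FourierTransport.

(** * Symplectic transport of dependences *)

Section Systems.
Context {R : realType}.
Local Notation C := R[i].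

(** The function is quantified existentially because the symplectic normalisations
    replace it; only the points, and the coefficients up to unimodular factors,
    are followed. *)
Definition dependence n (c : 'I_n -> C) (z : 'I_n -> R * R) := exists f,
  [/\ L2fun f, ~ null [set t | f t != 0] & null [set t | \sum_(i < n) c i * tfshift (z i) f t != 0]].

Definition same_support n (c c' : 'I_n -> C) := forall i, (c' i == 0) = (c i == 0).

Lemma unit_support n (c : 'I_n -> C) (x : 'I_n -> R) : same_support c (fun i => c i * cexp (x i)).
Proof. by move=> i; rewrite mulf_eq0 (negbTE (cexp_neq0 _)) orbF. Qed.

Lemma dependence_fourier n (c : 'I_n -> C) (z : 'I_n -> R * R) : dependence c z ->
  exists2 c', same_support c c' & dependence c' (fun i => (- (z i).2, (z i).1)).
Proof.
move=> [f [Lf nf rel]]; have [g gP] := fourier_transport Lf nf rel.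
by exists (fun i => c i * cexp (- ((z i).1 * (z i).2))); [exact: unit_support|exists g].
Qed.

Lemma L2fun_unimodular (f : R -> C) (h : R -> R) : measurable_fun setT h -> L2fun f ->
  L2fun (fun t => cexp (h t) * f t).
Proof.
move=> mh [m1 m2 fin].
have mc := measurable_trig true mh; have ms := measurable_trig false mh.
split.
- have := measurable_funB (measurable_funM mc m1) (measurable_funM ms m2).
  by apply: eq_measurable_fun => t _; rewrite Re_mul.
- have := measurable_funD (measurable_funM mc m2) (measurable_funM ms m1).
  by apply: eq_measurable_fun => t _; rewrite Im_mul.
by under eq_integral => t _ do rewrite nrmM nrm_cexp mul1r.
Qed.

(** Multiplication by a chirp conjugates the shift by [(x, y)] into the shift by
    [(x, y + gamma x)], up to a unimodular factor. *)
Lemma dependence_chirp n (c : 'I_n -> C) (z : 'I_n -> R * R) (gamma : R) : dependence c z ->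
  exists2 c', same_support c c' & dependence c' (fun i => ((z i).1, (z i).2 + gamma * (z i).1)).
Proof.
move=> [f [Lf nf rel]].
exists (fun i => c i * cexp (gamma * (z i).1 ^+ 2 / 2)); first exact: unit_support.
exists (fun t => cexp (- (gamma * t ^+ 2 / 2)) * f t); split.
- apply: L2fun_unimodular => //; apply: measurable_funN => //.
  by apply: measurable_funM => //; apply: measurable_funM => //; exact: measurable_funX.
- move=> h; apply: nf; apply: nullS h => t /=.
  by rewrite mulf_eq0 (negbTE (cexp_neq0 _)).
apply: nullS rel => t /=; apply: contraNneq => e.
have -> : \sum_(i < n) c i * cexp (gamma * (z i).1 ^+ 2 / 2) *
    tfshift ((z i).1, (z i).2 + gamma * (z i).1) (fun t => cexp (- (gamma * t ^+ 2 / 2)) * f t) t =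
    cexp (- (gamma * t ^+ 2 / 2)) * \sum_(i < n) c i * tfshift (z i) f t.
  rewrite mulr_sumr; apply: eq_bigr => i _; rewrite !tfshiftE /=.
  rewrite [RHS]mulrCA -mulrA; congr (_ * _); rewrite !mulrA -!cexpD; congr (cexp _ * _); by field.
by rewrite e mulr0.
Qed.

Lemma dependence_translate n (c : 'I_n -> C) (z : 'I_n -> R * R) (w : R * R) : dependence c z ->
  exists2 c', same_support c c' & dependence c' (fun i => z i - w).
Proof.
move=> [f [Lf nf rel]].
exists (fun i => c i * cexp (- ((z i).2 * w.1))); first exact: unit_support.
exists f; split=> //.
apply: nullS (null_shift (- w.1) rel) => t /=; apply: contraNneq => e; rewrite opprK in e.
have -> : \sum_(i < n) c i * cexp (- ((z i).2 * w.1)) * tfshift (z i - w) f t =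
    cexp (w.2 * t) * \sum_(i < n) c i * tfshift (z i) f (t + w.1).
  rewrite mulr_sumr; apply: eq_bigr => i _; rewrite !tfshiftE /=.
  rewrite [RHS]mulrCA -mulrA; congr (_ * _); rewrite !mulrA -!cexpD; congr (cexp _ * f _); ring.
by rewrite e mulr0.
Qed.

Definition linear_symplectic (A : R * R -> R * R) :=
  (forall (a b : R) u v, A (a *: u + b *: v) = a *: A u + b *: A v) /\
  (forall u v, symplectic (A u) (A v) = symplectic u v).

Lemma pairE (u v : R * R) : u.1 = v.1 -> u.2 = v.2 -> u = v.
Proof. by case: u v => [a b] [c d] /= -> ->. Qed.

Lemma linear_symplectic_comp A B : linear_symplectic A -> linear_symplectic B ->
  linear_symplectic (A \o B).
Proof.
move=> [A1 A2] [B1 B2]; split=> [a b u v|u v] /=; first by rewrite B1 A1.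
by rewrite A2 B2.
Qed.

Lemma linear_symplectic_inj A : linear_symplectic A -> injective A.
Proof.
move=> [A1 A2] u v e.
have h w : symplectic u w = symplectic v w by rewrite -A2 e A2.
have := h (0, 1); have := h (1, 0); rewrite /symplectic /= !mul1r !mul0r !mulr0 !mulr1 !subr0 !sub0r.
by move=> /oppr_inj h2 h1; apply: pairE.
Qed.

Lemma comb_pair (a b : R) (u v : R * R) :
  a *: u + b *: v = (a * u.1 + b * v.1, a * u.2 + b * v.2).
Proof. by []. Qed.

Lemma linear_symplectic_shear (g : R) : linear_symplectic (fun w => (w.1, w.2 + g * w.1)).
Proof.
split=> [a b u v|u v]; last by rewrite /symplectic /=; ring.
by rewrite !comb_pair; apply: pairE => //=; ring.
Qed.

Lemma linear_symplectic_turn : linear_symplectic (fun w => (- w.2, w.1)).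
Proof.
split=> [a b u v|u v]; last by rewrite /symplectic /=; ring.
by rewrite !comb_pair; apply: pairE => //=; ring.
Qed.

(** A chirp shears [p] into a horizontal vector, which the Fourier transform turns
    by a right angle. *)
Lemma make_vertical n (c : 'I_n -> C) (z : 'I_n -> R * R) (p : R * R) : dependence c z ->
  exists A c', [/\ linear_symplectic A, (A p).1 = 0, same_support c c' & dependence c' (A \o z)].
Proof.
move=> dep; have [p0|p0] := eqVneq p.1 0.
  by exists id, c; split.
have [c1 s1 d1] := dependence_chirp (- (p.2 / p.1)) dep.
have [c2 s2 d2] := dependence_fourier d1.
exists (fun w => (- (w.2 + - (p.2 / p.1) * w.1), w.1)), c2; split=> //.
- exact: (linear_symplectic_comp linear_symplectic_turn (linear_symplectic_shear (- (p.2 / p.1)))).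
- by rewrite /= mulNr divfK// subrr oppr0.
- by move=> i; rewrite s2 s1.
Qed.

(** Once [p] is vertical, a shear fixes it and moves [r] to the horizontal axis. *)
Lemma make_frame n (c : 'I_n -> C) (z : 'I_n -> R * R) (p r : R * R) : symplectic p r != 0 ->
  dependence c z -> exists A c', [/\ linear_symplectic A, (A p).1 = 0, (A r).2 = 0,
    same_support c c' & dependence c' (A \o z)].
Proof.
move=> pr dep; have [A [c1 [lA Ap s1 d1]]] := make_vertical p dep.
have Ar : (A r).1 != 0.
  by apply: contraNneq pr => Ar; rewrite -lA.2 /symplectic Ap Ar !mul0r subrr.
pose g := - ((A r).2 / (A r).1).
have [c2 s2 d2] := dependence_chirp g d1.
pose B (w : R * R) := (w.1, w.2 + g * w.1).
have lB : linear_symplectic B := linear_symplectic_shear g.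
exists (B \o A), c2; split=> //.
- exact: linear_symplectic_comp.
- by rewrite /= /g mulNr divfK// subrr.
- by move=> i; rewrite s2 s1.
Qed.

Lemma three_points_free (c : 'I_3 -> C) (z : 'I_3 -> R * R) : injective z ->
  (exists i, c i != 0) -> ~ dependence c z.
Proof.
move=> zI [i0 ci0] dep.
have [c1 s1 d1] := dependence_translate (z ord0) dep.
pose i1 : 'I_3 := lift ord0 ord0; pose i2 : 'I_3 := lift ord0 (lift ord0 ord0).
have [A [c2 [lA Ap s2 [f [Lf nf rel]]]]] := make_vertical (z i1 - z ord0) d1.
have AI := linear_symplectic_inj lA.
have A0 : A 0 = 0 by have := lA.1 0 0 0 0; rewrite !scale0r addr0.
apply: nf; apply: (@three_points_vertical _ f (A (z i1 - z ord0)).2 (A (z i2 - z ord0)).1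
  (A (z i2 - z ord0)).2 (c2 ord0) (c2 i1) (c2 i2)) => //.
- apply/eqP => p2; have : A (z i1 - z ord0) = A 0 by rewrite A0; apply: pairE.
  by move=> /AI /eqP; rewrite subr_eq0 => /eqP /zI.
- rewrite -surjective_pairing; apply/eqP => e.
  have : A (z i2 - z ord0) = A 0 by rewrite A0.
  by move=> /AI /eqP; rewrite subr_eq0 => /eqP /zI.
- rewrite -surjective_pairing; apply/eqP => e.
  have : A (z i2 - z ord0) = A (z i1 - z ord0) by rewrite e; apply: pairE.
  by move=> /AI /addIr /zI.
- move: ci0; have <- : (c2 i0 == 0) = (c i0 == 0) by rewrite s2 s1.
  have [->|[->|->]] : i0 = ord0 \/ i0 = i1 \/ i0 = i2.
  + case: i0 => -[|[|[|//]]] h; [left|right; left|right; right]; exact: val_inj.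
  + by move=> ->.
  + by move=> ->; rewrite orbT.
  + by move=> ->; rewrite !orbT.
apply: nullS rel => t /=; apply: contraNneq => e; apply/eqP; rewrite -[RHS]e.
rewrite 3!big_ord_recl big_ord0 addr0 /= addrA !tfshiftE subrr A0 /= Ap.
by rewrite !subr0 mul0r oppr0 cexp0 mul1r.
Qed.

End Systems.

(** * The rational relation *)

Section Rationality.
Context {R : realType}.

Definition rational (x : R) := exists q : rat, x = ratr q.

Lemma rational_int (n : int) : rational n%:~R.
Proof. by exists n%:~R; rewrite ratr_int. Qed.

Lemma rationalD (x y : R) : rational x -> rational y -> rational (x + y).
Proof. by move=> [p ->] [q ->]; exists (p + q); rewrite rmorphD. Qed.

Lemma rationalM (x y : R) : rational x -> rational y -> rational (x * y).
Proof. by move=> [p ->] [q ->]; exists (p * q); rewrite rmorphM. Qed.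

Lemma rationalV (x : R) : rational x -> rational x^-1.
Proof. by move=> [p ->]; exists p^-1; rewrite fmorphV. Qed.

Lemma irrational_angleP (theta : R) : ~ rational theta -> irrational_angle theta.
Proof.
move=> nr k k0; apply/eqP => /cexp_eq1[n e]; apply: nr.
have kN : k%:R != 0 :> R by rewrite pnatr_eq0 -lt0n.
have -> : theta = n%:~R * (k%:~R)^-1 by rewrite -e -pmulrn mulrC mulKf.
by apply: rationalM; [exact: rational_int|apply: rationalV; exact: rational_int].
Qed.

Variables (alpha beta : R).
Hypothesis hdim : Qdim_eq (Qspan [tuple 1; alpha; beta]) 2.

Lemma Qcomb3 (q : 'I_3 -> rat) : Qcomb [tuple 1; alpha; beta] q =
  ratr (q ord0) + ratr (q (lift ord0 ord0)) * alpha + ratr (q (lift ord0 (lift ord0 ord0))) * beta.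
Proof. by rewrite /Qcomb 3!big_ord_recl big_ord0 !(tnth_nth 0) /= addr0 mulr1 addrA. Qed.

(** Three elements of a rational vector space of dimension two are dependent;
    clearing denominators gives an integer relation. *)
Lemma integer_relation : exists k l m : int, (k != 0) || (l != 0) /\
  k%:~R * alpha + l%:~R * beta = m%:~R.
Proof.
have [b [bfree bspan]] := hdim; set T := [tuple 1; alpha; beta] in bspan.
have inT i : Qspan b (tnth T i).
  rewrite bspan; exists (fun j => (j == i)%:R) => //.
  rewrite /Qcomb (bigD1 i)//= eqxx rmorph1 mul1r big1 ?addr0// => j /negbTE ->.
  by rewrite rmorph0 mul0r.
have /choice[s hs] i : exists q, Qcomb b q = tnth T i by have [q _ e] := inT i; exists q.
(* The coordinates of [1], [alpha] and [beta] in the basis [b]: more rows than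
   columns. *)
pose M : 'M[rat]_(3, 2) := \matrix_(i, j) s i j.
have kM : kermx M != 0.
  rewrite -mxrank_eq0 mxrank_ker subn_eq0 -ltnNge.
  by apply: leq_ltn_trans (rank_leq_col M) _.
have /rowV0Pn[v /sub_kermxP vM v0] := kM.
have e : Qcomb T (fun i => v 0 i) = 0.
  transitivity (\sum_(j < 2) ratr ((v *m M) 0 j) * tnth b j).
    under [RHS]eq_bigr => j _ do rewrite mxE rmorph_sum mulr_suml.
    rewrite exchange_big /=; apply: eq_bigr => i _; rewrite -hs mulr_sumr.
    by apply: eq_bigr => j _; rewrite rmorphM mxE mulrA.
  by rewrite vM big1// => j _; rewrite mxE rmorph0 mul0r.
rewrite Qcomb3 in e.
set v0' := v 0 ord0 in e; set v1 := v 0 (lift ord0 ord0) in e; set v2 := v 0 (lift ord0 (lift ord0 ord0)) in e.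
exists (numq v1 * denq v0' * denq v2), (numq v2 * denq v0' * denq v1), (- (numq v0' * denq v1 * denq v2)); split.
  apply: contraNT v0; rewrite negb_or !negbK !mulf_eq0 !(negbTE (denq_neq0 _)) !orbF !numq_eq0.
  move=> /andP[/eqP z1 /eqP z2]; apply/eqP/rowP => i; rewrite mxE.
  move: e; rewrite z1 z2 rmorph0 !mul0r !addr0 => /eqP; rewrite fmorph_eq0 => /eqP z0.
  have [->|[->|->]] : i = ord0 \/ i = lift ord0 ord0 \/ i = lift ord0 (lift ord0 ord0).
  + case: i => -[|[|[|//]]] h; [left|right; left|right; right]; exact: val_inj.
  + exact: z0.
  + exact: z1.
  + exact: z2.
have d0 x : (denq x)%:~R != 0 :> R by rewrite intr_eq0 denq_neq0.
apply/eqP; rewrite -subr_eq0 mulrNz opprK !intrM.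
have : ratr v0' + ratr v1 * alpha + ratr v2 * beta =
  ((numq v1)%:~R * (denq v0')%:~R * (denq v2)%:~R * alpha + (numq v2)%:~R * (denq v0')%:~R * (denq v1)%:~R * beta
   + (numq v0')%:~R * (denq v1)%:~R * (denq v2)%:~R) / ((denq v0')%:~R * (denq v1)%:~R * (denq v2)%:~R).
  by rewrite /ratr; field; rewrite !d0.
by rewrite e => /esym/eqP; rewrite mulf_eq0 invr_eq0 !mulf_eq0 !(negbTE (d0 _)) !orbF.
Qed.

(** Otherwise the span would be the line of the rational numbers. *)
Lemma not_both_rational : ~ (rational alpha /\ rational beta).
Proof.
move=> [[ra ea] [rb eb]]; have [b [bfree bspan]] := hdim.
have rat_b j : exists r, tnth b j = ratr r.
  have : Qspan b (tnth b j).
    exists (fun i => (i == j)%:R) => //.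
    rewrite /Qcomb (bigD1 j)//= eqxx rmorph1 mul1r big1 ?addr0// => i /negbTE ->.
    by rewrite rmorph0 mul0r.
  rewrite bspan => -[q _]; rewrite Qcomb3 ea eb => <-.
  by exists (q ord0 + q (lift ord0 ord0) * ra + q (lift ord0 (lift ord0 ord0)) * rb); rewrite !rmorphD !rmorphM.
pose j1 : 'I_2 := lift ord0 ord0.
have [r0 e0] := rat_b ord0; have [r1 e1] := rat_b j1.
have comb (q : 'I_2 -> rat) : Qcomb b q = ratr (q ord0) * ratr r0 + ratr (q j1) * ratr r1.
  by rewrite /Qcomb 2!big_ord_recl big_ord0 addr0 e0 e1.
have z : r0 = 0.
  have := bfree (fun i => if i == ord0 then r1 else - r0).
  rewrite comb /= => /(_ _ j1) /= h; apply: oppr_inj; rewrite oppr0; apply: h.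
  by rewrite rmorphN mulNr mulrC subrr.
have := bfree (fun i => if i == ord0 then 1 else 0).
rewrite comb /= z rmorph0 mulr0 mul0r addr0 => /(_ erefl ord0) /= /eqP.
by rewrite oner_eq0.
Qed.

(** Dividing the integer relation by the gcd of its coefficients gives a primitive
    vector, which Bezout's identity completes to a unimodular matrix. The latter
    describes the coordinates of [alpha u + beta v] in another basis of the lattice
    generated by [u] and [v]. The first coordinate is rational by construction, so
    the second is not: otherwise [alpha] and [beta] would both be rational. *)
Lemma adapted_basis : exists (k' l' k2 l2 p : int) (d : nat), [/\ k' * l2 - l' * k2 = 1, (0 < d)%N,
  d%:R * (k'%:~R * alpha + l'%:~R * beta) = p%:~R & irrational_angle (k2%:~R * alpha + l2%:~R * beta)].
Proof.
have [k [l [m [kl e]]]] := integer_relation.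
pose g := gcdz k l.
have g0 : g != 0 by rewrite gcdz_eq0 negb_and.
have gge0 : 0 <= g by [].
have [k' ek] : exists k', k = k' * g by apply/dvdzP; exact: dvdz_gcdl.
have [l' el] : exists l', l = l' * g by apply/dvdzP; exact: dvdz_gcdr.
have [x [y exy]] := Bezoutz k l.
have bez : x * k' + y * l' = 1.
  apply: (mulIf g0); rewrite mul1r mulrDl -!mulrA -ek -el; exact: exy.
exists k', l', (- y), x, m, (absz g); split.
- by rewrite mulrN opprK -[RHS]bez mulrC [l' * y]mulrC.
- by rewrite absz_gt0.
- rewrite -e ek el !intrM.
  have -> : (absz g)%:R = g%:~R :> R by rewrite -[in RHS](gez0_abs gge0) -pmulrn.
  by ring.
apply: irrational_angleP => rY.
have gR : g%:~R != 0 :> R by rewrite intr_eq0.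
have rX : rational (k'%:~R * alpha + l'%:~R * beta).
  have -> : k'%:~R * alpha + l'%:~R * beta = m%:~R * (g%:~R)^-1.
    by rewrite -e ek el !intrM; field.
  by apply: rationalM; [exact: rational_int|apply: rationalV; exact: rational_int].
have bezR : x%:~R * k'%:~R + y%:~R * l'%:~R = 1 :> R by rewrite -!intrM -intrD bez.
apply: not_both_rational; split.
  have -> : alpha = x%:~R * (k'%:~R * alpha + l'%:~R * beta) + (- l')%:~R * ((- y)%:~R * alpha + x%:~R * beta).
    transitivity ((x%:~R * k'%:~R + y%:~R * l'%:~R) * alpha); first by rewrite bezR mul1r.
    by rewrite !mulrNz; ring.
  by apply: rationalD; apply: rationalM => //; exact: rational_int.
have -> : beta = y%:~R * (k'%:~R * alpha + l'%:~R * beta) + k'%:~R * ((- y)%:~R * alpha + x%:~R * beta).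
  transitivity ((x%:~R * k'%:~R + y%:~R * l'%:~R) * beta); first by rewrite bezR mul1r.
  by rewrite !mulrNz; ring.
by apply: rationalD; apply: rationalM => //; exact: rational_int.
Qed.

End Rationality.

(** * Independence of the four shifts *)

Section FourPoints.
Context {R : realType}.
Local Notation C := R[i].

Lemma tfshift0 (f : R -> C) t : tfshift 0 f t = f t.
Proof. by rewrite tfshiftE mul0r !oppr0 cexp0 mul1r addr0. Qed.

(** The basis of [adapted_basis] is made vertical and horizontal, which turns the
    dependence into the relation of [vertical_four]. *)
Lemma four_points_free (u v : R * R) (alpha beta : R) (c : 'I_4 -> C) (z : 'I_4 -> R * R) :
  `|symplectic u v| = 1 -> Qdim_eq (Qspan [tuple 1; alpha; beta]) 2 ->
  z ord0 = 0 -> z (lift ord0 ord0) = u -> z (lift ord0 (lift ord0 ord0)) = v ->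
  z (lift ord0 (lift ord0 (lift ord0 ord0))) = alpha *: u + beta *: v ->
  (forall i, c i != 0) -> ~ dependence c z.
Proof.
move=> huv hdim z0 z1 z2 z3 c0 dep.
have [k' [l' [k2 [l2 [p [d [det d0 X Y]]]]]]] := adapted_basis hdim.
(* In the basis [(Q, P)] the fourth point is [(p / d) Q + theta P]. *)
pose P := (- l'%:~R : R) *: u + (k'%:~R : R) *: v.
pose Q := (l2%:~R : R) *: u + (- k2%:~R : R) *: v.
have detR : k'%:~R * l2%:~R - l'%:~R * k2%:~R = 1 :> R by rewrite -!intrM -intrB det.
have sPQ : symplectic P Q = - symplectic u v.
  rewrite -[RHS]mul1r -detR /P /Q !comb_pair /symplectic /=; ring.
have s0 : symplectic P Q != 0.
  by rewrite sPQ oppr_eq0 -normr_gt0 huv.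
have [A [c' [lA AP AQ cc [f [Lf nf rel]]]]] := make_frame s0 dep.
pose kappa := (A P).2; pose s := (A Q).1.
have sk : kappa * s = symplectic u v.
  have := lA.2 P Q; rewrite sPQ {1}/symplectic AP AQ !mul0r sub0r => /oppr_inj.
  by rewrite /kappa /s mulrC.
have det1 (a : R) : a = (k'%:~R * l2%:~R - l'%:~R * k2%:~R) * a by rewrite detR mul1r.
have eu : u = (k'%:~R : R) *: Q + (k2%:~R : R) *: P.
  by rewrite /P /Q !comb_pair; apply: pairE; rewrite /= [LHS]det1; ring.
have ev : v = (l'%:~R : R) *: Q + (l2%:~R : R) *: P.
  by rewrite /P /Q !comb_pair; apply: pairE; rewrite /= [LHS]det1; ring.
have Au : A u = (k'%:~R * s, k2%:~R * kappa).
  by rewrite {1}eu lA.1 comb_pair AP AQ !mulr0 addr0 add0r.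
have Av : A v = (l'%:~R * s, l2%:~R * kappa).
  by rewrite {1}ev lA.1 comb_pair AP AQ !mulr0 addr0 add0r.
have A0 : A 0 = 0 by have := lA.1 0 0 0 0; rewrite !scale0r addr0.
have dR : d%:R != 0 :> R by rewrite pnatr_eq0 -lt0n.
pose theta := k2%:~R * alpha + l2%:~R * beta.
pose h := s / d%:R.
have dh : d%:R * h = s by rewrite /h mulrC divfK.
have An : A (alpha *: u + beta *: v) = (p%:~R * h, theta * kappa).
  rewrite lA.1 Au Av comb_pair /=; apply: pairE => /=; last by rewrite /theta; ring.
  by rewrite -X -[s]dh; ring.
have uv0 : symplectic u v != 0 by rewrite -normr_gt0 huv.
have sN0 : s != 0 by apply: contraNneq uv0 => s0'; rewrite -sk s0' mulr0.
have h0 : h != 0 by rewrite mulf_neq0// invr_eq0.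
have [sigma sigma0 lat] : exists2 sigma : int, sigma != 0 & kappa * (d%:R * h) = sigma%:~R.
  rewrite dh sk; move: huv.
  have [s1|s1] := leP 0 (symplectic u v).
    by rewrite ger0_norm// => ->; exists 1.
  by rewrite ltr0_norm// => /(congr1 -%R); rewrite opprK => ->; exists (-1).
have cn i : c' i != 0 by rewrite cc.
pose i1 : 'I_4 := lift ord0 ord0; pose i2 : 'I_4 := lift ord0 (lift ord0 ord0).
pose i3 : 'I_4 := lift ord0 (lift ord0 (lift ord0 ord0)).
have quo i : - (c' i / c' i3) != 0 by rewrite oppr_eq0 mulf_neq0// invr_eq0.
apply: nf; apply: (@vertical_four R h kappa theta d p sigma (- (c' ord0 / c' i3)) (- (c' i1 / c' i3))
   (- (c' i2 / c' i3)) k' k2 l' l2) => //.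
- by rewrite det.
- apply: nullS rel => t /=; apply: contra_notN => /eqP e.
  rewrite /four_relation; apply: (mulfI (cn i3)).
  apply/eqP; rewrite -subr_eq0 -[X in _ == X]e; apply/eqP.
  rewrite 4!big_ord_recl big_ord0 addr0 /= z0 z1 z2 z3 A0 tfshift0 Au Av An !tfshiftE /= -/i1 -/i2 -/i3.
  rewrite dh.
  have ci := cn i3; field; exact: ci.
- by rewrite dh; exact: L2_decay.
Qed.

End FourPoints.

Theorem theorem2p1 (R : realType) (u v nu : R * R) (alpha beta : R)
    (huv : `|symplectic u v| = 1)
    (hnu : nu = alpha *: u + beta *: v)
    (hdistinct : uniq [:: 0; u; v; nu])
    (hdim : Qdim_eq (Qspan [tuple 1; alpha; beta]) 2)
    (f : R -> R[i]) (hf : L2fun f) (hf0 : ~ L2eq f (fun=> 0)) :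
  L2free [tuple f; tfshift u f; tfshift v f; tfshift nu f].
Proof.
move=> c rel i; apply: contrapT => /eqP ci.
pose zs : 4.-tuple (R * R) := [tuple 0; u; v; nu].
pose z i := tnth zs i.
have dep : dependence c z.
  exists f; split=> //.
    move=> nf; apply: hf0; apply: nullS nf => t /=; apply: contra_not_neq => ft _.
    by rewrite ft.
  apply: nullS rel => t /=; apply: contra_neq_not => /(_ I) e.
  apply: etrans e; apply: eq_bigr => j _; congr (_ * _).
  have [->|[->|[->|->]]] : j = ord0 \/ j = lift ord0 ord0 \/ j = lift ord0 (lift ord0 ord0) \/
      j = lift ord0 (lift ord0 (lift ord0 ord0)).
  + by case: j => -[|[|[|[|//]]]] h; [left|right; left|right; right; left|right; right; right]; exact: val_inj.
  + by rewrite /z !(tnth_nth 0) /= tfshift0.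
  + by rewrite /z !(tnth_nth 0).
  + by rewrite /z !(tnth_nth 0).
  + by rewrite /z !(tnth_nth 0).
have zI : injective z.
  move=> j k; rewrite /z !(tnth_nth 0) => /eqP; rewrite nth_uniq ?size_tuple//= => /eqP.
  exact: val_inj.
have [[k ck]|allc] := pselect (exists k, c k = 0).
  apply: (@three_points_free R (fun j => c (lift k j)) (fun j => z (lift k j))).
  - by move=> a b /zI /lift_inj.
  - have ik : k != i by apply: contraNneq ci => <-; rewrite ck.
    by have [j ij] := unlift_some ik; exists j; rewrite -ij.
  have [g [Lg ng relg]] := dep; exists g; split=> //.
  apply: nullS relg => t /=; apply: contraNneq => e.
  by rewrite (bigD1_ord k)//= ck mul0r add0r in e *; rewrite e.
apply: (@four_points_free R u v alpha beta c z) => //.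
- by move=> j; apply/eqP => cj; apply: allc; exists j.
Qed.
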